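(* Let $g\ge0$, $k\ge0$, $n\ge1$, and let $\mathcal{C}_1,\dots,\mathcal{C}_k$ be conjugacy classes in $GL_n(\mathbb{C})$. Let $Q$ be the associated crab-shaped quiver, $\alpha$ the associated dimension vector and $q$ the associated parameter (see context). Then there is an isomorphism between the character variety $\mathcal{X}(g,k,\overline{\mathcal{C}})$ and the affine quotient $$\widetilde{\mathcal{M}}_{q,0}(Q,\alpha):=\mathrm{Rep}(\Lambda^q(Q),\alpha)'/\!/GL(\alpha).$$
   Context: Character variety: $\mathcal{X}(g,k,\overline{\mathcal{C}})=\{(A_1,\dots,A_g,B_1,\dots,B_g,C_1,\dots,C_k)\in GL_n(\mathbb{C})^{2g}\times\overline{\mathcal{C}_1}\times\cdots\times\overline{\mathcal{C}_k}\mid\prod_{i=1}^g[A_i,B_i]\prod_{j=1}^kC_j=I\}/\!/GL_n(\mathbb{C})$ (affine GIT quotient under simultaneous conjugation; $[A,B]=ABA^{-1}B^{-1}$; varieties are taken reduced). It parametrises representations of the fundamental group of a genus $g$ compact Riemann surface with $k$ punctures whose monodromy around the $i$-th puncture lies in $\overline{\mathcal{C}_i}$. Associated data: for each $i$ choose $A_i\in\mathcal{C}_i$, let $w_i\ge1$ be the degree of its minimal polynomial, and choose $\xi_{i,j}\in\mathbb{C}^\times$ ($1\le j\le w_i$) with $(A_i-\xi_{i,1}I)\cdots(A_i-\xi_{i,w_i}I)=0$. Put $\alpha_{i,j}=\mathrm{rank}\,(A_i-\xi_{i,1}I)\cdots(A_i-\xi_{i,j}I)$ for $1\le j\le w_i-1$.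 The quiver $Q$ has a central vertex $0$ with $g$ loops and $k$ legs; the $i$-th leg has vertices $[i,1],\dots,[i,w_i-1]$ with arrows $[i,1]\to0$ and $[i,j+1]\to[i,j]$. The dimension vector $\alpha$ has $\alpha_0=n$ and $\alpha_{[i,j]}=\alpha_{i,j}$. The parameter $q\in(\mathbb{C}^\times)^{Q_0}$ is $q_0=\prod_{i=1}^k\xi_{i,1}^{-1}$, $q_{[i,j]}=\xi_{i,j}/\xi_{i,j+1}$. Multiplicative preprojective algebra: $\overline{Q}$ is the doubled quiver (add an arrow $a^*$ opposite to each $a\in Q_1$; $(a^* )^*=a$), $\varepsilon(a)=1$ for $a\in Q_1$ and $-1$ for $a\in\overline{Q}_1\setminus Q_1$. $\Lambda^q(Q)$ is the quotient of the universal localisation of $\mathbb{C}\overline{Q}$ in which all $1+aa^*$ ($a\in\overline{Q}_1$) are invertible by the relation $\prod^{<}_{a\in\overline{Q}_1}(1+aa^* )^{\varepsilon(a)}=\sum_iq_ie_i$ (for any fixed ordering of $\overline{Q}_1$; up to isomorphism independent of the ordering). $\mathrm{Rep}(\Lambda^q(Q),\alpha)'$ is the open affine subvariety of the (reduced) representation variety with spaces $\mathbb{C}^{\alpha_i}$ on which the linear maps representing the loops of $Q$ at the central vertex (but not necessarily their reverses in $\overline{Q}$) are invertible; $GL(\alpha)=\prod_iGL_{\alpha_i}(\mathbb{C})$. *)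

(* Defs.v *)
From HB Require Import structures.
From mathcomp Require Import all_boot all_order all_algebra.
From mathcomp Require Import boolp reals complex.
From mathcomp.multinomials Require Import monalg.

Set Implicit Arguments.
Unset Strict Implicit.
Unset Printing Implicit Defensive.

Import GRing.Theory.
Local Open Scope ring_scope.
Local Open Scope quotient_scope.

(* A (reduced) affine variety over an algebraically closed field [K] is handled
   classically: by its set of closed points together with its coordinate ring,
   seen as a ring of [K]-valued functions on the points. *)
Record variety (K : fieldType) := Variety {
  point :> Type;
  regular : (point -> K) -> Prop }.

Inductive generated (K : fieldType) (T : Type) (S : (T -> K) -> Prop) :
    (T -> K) -> Prop :=
  | gen_coord f : S f -> generated S f
  | gen_const c : generated S (fun=> c)
  | gen_add f h : generated S f -> generated S h ->
      generated S (fun x => f x + h x)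
  | gen_mul f h : generated S f -> generated S h ->
      generated S (fun x => f x * h x).

Definition isomorphic (K : fieldType) (X Y : variety K) : Prop :=
  exists (phi : X -> Y) (psi : Y -> X),
    [/\ cancel phi psi, cancel psi phi,
        forall f, regular (v := Y) f -> regular (v := X) (f \o phi)
      & forall f, regular (v := X) f -> regular (v := Y) (f \o psi)].

Definition power (K : fieldType) (I : Type) (X : variety K) : variety K :=
  @Variety K (I -> X)
    (generated (fun f => exists i h,
       regular (v := X) h /\ f =1 (fun x => h (x i)))).

(* Meant for a Zariski-closed subset [P]. *)
Definition subvariety (K : fieldType) (X : variety K) (P : X -> Prop) :
    variety K :=
  @Variety K {x : X | P x}
    (fun f => exists h, regular (v := X) h /\ f =1 (fun x => h (sval x))).

Definition zariski_closure (K : fieldType) (X : variety K) (S : X -> Prop) :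
    X -> Prop :=
  fun x => forall f, regular (v := X) f ->
    (forall y, S y -> f y = 0) -> f x = 0.

(* The affine GIT quotient Spec K[X]^G.  The group only enters through the
   relation [orb] of lying in the same orbit: an element of [K[X]^G] is a
   regular function that is constant on orbits.  The closed points of the
   spectrum are the unital [K]-algebra morphisms [K[X]^G -> K]. *)
Section GitQuotient.
Variables (K : fieldType) (X : variety K) (orb : X -> X -> Prop).

Definition invariant_fun : Type :=
  {f : X -> K | regular (v := X) f /\ forall x y, orb x y -> f x = f y}.

Definition is_character (chi : invariant_fun -> K) : Prop :=
  [/\ forall c f, sval f =1 (fun=> c) -> chi f = c,
      forall f h s, sval s =1 (fun x => sval f x + sval h x) ->
        chi s = chi f + chi h
    & forall f h p, sval p =1 (fun x => sval f x * sval h x) ->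
        chi p = chi f * chi h].

Definition git_quotient : variety K :=
  @Variety K {chi : invariant_fun -> K | is_character chi}
    (fun u => exists f, u =1 (fun chi => sval chi f)).

End GitQuotient.

Definition GL (K : fieldType) (n : nat) : variety K :=
  @Variety K {A : 'M[K]_n | A \in unitmx}
    (generated (fun f =>
       (exists i j, f =1 (fun A : {A : 'M[K]_n | A \in unitmx} => sval A i j))
       \/ f =1 (fun A : {A : 'M[K]_n | A \in unitmx} => (\det (sval A))^-1))).

Definition conjugacy_class (K : fieldType) (n : nat) (S : GL K n -> Prop) :
    Prop :=
  exists A : GL K n, forall B : GL K n,
    S B <-> exists P : GL K n, sval B = sval P *m sval A *m invmx (sval P).

Section CharacterVariety.
Variables (K : fieldType) (g k n : nat) (Cl : 'I_k -> GL K n.+1 -> Prop).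

(* A tuple (A_1..A_g, B_1..B_g, C_1..C_k) of invertible matrices. *)
Definition surface_index : Type := ('I_g + 'I_g + 'I_k)%type.

Definition matA (x : surface_index -> GL K n.+1) (i : 'I_g) : 'M[K]_n.+1 :=
  sval (x (inl (inl i))).
Definition matB (x : surface_index -> GL K n.+1) (i : 'I_g) : 'M[K]_n.+1 :=
  sval (x (inl (inr i))).
Definition matC (x : surface_index -> GL K n.+1) (j : 'I_k) : 'M[K]_n.+1 :=
  sval (x (inr j)).

Definition surface_rep : variety K :=
  @subvariety K (power surface_index (GL K n.+1)) (fun x =>
    (forall j, zariski_closure (Cl j) (x (inr j))) /\
    (\prod_(i < g) (matA x i * matB x i * (matA x i)^-1 * (matB x i)^-1)) *
      (\prod_(j < k) matC x j) = 1).

Definition simultaneously_conjugate (x y : surface_rep) : Prop :=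
  exists P : GL K n.+1, forall i,
    sval (sval y i) = sval P *m sval (sval x i) *m invmx (sval P).

Definition character_variety : variety K :=
  git_quotient simultaneously_conjugate.

End CharacterVariety.

(* The quotient of an algebra by the two-sided ideal generated by a set of
   relators.  It may be the zero ring, whereas mathcomp algebras are nontrivial,
   so its [K]-algebra structure is given by a [pzRingType] and a [lmodType K]
   structure together with [algquot_scalerAl] and [algquot_scalerAr]. *)
Inductive ideal_gen (K : fieldType) (A : algType K) (rel : A -> Prop) :
    A -> Prop :=
  | ideal_gen0 : ideal_gen rel 0
  | ideal_genD x y : ideal_gen rel x -> ideal_gen rel y ->
      ideal_gen rel (x + y)
  | ideal_genM u r v : rel r -> ideal_gen rel (u * r * v).

Section AlgebraQuotient.
Variables (K : fieldType) (A : algType K) (rel : A -> Prop).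

Definition ideal_pred : {pred A} := fun x => `[< ideal_gen rel x >].

Lemma ideal_predP x : reflect (ideal_gen rel x) (x \in ideal_pred).
Proof. exact: asboolP. Qed.

Lemma ideal_genN x : ideal_gen rel x -> ideal_gen rel (- x).
Proof.
elim=> [|y z _ Hy _ Hz|u r v Hr]; first by rewrite oppr0; constructor.
  by rewrite opprD; constructor.
by rewrite -!mulNr; constructor.
Qed.

Lemma ideal_genMl a x : ideal_gen rel x -> ideal_gen rel (a * x).
Proof.
elim=> [|y z _ Hy _ Hz|u r v Hr]; first by rewrite mulr0; constructor.
  by rewrite mulrDr; constructor.
by rewrite !mulrA; constructor.
Qed.

Lemma ideal_genMr a x : ideal_gen rel x -> ideal_gen rel (x * a).
Proof.
elim=> [|y z _ Hy _ Hz|u r v Hr]; first by rewrite mul0r; constructor.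
  by rewrite mulrDl; constructor.
by rewrite -mulrA; constructor.
Qed.

Lemma ideal_pred_zmod : zmod_closed ideal_pred.
Proof.
split=> [|x y /ideal_predP Hx /ideal_predP Hy]; apply/ideal_predP.
  exact: ideal_gen0.
by apply: ideal_genD => //; apply: ideal_genN.
Qed.

HB.instance Definition _ := GRing.isZmodClosed.Build A ideal_pred
  ideal_pred_zmod.

Definition algquot : Type := Quotient.quot ideal_pred.
HB.instance Definition _ := GRing.Zmodule.on algquot.
HB.instance Definition _ :=
  EqQuotient.copy algquot (Quotient.quot ideal_pred).

Definition proj (x : A) : algquot := \pi_algquot x.

Lemma projP (x y : A) : proj x = proj y <-> ideal_gen rel (x - y).
Proof.
split=> [/eqP|/ideal_predP H].
  by rewrite -Quotient.idealrBE => /ideal_predP.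
by apply/eqP; rewrite -Quotient.idealrBE.
Qed.

Lemma projD x y : proj (x + y) = proj x + proj y.
Proof. exact: Quotient.pi_add. Qed.

Lemma proj_repr (x : algquot) : proj (repr x) = x.
Proof. exact: reprK. Qed.

Lemma repr_proj x : ideal_gen rel (repr (proj x) - x).
Proof. by apply/projP; rewrite proj_repr. Qed.

Lemma proj_ind (P : algquot -> Prop) :
  (forall x, P (proj x)) -> forall x, P x.
Proof. by move=> H x; rewrite -[x]proj_repr. Qed.

Definition algquot_one : algquot := proj 1.
Definition algquot_mul (x y : algquot) : algquot := proj (repr x * repr y).
Definition algquot_scale (c : K) (x : algquot) : algquot :=
  proj (c *: repr x).

Lemma projM x y : proj (x * y) = algquot_mul (proj x) (proj y).
Proof.
apply/esym/projP; set x' := repr _; set y' := repr _.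
rewrite -(addrNK (x' * y) (x' * y')) -addrA -mulrBr -mulrBl.
by constructor; [apply: ideal_genMl | apply: ideal_genMr]; apply: repr_proj.
Qed.

Lemma projZ c x : proj (c *: x) = algquot_scale c (proj x).
Proof.
apply/esym/projP; rewrite -scalerBr -[X in _ *: X]mul1r scalerAl.
by apply: ideal_genMl; apply: repr_proj.
Qed.

Lemma algquot_mulA : associative algquot_mul.
Proof.
by do 3!elim/proj_ind=> ?; rewrite -!projM mulrA.
Qed.

Lemma algquot_mul1 : left_id algquot_one algquot_mul.
Proof. by elim/proj_ind=> ?; rewrite -!projM mul1r. Qed.

Lemma algquot_1mul : right_id algquot_one algquot_mul.
Proof. by elim/proj_ind=> ?; rewrite -!projM mulr1. Qed.

Lemma algquot_mulDl : left_distributive algquot_mul +%R.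
Proof. by do 3!elim/proj_ind=> ?; rewrite -projD -!projM -projD mulrDl. Qed.

Lemma algquot_mulDr : right_distributive algquot_mul +%R.
Proof. by do 3!elim/proj_ind=> ?; rewrite -projD -!projM -projD mulrDr. Qed.

HB.instance Definition _ := GRing.Zmodule_isPzRing.Build algquot
  algquot_mulA algquot_mul1 algquot_1mul algquot_mulDl algquot_mulDr.

Lemma algquot_scaleA a b x :
  algquot_scale a (algquot_scale b x) = algquot_scale (a * b) x.
Proof. by elim/proj_ind: x => x; rewrite -!projZ scalerA. Qed.

Lemma algquot_scale1 : left_id 1 algquot_scale.
Proof. by elim/proj_ind=> x; rewrite -projZ scale1r. Qed.

Lemma algquot_scaleDr : right_distributive algquot_scale +%R.
Proof.
by move=> c; do 2!elim/proj_ind=> ?; rewrite -projD -!projZ -projD scalerDr.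
Qed.

Lemma algquot_scaleDl x : {morph algquot_scale^~ x : a b / a + b}.
Proof.
by elim/proj_ind: x => x a b; rewrite /= -!projZ -projD scalerDl.
Qed.

HB.instance Definition _ := GRing.Zmodule_isLmodule.Build K algquot
  algquot_scaleA algquot_scale1 algquot_scaleDr algquot_scaleDl.

Lemma algquot_scalerAl (c : K) (x y : algquot) : c *: (x * y) = c *: x * y.
Proof.
elim/proj_ind: x => x; elim/proj_ind: y => y.
by rewrite -[LHS]/(algquot_scale _ (algquot_mul _ _)) -projM -projZ scalerAl
  projM projZ.
Qed.

Lemma algquot_scalerAr (c : K) (x y : algquot) : c *: (x * y) = x * (c *: y).
Proof.
elim/proj_ind: x => x; elim/proj_ind: y => y.
by rewrite -[LHS]/(algquot_scale _ (algquot_mul _ _)) -projM -projZ scalerAr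
  projM projZ.
Qed.

End AlgebraQuotient.

(* The free algebra K<I>. *)
Definition free_alg (K : fieldType) (I : choiceType) : Type :=
  {malg K[{fmonom I}]}.
HB.instance Definition _ (K : fieldType) (I : choiceType) :=
  GRing.Lalgebra.on (free_alg K I).

Lemma free_alg_scalerAr (K : fieldType) (I : choiceType) (c : K)
    (x y : free_alg K I) : c *: (x * y) = x * (c *: y).
Proof.
rewrite scalerAl.
rewrite (malgMEw (finmap.fsubset_refl (msupp x)) (msuppZ_le c y)).
rewrite (malgMEw (msuppZ_le c x) (finmap.fsubset_refl (msupp y))).
apply: eq_bigr => i _; apply: eq_bigr => j _.
by rewrite -!mul_malgC !mcoeffCM mulrCA mulrA.
Qed.

HB.instance Definition _ (K : fieldType) (I : choiceType) :=
  GRing.Lalgebra_isAlgebra.Build K (free_alg K I)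
    (@free_alg_scalerAr K I).

Definition gen (K : fieldType) (I : choiceType) (i : I) : free_alg K I :=
  mkmalgU (fmu i) 1.

Record quiver := Quiver {
  vertex : finType;
  arrow : finType;
  tail : arrow -> vertex;
  head : arrow -> vertex }.

(* The arrows of the doubled quiver: [inl a] is [a] and [inr a] is [a^*]. *)
Definition darrow (Q : quiver) : finType := (arrow Q + arrow Q)%type.

Definition star (Q : quiver) (a : darrow Q) : darrow Q :=
  match a with inl b => inr b | inr b => inl b end.
Definition dtail (Q : quiver) (a : darrow Q) : vertex Q :=
  match a with inl b => tail b | inr b => head b end.
Definition dhead (Q : quiver) (a : darrow Q) : vertex Q :=
  match a with inl b => head b | inr b => tail b end.

Section MultiplicativePreprojectiveAlgebra.
Variables (K : fieldType) (Q : quiver) (q : vertex Q -> K).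
Variable (s : seq (darrow Q)).

(* Paths compose like maps, from right to left, so that [a a^*] is a path at
   the head of [a].  The generators are the trivial paths, the arrows of the
   doubled quiver, and the inverses of the elements [1 + a a^*] adjoined by the
   universal localisation. *)
Definition mpa_gen : finType := (vertex Q + darrow Q + darrow Q)%type.

Definition free_e (i : vertex Q) : free_alg K mpa_gen :=
  gen K (inl (inl i) : mpa_gen).
Definition free_arr (a : darrow Q) : free_alg K mpa_gen :=
  gen K (inl (inr a) : mpa_gen).
Definition free_inv (a : darrow Q) : free_alg K mpa_gen :=
  gen K (inr a : mpa_gen).
Definition free_loc (a : darrow Q) : free_alg K mpa_gen :=
  1 + free_arr a * free_arr (star a).

(* The power of [1 + a a^*] with exponent [eps a]. *)
Definition free_factor (a : darrow Q) : free_alg K mpa_gen :=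
  match a with inl _ => free_loc a | inr _ => free_inv a end.

Inductive mpa_rel : free_alg K mpa_gen -> Prop :=
  | rel_idem i : mpa_rel (free_e i * free_e i - free_e i)
  | rel_orth i j : i != j -> mpa_rel (free_e i * free_e j)
  | rel_one : mpa_rel (\sum_i free_e i - 1)
  | rel_head a : mpa_rel (free_e (dhead a) * free_arr a - free_arr a)
  | rel_tail a : mpa_rel (free_arr a * free_e (dtail a) - free_arr a)
  | rel_inv_r a : mpa_rel (free_loc a * free_inv a - 1)
  | rel_inv_l a : mpa_rel (free_inv a * free_loc a - 1)
  | rel_mpa : mpa_rel (\prod_(a <- s) free_factor a - \sum_i q i *: free_e i).

(* The algebra [Lambda^q(Q)] for the ordering [s] of the arrows of the doubled
   quiver. *)
Definition mpa : Type := algquot mpa_rel.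
HB.instance Definition _ := GRing.PzRing.on mpa.
HB.instance Definition _ := GRing.Lmodule.on mpa.

Definition mpa_e (i : vertex Q) : mpa := proj mpa_rel (free_e i).
Definition mpa_arr (a : darrow Q) : mpa := proj mpa_rel (free_arr a).

Variable (alpha : vertex Q -> nat).

(* A [K]-algebra morphism from [mpa] to the endomorphisms of the direct sum of
   the [K^(alpha i)], written in blocks ([rho x i j] maps [K^(alpha j)] to
   [K^(alpha i)]) and sending [e_i] to the [i]-th projection.  It is unital
   because the [e_i] add up to [1]. *)
Definition is_rep (rho : mpa -> forall i j, 'M[K]_(alpha i, alpha j)) : Prop :=
  [/\ forall x y i j, rho (x + y) i j = rho x i j + rho y i j,
      forall (c : K) x i j, rho (c *: x) i j = c *: rho x i j,
      forall x y i j, rho (x * y) i j = \sum_l rho x i l *m rho y l j,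
      forall l, rho (mpa_e l) l l = 1%:M
    & forall l i j, (i != l) || (j != l) -> rho (mpa_e l) i j = 0].

Definition mpa_rep : variety K :=
  @Variety K {rho | is_rep rho}
    (generated (fun f => exists x i j u v,
       f =1 (fun r : {rho | is_rep rho} => sval r x i j u v))).

(* The principal open subset where the loops of [Q] at [v0], but not
   necessarily their reverses in the doubled quiver, act invertibly. *)
Variable (v0 : vertex Q).

Definition is_loop (a : arrow Q) : bool := (tail a == v0) && (head a == v0).
Definition loop_mx (r : mpa_rep) (a : arrow Q) : 'M[K]_(alpha v0) :=
  sval r (mpa_arr (inl a)) v0 v0.

Definition mpa_rep' : variety K :=
  let U := {r : mpa_rep | forall a, is_loop a -> loop_mx r a \in unitmx} in
  @Variety K U
    (generated (fun f : U -> K =>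
       (exists h, regular (v := mpa_rep) h /\ f =1 (fun r => h (sval r)))
       \/ (exists a, is_loop a /\
             f =1 (fun r => (\det (loop_mx (sval r) a))^-1)))).

Definition gl_equivalent (r r' : mpa_rep') : Prop :=
  exists P : forall i, GL K (alpha i), forall x i j,
    sval (sval r') x i j
      = sval (P i) *m sval (sval r) x i j *m invmx (sval (P j)).

Definition mpa_quotient : variety K := git_quotient gl_equivalent.

End MultiplicativePreprojectiveAlgebra.

Arguments mpa_quotient {K} Q q s alpha v0.

(* The crab-shaped quiver with [g] loops and [k] legs.  The central vertex is
   [None].  Leg indices start at 0: [Some (Tagged _ j)] over [i] stands for the
   vertex [i, j+1] of the [i]-th leg, [j < w i - 1].  Each leg vertex is the
   tail of exactly one arrow, which is labelled by it; the [insub] below always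
   succeeds since [j' < j]. *)
Section Crab.
Variables (g k : nat) (w : 'I_k -> nat).

Definition leg_vertex : finType := {i : 'I_k & 'I_(w i).-1}.

Definition crab_vertex : finType := option leg_vertex.
Definition crab_arrow : finType := ('I_g + leg_vertex)%type.

Definition crab_tail (a : crab_arrow) : crab_vertex :=
  match a with inl _ => None | inr p => Some p end.

Definition crab_head (a : crab_arrow) : crab_vertex :=
  match a with
  | inl _ => None
  | inr (existT i j) =>
      if val j is j'.+1 then omap (existT (fun i => 'I_(w i).-1) i) (insub j')
      else None
  end.

Definition crab : quiver := Quiver crab_tail crab_head.

End Crab.

Section CrabData.
Variables (K : fieldType) (g k n : nat) (A : 'I_k -> GL K n.+1).

Definition minpoly_degree (i : 'I_k) : nat := degree_mxminpoly (sval (A i)).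

(* [xi i j] stands for xi_{i,j+1}, for [j < minpoly_degree i]. *)
Variable (xi : 'I_k -> nat -> K).

Definition partial_product (i : 'I_k) (m : nat) : 'M[K]_n.+1 :=
  \prod_(j < m) (sval (A i) - (xi i j)%:M).

Definition crab_dim (v : vertex (crab g minpoly_degree)) : nat :=
  match v with
  | None => n.+1
  | Some (existT i j) => \rank (partial_product i j.+1)
  end.

Definition crab_param (v : vertex (crab g minpoly_degree)) : K :=
  match v with
  | None => \prod_i (xi i 0%N)^-1
  | Some (existT i j) => xi i j / xi i j.+1
  end.

End CrabData.

Arguments crab_dim {K} g {k n} A xi v.
Arguments crab_param {K} g {k n} A xi v.

(* Main.v *)
(* The quotient map sends a representation of the crab-shaped quiver to the
   tuple of all [a_i], [1 + a_i b_i] and [xi_j1 (1 + phi_j psi_j)], where [b_i]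
   is the map of the reversed loop [a_i], and [phi_j], [psi_j]
   act between the centre and the first vertex of the [j]-th leg.  The loop
   [a_i] being invertible, [(1 + b_i a_i)^-1 = a_i^-1 (1 + a_i b_i)^-1 a_i],
   so the relation at the centre becomes a word relation in this tuple, which an
   automorphism of [GL_n^(2g+k)] given by words turns into the surface relation,
   whatever the ordering of the arrows.

   - Legs.  A matrix [B] lies in the closure of the class of [A] iff
     [rank p(B) <= rank p(A)] for all products [p] of linear factors, iff [B]
     comes from a representation of the leg.  The rank condition is closed, and
     it descends along a leg when the image of [B - xi] is enlarged by the right
     piece of the filtration [im M + ker M^s], [M = B - xi].  Conversely the leg
     representation so obtained lies on a line that generically stays in the
     class of [A].
   - Invariants.  The invariants of the base changes along the legs are the
     functions of the central tuple.  The leg vertices are removed one by one,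
     from the ends, with the first fundamental theorem for [GL_r]; it applies to
     the non-normal, non-closed situation at hand because over the complex
     numbers an invariant function on a stable set lifts to an invariant
     polynomial, by orthogonal projection for a Hermitian form. *)

Require Import Defs.
From HB Require Import structures.
From mathcomp Require Import all_boot all_order all_algebra.
From mathcomp Require Import boolp reals complex zify.
From mathcomp.multinomials Require Import monalg.

Set Implicit Arguments.
Unset Strict Implicit.
Unset Printing Implicit Defensive.

Import Order.TTheory GRing.Theory Num.Theory.
Local Open Scope ring_scope.


(** * Ranks of polynomials in a matrix, and legs *)

(** No theory of quotients is needed: a regular map that is surjective, lifts orbits, and through
    which every invariant regular function factors identifies the two rings of invariants, hence
    their characters. The obstacle is the last condition. The varieties are reduced, so a regular
    function is known only by its values, and a polynomial that represents an invariant function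
    need not be invariant. Orthogonal projection in a finite-dimensional space of tensors corrects
    this; it only asks that the acting family be closed under adjoints. Since the first fundamental
    theorem concerns polynomials, the inverses adjoined by the localisation must be removed
    beforehand: along a leg they are computed from its far end by 1 - X (1 + YX)^-1 Y, the inverse
    of 1 + XY. The theorem is proved for an inner dimension at most the outer one, as holds for the
    ranks along a leg. Conjugacy classes are handled by ranks and rank factorisations alone: no
    Jordan form occurs, and density is only used on lines, hence for polynomials in one variable. *)

Section RootProduct.
Variable K : fieldType.

Definition root_prod n (A : 'M[K]_n) (cs : seq K) : 'M[K]_n :=
  foldr (fun c M => (A - c%:M) *m M) 1%:M cs.

(** For a matrix [A] that carries leg data this becomes the closure relation of conjugacy classes
    ([leg_closure]). Testing split polynomials, repeated roots included, suits inductions on the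
    list of roots. *)
Definition rank_le n (B A : 'M[K]_n) : Prop :=
  forall cs, (\rank (root_prod B cs) <= \rank (root_prod A cs))%N.

Lemma root_prod_cat n (A : 'M[K]_n) cs ds :
  root_prod A (cs ++ ds) = root_prod A cs *m root_prod A ds.
Proof. by elim: cs => [|c cs IH] /=; rewrite ?mul1mx // IH mulmxA. Qed.

Lemma root_prod_comm n (A : 'M[K]_n) c cs :
  (A - c%:M) *m root_prod A cs = root_prod A cs *m (A - c%:M).
Proof.
elim: cs => [|d cs IH] /=; first by rewrite mul1mx mulmx1.
rewrite -mulmxA -IH !mulmxA; congr (_ *m _).
by rewrite !mulmxBl !mulmxBr -!scalar_mxM !mul_scalar_mx !mul_mx_scalar [d * c]mulrC
  !opprB addrACA [in RHS]addrACA; congr (_ + _); rewrite addrC.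
Qed.

Lemma root_prod_comm2 n (A : 'M[K]_n) cs ds :
  root_prod A cs *m root_prod A ds = root_prod A ds *m root_prod A cs.
Proof.
elim: cs => [|c cs IH] /=; first by rewrite mul1mx mulmx1.
by rewrite -mulmxA IH !mulmxA root_prod_comm.
Qed.

Lemma root_prod_perm n (A : 'M[K]_n) cs ds :
  perm_eq cs ds -> root_prod A cs = root_prod A ds.
Proof.
elim: cs ds => [|c cs IH] ds.
  by rewrite perm_sym => /perm_nilP ->.
move=> H; have : c \in ds by rewrite -(perm_mem H) inE eqxx.
move=> /splitPr E; case: E H => d1 d2 H.
have {}H : perm_eq cs (d1 ++ d2).
  by rewrite -(perm_cons c); apply: perm_trans H _; rewrite (perm_catCA d1 [:: c] d2).
by rewrite /= (IH _ H) !root_prod_cat /= !mulmxA root_prod_comm.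
Qed.

Lemma comm_root_prod n (A X : 'M[K]_n) cs : A *m X = X *m A ->
  root_prod A cs *m X = X *m root_prod A cs.
Proof.
move=> H; elim: cs => [|c cs IH] /=; first by rewrite mul1mx mulmx1.
by rewrite -mulmxA IH !mulmxA mulmxBl mulmxBr H scalar_mxC.
Qed.

(** Bezout for coprime polynomials, evaluated at [A]. Since X - d = (X - c) + (c - d), each new root
    [d] divides [U] by [c - d], and the surplus multiple of X - c goes into [V]. *)
Lemma root_prod_coprime n (A : 'M[K]_n) c cs : c \notin cs ->
  exists U V, [/\ A *m U = U *m A, A *m V = V *m A &
    U *m root_prod A cs + V *m (A - c%:M) = 1%:M].
Proof.
elim: cs => [_|d cs IH].
  by exists 1%:M, 0; rewrite !mulmx1 !mul0mx !mul1mx !mulmx0 addr0.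
rewrite inE negb_or => /andP[cd /IH [U [V [HU HV E]]]].
exists ((c - d)^-1 *: U), (V - (c - d)^-1 *: (U *m root_prod A cs)).
have nz : c - d != 0 by rewrite subr_eq0.
have HP : A *m root_prod A cs = root_prod A cs *m A.
  have := root_prod_comm A 0 cs; rewrite raddf0 subr0 //.
split.
- by rewrite -scalemxAl -scalemxAr HU.
- rewrite mulmxBl mulmxBr HV; congr (_ - _).
  by rewrite -scalemxAl -scalemxAr mulmxA HU -!mulmxA HP.
set P := root_prod A cs in HP E *.
have E2 : U *m ((A - d%:M) *m P) = U *m P *m (A - c%:M) + (c - d) *: (U *m P).
  rewrite -mulmxA scalemxAr -mulmxDr; congr (_ *m _).
  by rewrite mulmxBl mulmxBr HP mul_scalar_mx mul_mx_scalar scalerBl addrA subrK.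
rewrite /= -/P -scalemxAl E2 scalerDr scalerA mulVf // scale1r mulmxBl -scalemxAl.
by rewrite [X in _ + X]addrC addrACA subrr add0r.
Qed.


Lemma root_prod_intertwine m n (X : 'M[K]_(m, n)) (Y : 'M[K]_(n, m)) c cs :
  root_prod (X *m Y + c%:M) cs *m X = X *m root_prod (Y *m X + c%:M) cs.
Proof.
elim: cs => [|d cs IH] /=; first by rewrite mul1mx mulmx1.
rewrite -mulmxA IH !mulmxA; congr (_ *m _).
by rewrite mulmxBl mulmxBr mulmxDl mulmxDr !scalar_mxC mulmxA.
Qed.

Lemma root_prod_factor n r (A : 'M[K]_n) c (F : 'M_(n, r)) (G : 'M_(r, n)) cs :
  A - c%:M = F *m G ->
  root_prod A (c :: cs) = F *m root_prod (G *m F + c%:M) cs *m G.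
Proof.
move=> E; have -> : A = F *m G + c%:M by rewrite -E subrK.
by rewrite -mulmxA root_prod_intertwine /= addrK mulmxA.
Qed.

(** For row vectors, the rows of [G] form a basis of the image of [A - c], and [G *m F + c%:M] is
    the matrix of [A] on that image. *)
Lemma rank_root_prod_factor n r (A : 'M[K]_n) c (F : 'M_(n, r)) (G : 'M_(r, n)) cs :
  A - c%:M = F *m G -> row_full F -> row_free G ->
  \rank (root_prod (G *m F + c%:M) cs) = \rank (root_prod A (c :: cs)).
Proof.
move=> E fF fG; rewrite (root_prod_factor cs E).
by rewrite mxrankMfree // (eqmxMfull _ fF).
Qed.

Lemma submx_interpolate m1 m2 n (X : 'M[K]_(m1, n)) (Y : 'M_(m2, n)) r :
  (X <= Y)%MS -> (\rank X <= r <= \rank Y)%N ->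
  exists V : 'M_(r, n), [/\ row_free V, (X <= V)%MS & (V <= Y)%MS].
Proof.
move=> sXY /andP[rX rY].
suff: exists V : 'M_n, [/\ \rank V = r, (X <= V)%MS & (V <= Y)%MS].
  move=> [V [<- XV VY]]; exists (row_base V).
  by rewrite row_base_free !eq_row_base.
elim: r rX rY => [|r IH].
  rewrite leqn0 => /eqP rX _; exists <<X>>%MS.
  by rewrite !genmxE rX.
rewrite leq_eqVlt => /orP[/eqP rX _|]; first by exists <<X>>%MS; rewrite !genmxE.
rewrite ltnS => rX rY; have [V [rV XV VY]] := IH rX (ltnW rY).
have : ~~ (Y <= V)%MS.
  by apply: contraL rY => /mxrankS; rewrite rV -ltnNge.
move=> /row_subPn[i Hi]; exists (V + row i Y)%MS; split.
- apply/eqP; rewrite eqn_leq; apply/andP; split.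
    have := rank_leq_row (row i Y); have := mxrank_adds_leqif V (row i Y) => /leqifP; case: ifP => _; lia.
  rewrite -rV; apply: rank_ltmx; rewrite ltmxE addsmxSl /=.
  by apply: contra Hi; apply: submx_trans (addsmxSr _ _).
- exact: submx_trans XV (addsmxSl _ _).
by rewrite addsmx_sub VY row_sub.
Qed.

(** The ranks of the powers of [M] cannot drop for ever; once [P s] and [P s.+1] have the same
    image, every vector differs from one in the image of [M] by one killed by [P s]. The powers
    enter through a recursion so that [root_prod] of constant lists can be substituted. *)
Lemma fitting n (M : 'M[K]_n) (P : nat -> 'M_n) :
  P 0%N = 1%:M -> (forall s, P s.+1 = M *m P s) ->
  exists s, row_full (M + kermx (P s))%MS.
Proof.
move=> P0 PS.
have [s Hs] : exists s, (\rank (P s) <= \rank (P s.+1))%N.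
  apply: contrapT => H.
  suff: forall s, (\rank (P s) + s <= n)%N.
    by move=> /(_ n.+1); rewrite addnS ltnNge leq_addl.
  elim=> [|s IH]; first by rewrite addn0 rank_leq_row.
  rewrite addnS -addSn; apply: leq_trans IH; rewrite leq_add2r ltnNge.
  by apply/negP => le; apply: H; exists s.
exists s; have sub : (P s.+1 <= P s)%MS by rewrite PS submxMl.
have : (P s <= P s.+1)%MS by rewrite -(geq_leqif (mxrank_leqif_sup sub)).
move=> /submxP[X EX]; rewrite -sub1mx.
have -> : 1%:M = X *m M + (1%:M - X *m M) by rewrite addrC subrK.
apply: addmx_sub_adds; first exact: submxMl.
by apply/sub_kermxP; rewrite mulmxBl mul1mx -mulmxA -PS -EX subrr.
Qed.


Lemma perm_nseq_filter (c : K) cs :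
  perm_eq cs (nseq (count_mem c cs) c ++ filter (predC1 c) cs).
Proof.
rewrite -(perm_filterC (pred1 c)) perm_sym; apply: perm_cat => //.
by rewrite -size_filter; have /all_pred1P <- := filter_all (pred1 c) cs.
Qed.

Lemma ker_root_prod_sub n (A : 'M[K]_n) c cs m (u : 'M_(m, n)) : c \notin cs ->
  u *m root_prod A cs = 0 -> (u <= A - c%:M)%MS.
Proof.
move=> ccs u0; have [U [V [HU HV E]]] := root_prod_coprime A ccs.
rewrite -[u]mulmx1 -E mulmxDr -(comm_root_prod _ HU) !mulmxA u0 mul0mx add0r.
exact: submxMl.
Qed.

(* [Q] spans a subspace [V] between two consecutive terms of the filtration
   [im M + ker M^s].  For [t] the multiplicity of [c] in the polynomial [p],
   either [V <= im M + ker M^t], so that [p(B)] maps [V] into the image of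
   [p(B) M], or [V] contains the kernel of [p(B)]: both bound [rank p(B)|_V]. *)
Lemma rank_le_factor n r (A B : 'M[K]_n) c (F : 'M_(n, r)) (G : 'M_(r, n)) :
  A - c%:M = F *m G -> row_full F -> row_free G -> rank_le B A ->
  exists (P : 'M_(n, r)) (Q : 'M_(r, n)), [/\ B - c%:M = P *m Q, row_free Q &
    rank_le (Q *m P + c%:M) (G *m F + c%:M)].
Proof.
move=> EA fF fG BA; pose M := B - c%:M; pose W s := root_prod B (nseq s c).
have rA : \rank (A - c%:M) = r.
  by rewrite EA mxrankMfree // (eqP fF).
have rM : (\rank M <= r)%N.
  by have := BA [:: c]; rewrite /= !mulmx1 rA.
pose f s : 'M_n := (M + kermx (W s))%MS.
have f_mono s t : (s <= t)%N -> (f s <= f t)%MS.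
  move=> st; apply: addsmxS => //; apply/sub_kermxP.
  rewrite /W -(subnKC st) nseqD root_prod_cat mulmxA.
  by have /sub_kermxP -> := submx_refl (kermx (W s)); rewrite mul0mx.
have exs : exists s, (r <= \rank (f s))%N.
  have [] := @fitting _ M W => // s fs; exists s.
  by rewrite /f (eqP fs) -rA rank_leq_row.
have [V [fV MV Vs]] : exists V : 'M_(r, n),
    [/\ row_free V, (M <= V)%MS & forall s, (V <= f s)%MS \/ (f s <= V)%MS].
  (* At the least index where the rank of [f] reaches [r], [V] is squeezed between this term and the
     preceding one, hence is comparable with every term. At index 0 it lies between [M] and [f 0],
     whose kernel part is zero. *)
  case: (ex_minnP exs) => -[|s] rs smin.
    have [||V [fV MV Vf]] := @submx_interpolate _ _ _ M (f 0%N) r.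
    - exact: addsmxSl.
    - by rewrite rM rs.
    exists V; split=> // s; left; exact: submx_trans Vf (f_mono _ _ _).
  have lt : (\rank (f s) < r)%N.
    by rewrite ltnNge; apply/negP => /smin; rewrite ltnn.
  have [||V [fV fsV Vf]] := @submx_interpolate _ _ _ (f s) (f s.+1) r.
  - exact: f_mono.
  - by rewrite rs (ltnW lt).
  exists V; split=> //; first exact: submx_trans (addsmxSl _ _) fsV.
  move=> t; case: (leqP t s) => ts; [right|left].
    exact: submx_trans (f_mono _ _ ts) fsV.
  exact: submx_trans Vf (f_mono _ _ ts).
have /submxP[P EM] := MV.
exists P, V; split=> // cs; rewrite (rank_root_prod_factor cs EA) //.
have EB : B = P *m V + c%:M by rewrite -EM subrK.
rewrite -(mxrankMfree _ fV) root_prod_intertwine -EB.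
set cs' := filter (predC1 c) cs; set t := count_mem c cs.
have perm := perm_nseq_filter c cs.
have ccs' : c \notin cs' by rewrite mem_filter /= eqxx.
have Ecs : root_prod B cs = W t *m root_prod B cs'.
  by rewrite (root_prod_perm _ perm) root_prod_cat.
case: (Vs t) => [Vft|fVt].
  apply: leq_trans (BA (c :: cs)).
  apply: (@leq_trans (\rank (f t *m root_prod B cs))).
    by apply: mxrankS; apply: submxMr.
  apply: mxrankS; rewrite addsmxMr addsmx_sub submx_refl /=.
  rewrite Ecs mulmxA; have /sub_kermxP -> := submx_refl (kermx (W t)).
  by rewrite mul0mx sub0mx.
have kV : (kermx (root_prod B cs) <= V)%MS.
  apply: submx_trans fVt; set k := kermx _.
  have k0 : k *m root_prod B cs' *m W t = 0.
    by rewrite -mulmxA root_prod_comm2 -Ecs; apply/sub_kermxP.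
  have [U [X [HU HX EX]]] := root_prod_coprime B ccs'.
  rewrite -[k]mulmx1 -EX mulmxDr addrC; apply: addmx_sub_adds.
    by rewrite mulmxA submxMl.
  apply/sub_kermxP; rewrite -(comm_root_prod _ HU) !mulmxA -(mulmxA _ U).
  by rewrite -(comm_root_prod _ HU) mulmxA k0 mul0mx.
(* As [V] contains ker p(B), the rank of p(B) on [V] is r - (n - rank p(B)). This is at most r - (n
   - rank p(A)), a lower bound for the rank of the product of A - c and p(A). *)
have r1 := mxrank_mul_ker V (root_prod B cs).
have r2 : \rank (V :&: kermx (root_prod B cs))%MS = (n - \rank (root_prod B cs))%N.
  by rewrite -mxrank_ker; apply/eqP; rewrite (mxrank_leqif_sup (capmxSr _ _)).2 sub_capmx kV submx_refl.
have r3 := BA cs; have r4 := mxrank_mul_min (A - c%:M) (root_prod A cs).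
rewrite /= rA in r4 *; rewrite (eqP fV) in r1.
apply: leq_trans r4.
move: (rank_leq_row (root_prod B cs)) (rank_leq_row (root_prod A cs)) => r5 r6.
by rewrite r2 in r1; lia.
Qed.


(* The conditions satisfied by the matrix [A] at the root of a leg with [m]
   vertices: [d j] is the dimension at the [j]-th vertex, [d 0] being that at
   the root, and [xi j] stands for [xi_{j+1}]. *)
Definition leg_type m (d : nat -> nat) (xi : nat -> K) (A : 'M[K]_(d 0)) : Prop :=
  (forall j, (j <= m)%N -> \rank (root_prod A (mkseq xi j)) = d j) /\
  root_prod A (mkseq xi m.+1) = 0.

(* The endomorphism [D_j] at the [j]-th vertex, computed from the maps that join
   it to the previous one; the leg relations say that it agrees with
   [xi_j (1 + phi_j psi_j)], and with the scalar [xi_m] at the last vertex. *)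
Definition leg_map (d : nat -> nat) (xi : nat -> K)
    (phi : forall j, 'M[K]_(d j, d j.+1)) (psi : forall j, 'M[K]_(d j.+1, d j))
    (C : 'M[K]_(d 0)) (j : nat) : 'M[K]_(d j) :=
  match j with
  | 0 => C
  | j'.+1 => xi j' *: (1%:M + psi j' *m phi j')
  end.

Definition leg_rep m (d : nat -> nat) (xi : nat -> K)
    (phi : forall j, 'M[K]_(d j, d j.+1)) (psi : forall j, 'M[K]_(d j.+1, d j))
    (C : 'M[K]_(d 0)) : Prop :=
  (forall j, (j < m)%N ->
     leg_map xi phi psi C j = xi j *: (1%:M + phi j *m psi j)) /\
  leg_map xi phi psi C m = (xi m)%:M.

Lemma leg_repS m (d : nat -> nat) (xi : nat -> K) phi psi C :
  @leg_rep m.+1 d xi phi psi C <->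
  C = xi 0%N *: (1%:M + phi 0%N *m psi 0%N) /\
  @leg_rep m (d \o S) (xi \o S) (fun j => phi j.+1) (fun j => psi j.+1)
    (xi 0%N *: (1%:M + psi 0%N *m phi 0%N)).
Proof.
split=> [[H1 H2]|[H0 [H1 H2]]].
  split; first exact: (H1 0%N).
  split=> [j jm|]; last by case: m H1 H2.
  by have := H1 j.+1 jm; case: j jm.
split=> [[|j] jm //|]; last by case: m H1 H2.
by have := H1 j jm; case: j jm.
Qed.

(** The induction step along a leg: [A] is replaced by its restriction to the image of [A - xi_1],
    written in a basis of [d 1] vectors. The casts are due to the rank being equal to [d 1] only
    propositionally. *)
Lemma leg_typeS m (d : nat -> nat) (xi : nat -> K) (A : 'M[K]_(d 0)) : @leg_type m.+1 d xi A ->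
  exists (F : 'M_(d 0, d 1)) (G : 'M_(d 1, d 0)), [/\ A - (xi 0%N)%:M = F *m G,
    row_full F, row_free G &
    @leg_type m (d \o S) (xi \o S) (G *m F + (xi 0%N)%:M)].
Proof.
move=> [H1 H2]; set M := A - _.
have r1 : \rank M = d 1 by rewrite -(H1 1%N) //= mulmx1.
pose F : 'M_(d 0, d 1) := castmx (erefl, r1) (col_base M).
pose G : 'M_(d 1, d 0) := castmx (r1, erefl) (row_base M).
have E : M = F *m G.
  rewrite -[M in LHS]mulmx_base /F /G {F G}; move: (col_base M) (row_base M).
  by case: _ / r1 => a b; rewrite !castmx_id.
have fF : row_full F.
  rewrite /F {F G E}; move: (col_base_full M); move: (col_base M).
  by case: _ / r1 => a; rewrite castmx_id.
have fG : row_free G by rewrite row_free_castmx row_base_free.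
have mkS j : mkseq xi j.+1 = xi 0%N :: mkseq (xi \o S) j.
  by rewrite /mkseq /= (iotaDl 1 0) -map_comp.
exists F, G; split=> //; split=> [j jm|].
  by rewrite /= (rank_root_prod_factor _ E) // -mkS H1.
move: H2; rewrite mkS (root_prod_factor _ E) => H2.
have /row_freeP[G' GG'] := fG; have /row_fullP[F' FF'] := fF.
set R := root_prod _ _ in H2 *.
have -> : R = F' *m (F *m R *m G) *m G'.
  by rewrite !mulmxA FF' mul1mx -mulmxA GG' mulmx1.
by rewrite H2 mulmx0 mul0mx.
Qed.

Lemma leg_rep_exists m (d : nat -> nat) (xi : nat -> K) (A B : 'M[K]_(d 0)) :
  (forall j, (j <= m)%N -> xi j != 0) ->
  @leg_type m d xi A -> rank_le B A -> exists phi psi, @leg_rep m d xi phi psi B.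
Proof.
elim: m d xi A B => [|m IH] d xi A B xi0.
  move=> [_ H] BA; exists (fun=> 0), (fun=> 0); split=> //=.
  have := BA [:: xi 0%N]; move: H; rewrite /mkseq /= => ->.
  by rewrite mxrank0 leqn0 mxrank_eq0 mulmx1 subr_eq0 => /eqP.
move=> /leg_typeS [F [G [E fF fG tA]]] BA.
have [P [Q [EB _ le]]] := rank_le_factor E fF fG BA.
have [phi [psi H]] := IH (d \o S) (xi \o S) _ _ (fun j => xi0 j.+1) tA le.
(* [B = xi_1 + P Q] has to take the form [xi_1 (1 + phi psi)], so the inverse of xi_1 is absorbed in
   [phi]. *)
exists (fun j => match j return 'M_(d j, d j.+1) with
  0 => (xi 0%N)^-1 *: P | j'.+1 => phi j' end).
exists (fun j => match j return 'M_(d j.+1, d j) with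
  0 => Q | j'.+1 => psi j' end).
have xi00 := xi0 0%N isT.
apply/leg_repS; split.
  rewrite scalerDr scalemx1 -scalemxAl scalerA divff // scale1r -EB addrC.
  by rewrite subrK.
rewrite scalerDr scalemx1 -scalemxAr scalerA divff // scale1r addrC.
exact: H.
Qed.

(** Let [c] be the first root. If [c] occurs in [cs], then p(B) factors through the next vertex and
    the inductive bound applies. If not, [Q] embeds ker p(QP + c) into ker p(B), because a vector
    killed by [Q] is an eigenvector for [c], which is no root of p; and ker p(A) lies in the image
    of [A - c], so its dimension is read off exactly at the next vertex. *)
Lemma leg_rep_rank_le m (d : nat -> nat) (xi : nat -> K) phi psi (A B : 'M[K]_(d 0)) :
  (forall j, (j <= m)%N -> xi j != 0) ->
  @leg_type m d xi A -> @leg_rep m d xi phi psi B -> rank_le B A.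
Proof.
elim: m d xi phi psi A B => [|m IH] d xi phi psi A B xi0.
  move=> [_ H] [_ /= ->].
  suff -> : A = (xi 0%N)%:M by [].
  by apply/eqP; rewrite -subr_eq0; apply/eqP; rewrite -H /= mulmx1.
move=> /leg_typeS [F [G [E fF fG tA]]] /leg_repS [EB H].
have le := IH _ _ _ _ _ _ (fun j => xi0 j.+1) tA H.
have xi00 := xi0 0%N isT; move: (phi 0%N) (psi 0%N) EB H le {IH} => P0 Q.
set c := xi 0%N in E xi00 tA *; set D := c *: (1%:M + Q *m P0) => EB _ le.
pose P := c *: P0.
have {}EB : B - c%:M = P *m Q.
  by rewrite EB scalerDr scalemx1 addrC addrA addNr add0r scalemxAl.
have ED : D = Q *m P + c%:M by rewrite /D scalerDr scalemx1 -scalemxAr addrC.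
rewrite {}ED in le.
move=> cs; have perm := perm_nseq_filter c cs.
have [ccs|ccs] := boolP (c \in cs).
  have /perm_to_rem pc := ccs.
  rewrite !(root_prod_perm _ pc) (root_prod_factor _ EB).
  rewrite -(rank_root_prod_factor _ E) //; apply: leq_trans (le _).
  by apply: leq_trans (mxrankM_maxl _ _) _; apply: mxrankM_maxr.
set p := root_prod (Q *m P + c%:M) cs.
have EB' : B = P *m Q + c%:M by rewrite -EB subrK.
have kp : (kermx p *m Q <= kermx (root_prod B cs))%MS.
  apply/sub_kermxP; rewrite -mulmxA EB' -root_prod_intertwine mulmxA.
  by rewrite mulmx_ker mul0mx.
have rk : \rank (kermx p *m Q) = \rank (kermx p).
  apply/eqP; rewrite eqn_leq mxrankM_maxl /=.
  rewrite -(mxrank_mul_ker (kermx p) Q).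
  suff -> : (kermx p :&: kermx Q)%MS = 0 by rewrite mxrank0 addn0.
  apply/eqP/rowV0P => v; rewrite sub_capmx => /andP[/sub_kermxP v1 /sub_kermxP v2].
  have [U [V [HU HV EU]]] := root_prod_coprime (Q *m P + c%:M) ccs.
  rewrite addrK in EU; rewrite -[v]mulmx1 -EU mulmxDr -(comm_root_prod _ HU).
  rewrite mulmxA v1 mul0mx add0r.
  have HV' : Q *m P *m V = V *m (Q *m P).
    by move: HV; rewrite mulmxDl mulmxDr scalar_mxC => /addIr.
  by rewrite -HV' !mulmxA v2 !mul0mx.
have := mxrankS kp; rewrite rk !mxrank_ker => le1.
have le2 : (\rank p <= \rank ((A - c%:M) *m root_prod A cs))%N.
  by have := le cs; rewrite (rank_root_prod_factor _ E).
have rA : \rank (A - c%:M) = d 1 by rewrite E mxrankMfree // (eqP fF).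
have := mxrank_mul_ker (A - c%:M) (root_prod A cs); rewrite rA.
have -> : \rank ((A - c%:M) :&: kermx (root_prod A cs))%MS
    = (d 0 - \rank (root_prod A cs))%N.
  rewrite -mxrank_ker; apply/eqP.
  rewrite (mxrank_leqif_sup (capmxSr _ _)).2 sub_capmx submx_refl andbT.
  by apply: ker_root_prod_sub ccs _; rewrite mulmx_ker.
move: (rank_leq_row (root_prod A cs)) (rank_leq_row (root_prod B cs)).
have arith (x y a b e f : nat) : (f - x <= e - b)%N -> (x <= y)%N ->
    (a <= e)%N -> (b <= e)%N -> (y + (e - a))%N = f -> (b <= a)%N by lia.
exact: arith le1 le2.
Qed.

Lemma equiv_row_free m n (X Y : 'M[K]_(m, n)) : row_free X -> row_free Y ->
  exists2 Z, Z \in unitmx & X = Y *m Z.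
Proof.
move=> fX fY; have EX : Y *m (pinvmx Y *m X) = X by rewrite mulmxA mulmxVp ?mul1mx.
have [|Z uZ E] := @complete_unitmx _ _ _ Y (pinvmx Y *m X).
  by rewrite EX (eqP fX) (eqP fY).
by exists Z => //; rewrite -E EX.
Qed.

Lemma equiv_row_full m n (X Y : 'M[K]_(m, n)) : row_full X -> row_full Y ->
  exists2 Z, Z \in unitmx & X = Z *m Y.
Proof.
rewrite /row_full -(mxrank_tr X) -(mxrank_tr Y) => fX fY.
have [Z uZ E] := @equiv_row_free _ _ X^T Y^T fX fY.
by exists Z^T; rewrite ?unitmx_tr // -[X]trmxK E trmx_mul trmxK.
Qed.

(* In bases where [F = F' = (1 0)^T], the conjugating matrix is found modulo the
   column space of [N = G F]. *)
Lemma full_factor_conj_block r m (F F' : 'M[K]_(r + m, r)) (G G' : 'M_(r, r + m)) :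
  row_full F -> row_full F' -> row_free G -> row_free G' -> G *m F = G' *m F' ->
  exists2 g, g \in unitmx & g *m F = F' /\ G' *m g = G.
Proof.
pose F0 : 'M[K]_(r + m, r) := col_mx 1%:M 0.
have fF0 : row_full F0.
  by apply/row_fullP; exists (row_mx 1%:M 0); rewrite mul_row_col mul1mx mul0mx addr0.
suff key (H H' : 'M_(r, r + m)) : row_free H -> row_free H' ->
    H *m F0 = H' *m F0 -> exists2 g, g \in unitmx & g *m F0 = F0 /\ H' *m g = H.
  move=> fF fF' fG fG' E.
  have [P uP EP] := equiv_row_full fF fF0.
  have [P' uP' EP'] := equiv_row_full fF' fF0.
  have [|||g ug [Eg1 Eg2]] := key (G *m P) (G' *m P').
  - by rewrite /row_free mxrankMfree // row_free_unit.
  - by rewrite /row_free mxrankMfree // row_free_unit.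
  - by rewrite -!mulmxA -EP -EP'.
  exists (P' *m g *m invmx P); first by rewrite !unitmx_mul uP' ug unitmx_inv.
  split; first by rewrite EP !mulmxA mulmxKV // -mulmxA Eg1 -EP'.
  by rewrite !mulmxA Eg2 mulmxK.
move=> fH fH'; rewrite -[H]hsubmxK -[H']hsubmxK.
move: fH fH'; rewrite -[H]hsubmxK -[H']hsubmxK.
move: (lsubmx H) (rsubmx H) (lsubmx H') (rsubmx H') => {H H'} N Y N' Y' fH fH'.
rewrite !row_mxKl !row_mxKr.
rewrite !mul_row_col !mulmx1 !mulmx0 !addr0 => EN; rewrite -{N'}EN in fH' *.
(* [Q] has full rank and its kernel is exactly the column space of [N]. The products of [Q] with [Y]
   and [Y'] are both row free, so they differ by an invertible [z], and then [Y - Y' z] has the form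
   [N x]. *)
pose C := (cokermx N^T)^T; pose Q := row_base C.
have QN : Q *m N = 0.
  have /row_fullP[L HL] := col_base_full C.
  have CN : C *m N = 0 by apply: trmx_inj; rewrite trmx_mul trmxK mulmx_coker trmx0.
  by rewrite -[Q]mul1mx -HL -(mulmxA L) mulmx_base -mulmxA CN mulmx0.
have QI p (v : 'M_(r, p)) : Q *m v = 0 -> exists x, v = N *m x.
  move=> Qv; suff: (v^T <= N^T)%MS.
    by move=> /submxP[x Ex]; exists x^T; rewrite -[v]trmxK Ex trmx_mul trmxK.
  rewrite submxE -[cokermx _]trmxK -/C -trmx_mul -[C]mulmx_base -mulmxA Qv.
  by rewrite mulmx0 trmx0.
have fQY (Z : 'M_(r, m)) : row_free (row_mx N Z) -> row_free (Q *m Z).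
  move=> /row_freeP[W EW]; have /row_freeP[Q' EQ] := row_base_free C.
  apply/row_freeP; exists (dsubmx W *m Q'); rewrite -EQ -/Q -[in RHS](mulmx1 Q) -EW.
  rewrite -[W in RHS]vsubmxK mul_row_col mulmxDr !mulmxA QN mul0mx add0r.
  by [].
have [z uz Ez] := equiv_row_free (fQY _ fH) (fQY _ fH').
have [|x Ex] := QI _ (Y - Y' *m z); first by rewrite mulmxBr Ez mulmxA subrr.
exists (block_mx 1%:M x 0 z).
  by rewrite unitmxE det_ublock det1 mul1r -unitmxE.
rewrite mul_block_col !mulmx1 !mulmx0 !addr0; split=> //.
by rewrite mul_row_block !mulmx1 mulmx0 addr0 -Ex subrK.
Qed.

Lemma full_factor_conj n r (F F' : 'M[K]_(n, r)) (G G' : 'M_(r, n)) :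
  row_full F -> row_full F' -> row_free G -> row_free G' -> G *m F = G' *m F' ->
  exists2 g, g \in unitmx & g *m F = F' /\ G' *m g = G.
Proof.
move=> fF; have rn : (r <= n)%N by rewrite -(eqP fF) rank_leq_row.
move: F F' G G' fF; rewrite -(subnKC rn); exact: full_factor_conj_block.
Qed.

Definition similarmx n (A B : 'M[K]_n) : Prop :=
  exists2 P, P \in unitmx & B = P *m A *m invmx P.

(** A conjugacy class is determined by the size of the matrix and its action on the image of
    [A - c]: once the small matrices are conjugated into each other, the full-rank pairs with a
    given product [G *m F] form a single orbit ([full_factor_conj]). *)
Lemma factor_similar n r (A B : 'M[K]_n) c (F F' : 'M_(n, r)) (G G' : 'M_(r, n)) :
  A - c%:M = F *m G -> B - c%:M = F' *m G' ->
  row_full F -> row_full F' -> row_free G -> row_free G' ->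
  similarmx (G *m F + c%:M) (G' *m F' + c%:M) -> similarmx A B.
Proof.
move=> EA EB fF fF' fG fG' [P uP E].
have {}E : P *m (G *m F) *m invmx P = G' *m F'.
  by apply: (addIr c%:M); rewrite E mulmxDr mulmxDl scalar_mxC mulmxK.
have [|||||g ug [E1 E2]] := @full_factor_conj _ _ F (F' *m P) G (invmx P *m G').
- by [].
- by rewrite /row_full mxrankMfree // row_free_unit.
- by [].
- by rewrite /row_free (eqmxMfull _ _) // row_full_unit unitmx_inv.
- by rewrite -mulmxA (mulmxA G') -E -!mulmxA mulKmx // mulVmx // mulmx1.
have EgA : g *m (F *m G) = F' *m G' *m g by rewrite mulmxA E1 -E2 !mulmxA mulmxK.
exists g => //; rewrite -[B](subrK c%:M) EB -[A](subrK c%:M) EA.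
by rewrite mulmxDr mulmxDl EgA scalar_mxC !mulmxK.
Qed.

Lemma similarmx_refl n (A : 'M[K]_n) : similarmx A A.
Proof. by exists 1%:M; rewrite ?unitmx1 // invmx1 mul1mx mulmx1. Qed.

Lemma similarmx_sym n (A B : 'M[K]_n) : similarmx A B -> similarmx B A.
Proof.
move=> [P uP ->]; exists (invmx P); first by rewrite unitmx_inv.
by rewrite invmxK !mulmxA mulVmx // mul1mx mulmxKV.
Qed.

Lemma invmx_mulmx n (A B : 'M[K]_n) : A \in unitmx -> B \in unitmx ->
  invmx (A *m B) = invmx B *m invmx A.
Proof.
move=> uA uB; have uAB : A *m B \in unitmx by rewrite unitmx_mul uA.
by rewrite -[RHS]mulmx1 -(mulmxV uAB) !mulmxA mulmxKV // mulVmx // mul1mx.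
Qed.

Lemma similarmx_trans n (A B C : 'M[K]_n) :
  similarmx A B -> similarmx B C -> similarmx A C.
Proof.
move=> [P uP ->] [Q uQ ->]; exists (Q *m P); first by rewrite unitmx_mul uQ.
by rewrite invmx_mulmx // !mulmxA.
Qed.

Lemma rank_le_similar n (A B C : 'M[K]_n) :
  similarmx B C -> rank_le B A -> rank_le C A.
Proof.
move=> [P uP ->] H cs; suff -> : root_prod (P *m B *m invmx P) cs
    = P *m root_prod B cs *m invmx P.
  by rewrite mxrankMfree ?row_free_unit ?unitmx_inv // (eqmxMfull _ _) // row_full_unit.
elim: cs => [|c cs /= ->]; first by rewrite /= mulmx1 mulmxV.
have -> : P *m B *m invmx P - c%:M = P *m (B - c%:M) *m invmx P.
  by rewrite mulmxBr mulmxBl scalar_mxC mulmxK.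
by rewrite !mulmxA mulmxKV.
Qed.

Lemma rank_le_refl n (A : 'M[K]_n) : rank_le A A.
Proof. by []. Qed.

Lemma det_pencil n (X Y : 'M[K]_n) :
  exists p : {poly K}, forall t, p.[t] = \det ((1 - t) *: X + t *: Y).
Proof.
exists (\det ((1 - 'X) *: map_mx polyC X + 'X *: map_mx polyC Y)) => t.
rewrite -[LHS]/(horner_eval t _) -det_map_mx; congr (\det _).
by apply/matrixP => i j; rewrite !mxE -[LHS]/(_.[t]) !hornerE.
Qed.

(* After conjugation, [A] and [B] factor at each step through the same surjection
   [Q], hence so do all the matrices of the line that joins them. *)
Lemma leg_pencil m (d : nat -> nat) (xi : nat -> K) (A B : 'M[K]_(d 0)) :
  @leg_type m d xi A -> rank_le B A ->
  exists A' (e : {poly K}), [/\ similarmx A A', e != 0 &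
    forall t, e.[t] != 0 -> similarmx A ((1 - t) *: B + t *: A')].
Proof.
elim: m d xi A B => [|m IH] d xi A B.
  move=> [_ H] BA; exists A, 1; rewrite oner_neq0; split=> // [|t _].
    exact: similarmx_refl.
  suff -> : B = A by rewrite -scalerDl subrK scale1r; apply: similarmx_refl.
  have := BA [:: xi 0%N]; move: H; rewrite /mkseq /= !mulmx1 => H.
  rewrite H mxrank0 leqn0 mxrank_eq0 => /eqP H'.
  by apply: (addIr (- (xi 0%N)%:M)); rewrite H H'.
move=> /leg_typeS [F [G [E fF fG tA]]] BA.
set c := xi 0%N in E tA.
have [P [Q [EB fQ le]]] := rank_le_factor E fF fG BA.
have [D' [e1 [[k uk EAk] e1nz He1]]] := IH (d \o S) (xi \o S) _ _ tA le.
have [|g ug EQ] := @equiv_row_free _ _ Q (k *m G) fQ.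
  by rewrite /row_free (eqmxMfull _ _) // row_full_unit.
pose F' := invmx g *m F *m invmx k.
have fF' : row_full F'.
  rewrite /row_full mxrankMfree ?row_free_unit ?unitmx_inv //.
  by rewrite (eqmxMfull _ _) // row_full_unit unitmx_inv.
have EQF : Q *m F' + c%:M = D'.
  rewrite EAk EQ /F' mulmxDr mulmxDl scalar_mxC mulmxK //; congr (_ + _).
  by rewrite !mulmxA mulmxK.
pose A' := F' *m Q + c%:M.
have EA' : A' - c%:M = F' *m Q by rewrite addrK.
(* A left inverse of [F'] certifies full rank along the line: [e2], the determinant of [L] times the
   moving factor, is 1 at [t = 1], hence nonzero, and off its roots the moving factor has a left
   inverse too. *)
have [L HL] := row_fullP fF'.
have [e2 He2] := det_pencil (L *m P) (L *m F').
exists A', (e1 * e2); split.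
- apply: (factor_similar E EA') => //; rewrite EQF; by exists k.
- rewrite mulf_neq0 //; apply/eqP => e20; have := He2 1.
  rewrite e20 horner0 subrr scale0r add0r scale1r HL det1 => /eqP.
  by rewrite eq_sym oner_eq0.
move=> t; rewrite hornerM mulf_eq0 negb_or => /andP[/He1 H1].
rewrite He2 (scalemxAr _ L P) (scalemxAr _ L F') -mulmxDr => H2.
pose Ft := (1 - t) *: P + t *: F'.
apply: (factor_similar E (F' := Ft) (G' := Q)) => //.
- rewrite /Ft mulmxDl -!scalemxAl -EB -EA' !scalerBr addrACA -opprD -scalerDl.
  by rewrite subrK scale1r.
- apply/row_fullP; exists (invmx (L *m Ft) *m L).
  have uL : L *m Ft \in unitmx by rewrite unitmxE unitfE.
  by rewrite -mulmxA mulVmx.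
have -> : Q *m Ft + c%:M = (1 - t) *: (Q *m P + c%:M) + t *: D'; last by [].
rewrite -EQF /Ft mulmxDr -!scalemxAr !scalerDr addrACA -scalerDl.
by rewrite subrK scale1r.
Qed.

End RootProduct.


(** * Polynomial functions *)

Section Generated.
Variable K : fieldType.

Lemma generated_sum (T : Type) (S : (T -> K) -> Prop) (J : Type) (r : seq J)
    (P : pred J) (F : J -> T -> K) :
  (forall j, P j -> generated S (F j)) ->
  generated S (fun x => \sum_(j <- r | P j) F j x).
Proof.
move=> H; elim: r => [|j r IH].
  have -> : (fun x : T => \sum_(j <- [::] | P j) F j x) = (fun=> 0).
    by apply/funext => x; rewrite big_nil.
  exact: gen_const.
have -> : (fun x : T => \sum_(i <- j :: r | P i) F i x) =
   (fun x => (if P j then F j x else 0) + \sum_(i <- r | P i) F i x).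
  by apply/funext => x; rewrite big_cons; case: ifP; rewrite ?add0r.
apply: gen_add => //; case Pj: (P j); [exact: H|exact: gen_const].
Qed.

Lemma generated_prod (T : Type) (S : (T -> K) -> Prop) (J : Type) (r : seq J)
    (P : pred J) (F : J -> T -> K) :
  (forall j, P j -> generated S (F j)) ->
  generated S (fun x => \prod_(j <- r | P j) F j x).
Proof.
move=> H; elim: r => [|j r IH].
  have -> : (fun x : T => \prod_(j <- [::] | P j) F j x) = (fun=> 1).
    by apply/funext => x; rewrite big_nil.
  exact: gen_const.
have -> : (fun x : T => \prod_(i <- j :: r | P i) F i x) =
   (fun x => (if P j then F j x else 1) * \prod_(i <- r | P i) F i x).
  by apply/funext => x; rewrite big_cons; case: ifP; rewrite ?mul1r.
apply: gen_mul => //; case Pj: (P j); [exact: H|exact: gen_const].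
Qed.

Lemma generated_opp (T : Type) (S : (T -> K) -> Prop) f :
  generated S f -> generated S (fun x => - f x).
Proof.
move=> H; have -> : (fun x => - f x) = (fun x => (-1) * f x).
  by apply/funext => x; rewrite mulN1r.
by apply: gen_mul => //; apply: gen_const.
Qed.

Lemma generated_comp (T U : Type) (S : (T -> K) -> Prop) (S' : (U -> K) -> Prop)
    (p : U -> T) f :
  (forall h, S h -> generated S' (h \o p)) ->
  generated S f -> generated S' (f \o p).
Proof.
move=> H; elim=> [h /H //|c|h1 h2 _ IH1 _ IH2|h1 h2 _ IH1 _ IH2].
- exact: (gen_const _ c).
- exact: gen_add.
- exact: gen_mul.
Qed.

Lemma generated_sub (T : Type) (S S' : (T -> K) -> Prop) f :
  (forall h, S h -> generated S' h) -> generated S f -> generated S' f.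
Proof. by move=> H /(@generated_comp _ _ _ S' id); apply. Qed.

Lemma generated_mulmx (T : Type) (S : (T -> K) -> Prop) m n p
    (A : T -> 'M[K]_(m, n)) (B : T -> 'M[K]_(n, p)) :
  (forall i j, generated S (fun x => A x i j)) ->
  (forall i j, generated S (fun x => B x i j)) ->
  forall i j, generated S (fun x => (A x *m B x) i j).
Proof.
move=> HA HB i j.
have -> : (fun x => (A x *m B x) i j) = (fun x => \sum_k A x i k * B x k j).
  by apply/funext => x; rewrite mxE.
by apply: generated_sum => k _; apply: gen_mul.
Qed.

Lemma generated_det (T : Type) (S : (T -> K) -> Prop) n (A : T -> 'M[K]_n) :
  (forall i j, generated S (fun x => A x i j)) ->
  generated S (fun x => \det (A x)).
Proof.
move=> HA; apply: generated_sum => s _; apply: gen_mul; first exact: gen_const.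
by apply: generated_prod => i _; apply: HA.
Qed.

End Generated.

Section Infinite.
Variable K : numFieldType.

Lemma poly_fun0 (p : {poly K}) : (forall x, p.[x] = 0) -> p = 0.
Proof.
move=> H; apply/eqP; apply: contraT => nz.
have := @max_poly_roots _ p [seq i%:R | i <- iota 0 (size p)] nz.
rewrite size_map size_iota ltnn => -> //.
  by apply/allP => x _; apply/rootP.
rewrite map_inj_in_uniq ?iota_uniq // => i j _ _ /eqP.
by rewrite eqr_nat => /eqP.
Qed.

Definition polynomial_fun (f : K -> K) : Prop := exists p : {poly K}, forall t, f t = p.[t].

Lemma polynomial_fun_gen f : generated (fun h : K -> K => h = id) f ->
  polynomial_fun f.
Proof.
elim=> [h ->|c|h1 h2 _ [p1 H1] _ [p2 H2]|h1 h2 _ [p1 H1] _ [p2 H2]].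
- by exists 'X => t; rewrite hornerX.
- by exists c%:P => t; rewrite hornerC.
- by exists (p1 + p2) => t; rewrite hornerD H1 H2.
- by exists (p1 * p2) => t; rewrite hornerM H1 H2.
Qed.

End Infinite.

(** * Orthogonal decomposition for the standard Hermitian form *)

Section Ortho.
Variable C : numClosedFieldType.

Definition adjmx m n (A : 'M[C]_(m, n)) : 'M[C]_(n, m) := map_mx Num.conj A^T.

Lemma subspace_mx D (S : 'rV[C]_D -> Prop) :
  S 0 -> (forall a u v, S u -> S v -> S (a *: u + v)) ->
  exists B : 'M[C]_D, forall v, S v <-> (v <= B)%MS.
Proof.
move=> S0 Slin.
pose P r := `[< exists B : 'M[C]_D, \rank B = r /\ forall v : 'rV_D, (v <= B)%MS -> S v >].
have P0 : exists r, P r.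
  exists 0%N; apply/asboolP; exists 0; rewrite mxrank0; split=> // v.
  by rewrite submx0 => /eqP ->.
have Pb r : P r -> (r <= D)%N by move=> /asboolP[B [<- _]]; apply: rank_leq_row.
case: (ex_maxnP P0 Pb) => r /asboolP[B [rB HB]] rmax.
exists B => v; split; last exact: HB.
move=> Sv; apply: contraT => nvB.
have := rmax (\rank (B + v)%MS) _.
rewrite leqNgt -rB rank_ltmx ?ltmxE ?addsmxSl ?addsmx_sub ?submx_refl //= => ->//.
apply/asboolP; exists (B + v)%MS; split=> // u /sub_addsmxP[[x y] ->].
rewrite addrC [y]mx11_scalar mul_scalar_mx; apply: Slin => //.
by apply: HB; apply: submxMl.
Qed.

Lemma ortho_decomp D (S : 'rV[C]_D -> Prop) :
  S 0 -> (forall a u v, S u -> S v -> S (a *: u + v)) ->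
  forall v, exists s u, [/\ v = s + u, S s & forall s', S s' -> u *m adjmx s' = 0].
Proof.
move=> S0 Slin v; have [B HB] := subspace_mx S0 Slin.
have : (v <= B + orthomx Num.conj (mx_of_hermitian (hermitian1mx _)) B)%MS.
  by rewrite addsmx_ortho submx1.
move=> /sub_addsmxP[[x y] ->]; exists (x *m B); eexists; split; first by [].
  by apply/HB; apply: submxMl.
move=> s' /HB /submxP[z ->]; rewrite /adjmx trmx_mul map_mxM mulmxA.
set O := orthomx _ _ _.
have : (y *m O <= O)%MS by apply: submxMl.
by move=> /orthomx1P -> ; rewrite mul0mx.
Qed.

Lemma adj_self0 D (v : 'rV[C]_D) : v *m adjmx v = 0 -> v = 0.
Proof.
move=> H; apply/eqP; apply: contraT => /(@dotmx_is_dotmx C D v).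
by rewrite dotmxE -/(adjmx v) H mxE ltxx.
Qed.

Lemma adjmxM m n p (A : 'M[C]_(m, n)) (B : 'M_(n, p)) :
  adjmx (A *m B) = adjmx B *m adjmx A.
Proof. by rewrite /adjmx trmx_mul map_mxM. Qed.

Lemma adjmxK m n (A : 'M[C]_(m, n)) : adjmx (adjmx A) = A.
Proof. by apply/matrixP => i j; rewrite !mxE conjCK. Qed.

End Ortho.

(** * Invariants and the first fundamental theorem *)

Section Tensor.
Variables (C : numClosedFieldType) (I : finType) (N : nat).

Definition word : finType := {ffun 'I_N -> I}.
(** A homogeneous polynomial of degree [N], as a tensor that is not symmetrised. Linear
    substitutions then act by the matrices [tensor_power], whose adjoints are again of this form;
    that several tensors give the same polynomial is harmless. *)
Definition tensor : Type := 'rV[C]_#|word|.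

Definition tensor_eval (l : tensor) (x : I -> C) : C :=
  \sum_(w : word) l 0 (enum_rank w) * \prod_s x (w s).

Definition tensor_power (g : I -> I -> C) : 'M[C]_#|word| :=
  \matrix_(a, b) \prod_s g ((enum_val a : word) s) ((enum_val b : word) s).

Definition lin_act (g : I -> I -> C) (x : I -> C) (i : I) : C :=
  \sum_j g i j * x j.

Definition lin_adj (g : I -> I -> C) (i j : I) : C := (g j i)^*.

Lemma tensor_evalD a l m x :
  tensor_eval (a *: l + m) x = a * tensor_eval l x + tensor_eval m x.
Proof.
rewrite /tensor_eval big_distrr -big_split /=; apply: eq_bigr => w _.
by rewrite !mxE mulrDl mulrA.
Qed.

Lemma tensor_eval0 x : tensor_eval 0 x = 0.
Proof. by rewrite /tensor_eval big1 // => w _; rewrite mxE mul0r. Qed.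

Lemma tensor_eval_power l g x :
  tensor_eval (l *m tensor_power g) x = tensor_eval l (lin_act g x).
Proof.
rewrite /tensor_eval /lin_act.
under [RHS]eq_bigr => w _ do rewrite bigA_distr_bigA big_distrr /=.
rewrite exchange_big /=; apply: eq_bigr => v _.
rewrite mxE (reindex (@enum_rank word)) /=; last first.
  by apply: onW_bij; apply: enum_rank_bij.
rewrite big_distrl /=; apply: eq_bigr => w _.
rewrite mxE !enum_rankK -mulrA; congr (_ * _).
by rewrite -big_split.
Qed.

Lemma adjmx_tensor_power g : adjmx (tensor_power g) = tensor_power (lin_adj g).
Proof.
by apply/matrixP => a b; rewrite !mxE rmorph_prod.
Qed.

Lemma tensor_eval_gen (T : Type) (S : (T -> C) -> Prop) l (c : I -> T -> C) :
  (forall i, generated S (c i)) ->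
  generated S (fun x => tensor_eval l (c ^~ x)).
Proof.
move=> H; apply: generated_sum => w _; apply: gen_mul; first exact: gen_const.
by apply: generated_prod => s _; apply: H.
Qed.

(* The invariant lift is the component of [l] orthogonal to the tensors that
   vanish on [Y]: this subspace, hence its orthogonal, is stable under the
   adjoint-closed family [G]. *)
Lemma tensor_lift_invariant (Y : (I -> C) -> Prop) (G : (I -> I -> C) -> Prop) l :
  (forall g, G g -> G (lin_adj g)) ->
  (forall g y, G g -> Y y -> Y (lin_act g y)) ->
  (forall g y, G g -> Y y -> tensor_eval l (lin_act g y) = tensor_eval l y) ->
  exists m, (forall g x, G g -> tensor_eval m (lin_act g x) = tensor_eval m x) /\
    forall y, Y y -> tensor_eval m y = tensor_eval l y.
Proof.
move=> Gadj GY linv.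
pose S (m : tensor) := forall y, Y y -> tensor_eval m y = 0.
have S0 : S 0 by move=> y _; rewrite tensor_eval0.
have Slin a u v : S u -> S v -> S (a *: u + v).
  by move=> Su Sv y Yy; rewrite tensor_evalD Su // Sv // mulr0 addr0.
have Sstab g m : G g -> S m -> S (m *m tensor_power g).
  by move=> Gg Sm y Yy; rewrite tensor_eval_power Sm //; apply: GY.
have [s [u [El Ss Hu]]] := ortho_decomp S0 Slin l.
have Eu y : Y y -> tensor_eval u y = tensor_eval l y.
  by move=> Yy; rewrite El -[s]scale1r tensor_evalD Ss // mulr0 add0r.
exists u; split=> // g x Gg; rewrite -tensor_eval_power.
suff -> : u *m tensor_power g = u by [].
apply/eqP; rewrite -subr_eq0; apply/eqP; apply: adj_self0.
set d := _ - _.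
have Sd : S d.
  move=> y Yy; rewrite /d -scaleN1r addrC tensor_evalD tensor_eval_power.
  by rewrite !Eu ?linv ?mulN1r ?addNr //; apply: GY.
(* [u] is orthogonal to [d]; so is its transform by [g], because the pairing moves [g] to its
   adjoint acting on [d], and the result still vanishes on [Y]. *)
rewrite {1}/d mulmxBl (Hu _ Sd) subr0 -mulmxA.
by rewrite -[tensor_power g]adjmxK -adjmxM adjmx_tensor_power Hu //; apply/Sstab/Sd/Gadj.
Qed.

End Tensor.

Section Monomials.
Variables (K : fieldType) (T : Type) (A : finType) (S : (T -> K) -> Prop).
Variable (c : A -> T -> K).

Lemma generated_monomials f :
  generated (fun h => S h \/ exists a, h = c a) f ->
  exists (J : finType) (t : J -> T -> K) (w : J -> seq A),
    (forall j, generated S (t j)) /\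
    forall x, f x = \sum_j t j x * \prod_(a <- w j) c a x.
Proof.
elim=> [h [Sh|[a ->]]|b|h1 h2 _ [J1 [t1 [w1 [G1 E1]]]] _ [J2 [t2 [w2 [G2 E2]]]]
  |h1 h2 _ [J1 [t1 [w1 [G1 E1]]]] _ [J2 [t2 [w2 [G2 E2]]]]].
- exists unit, (fun _ => h), (fun=> [::]); split; first by move=> _; apply: gen_coord.
  by move=> x; rewrite (big_pred1 tt) ?big_nil ?mulr1 // => -[].
- exists unit, (fun _ _ => 1), (fun=> [:: a]); split; first by move=> _; apply: gen_const.
  by move=> x; rewrite (big_pred1 tt) ?big_seq1 ?mul1r // => -[].
- exists unit, (fun _ _ => b), (fun=> [::]); split; first by move=> _; apply: gen_const.
  by move=> x; rewrite (big_pred1 tt) ?big_nil ?mulr1 // => -[].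
- exists (J1 + J2)%type, (fun j => match j with inl a => t1 a | inr b => t2 b end).
  exists (fun j => match j with inl a => w1 a | inr b => w2 b end).
  by split=> [[a|b] //|x]; rewrite big_sumType /= -E1 -E2.
exists (J1 * J2)%type, (fun j x => t1 j.1 x * t2 j.2 x), (fun j => w1 j.1 ++ w2 j.2).
split=> [j|x]; first exact: gen_mul.
rewrite E1 E2 big_distrl /= -(pair_bigA _ (fun a b => t1 a x * t2 b x *
  \prod_(i <- w1 a ++ w2 b) c i x)) /=; apply: eq_bigr => a _.
by rewrite big_distrr /=; apply: eq_bigr => b _; rewrite big_cat /= mulrACA.
Qed.

End Monomials.

Lemma prod_nth_default (K : comNzRingType) (I : Type) (d : I) (F : I -> K) (w : seq I) M :
  F d = 1 -> (size w <= M)%N ->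
  \prod_(s < M) F (nth d w s) = \prod_(i <- w) F i.
Proof.
move=> Fd wM; rewrite -(big_mkord xpredT (fun s => F (nth d w s))).
rewrite (big_cat_nat (n := size w)) //= -(big_nth d xpredT F) [X in _ * X]big_nat_cond [X in _ * X]big1 ?mulr1 //.
by move=> s /andP[/andP[ws _] _]; rewrite nth_default.
Qed.

(** Homogenisation: the extra variable [inr None], of value 1, pads all monomials to the common
    length [M]. Position 0 of each word holds the coefficient [t j], whence the degree [M.+1]. *)
Lemma generated_tensor (C : numClosedFieldType) (T : Type) (A : finType)
    (S : (T -> C) -> Prop) (c : A -> T -> C) f :
  generated (fun h => S h \/ exists a, h = c a) f ->
  exists (J : finType) (t : J -> T -> C) N (l : tensor C (A + J)%type N),
    (forall j, generated S (t j)) /\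
    forall x, f x = tensor_eval l (fun i => match i with inl a => c a x | inr j => t j x end).
Proof.
move=> /generated_monomials [J [t [w [Gt E]]]].
pose M := (\max_j size (w j))%N.
pose wd (j : J) : word (A + option J)%type M.+1 :=
  [ffun s => match val s with
     | 0 => inr (Some j)
     | s'.+1 => nth (inr None) (map inl (w j)) s' end].
pose t' (j : option J) : T -> C := if j is Some j then t j else fun=> 1.
exists (option J), t', M.+1, (\sum_j delta_mx 0 (enum_rank (wd j))); split.
  by case=> [j|] /=; [exact: Gt|exact: gen_const].
move=> x; rewrite E /tensor_eval.
under [RHS]eq_bigr => v _ do rewrite summxE big_distrl /=.
rewrite exchange_big /=; apply: eq_bigr => j _.
rewrite (bigD1 (wd j)) //= !mxE !eqxx mul1r [X in _ + X]big1 ?addr0; last first.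
  move=> v nv; rewrite !mxE eqxx /= (inj_eq enum_rank_inj) (negPf nv) mul0r //.
rewrite big_ord_recl /wd ffunE /=; congr (_ * _).
set F := fun i : (A + option J)%type => match i with inl a => c a x | inr j => t' j x end.
transitivity (\prod_(s < M) F (nth (inr None) (map inl (w j)) s)).
  rewrite prod_nth_default ?big_map ?size_map //; exact: (leq_bigmax (F := fun j => size (w j))).
by apply: eq_bigr => s _; rewrite ffunE.
Qed.

Section FirstFundamentalTheorem.
Variables (C : numClosedFieldType) (n r : nat) (J : finType).

Definition pair_index : finType := ('I_n * 'I_r + 'I_r * 'I_n)%type.
Definition fft_index : finType := (pair_index + J)%type.

Definition pack (phi : 'M[C]_(n, r)) (psi : 'M[C]_(r, n)) (t : J -> C)
    (i : fft_index) : C :=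
  match i with
  | inl (inl ab) => phi ab.1 ab.2
  | inl (inr bc) => psi bc.1 bc.2
  | inr j => t j
  end.

(** The substitution that sends [phi] to [p phi h] and [psi] to [g psi s] and fixes [t]. Four
    independent matrices cover both the base changes of GL_r and the moves on the outer side, and
    give a family closed under adjoints. *)
Definition pack_lin (p : 'M[C]_n) (h g : 'M[C]_r) (s : 'M[C]_n)
    (i i' : fft_index) : C :=
  match i, i' with
  | inl (inl ab), inl (inl ab') => p ab.1 ab'.1 * h ab'.2 ab.2
  | inl (inr bc), inl (inr bc') => g bc.1 bc'.1 * s bc'.2 bc.2
  | inr j, inr j' => (j == j')%:R
  | _, _ => 0
  end.

Lemma packK (x : fft_index -> C) :
  x = pack (\matrix_(a, b) x (inl (inl (a, b)))) (\matrix_(b, c) x (inl (inr (b, c))))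
        (fun j => x (inr j)).
Proof. by apply/funext => -[[[a b]|[b c]]|j] /=; rewrite ?mxE. Qed.

Lemma lin_act_pack p h g s phi psi t :
  lin_act (pack_lin p h g s) (pack phi psi t) = pack (p *m phi *m h) (g *m psi *m s) t.
Proof.
apply/funext => i; rewrite /lin_act big_sumType big_sumType /=.
case: i => [[[a b]|[b c]]|j] /=.
- rewrite [X in _ + X + _]big1 ?addr0 => [|i _]; last by rewrite mul0r.
  rewrite [X in _ + X]big1 ?addr0 => [|i _]; last by rewrite mul0r.
  rewrite -(pair_bigA _ (fun a' b' => p a a' * h b' b * phi a' b')) /= !mxE.
  rewrite exchange_big /=; apply: eq_bigr => b' _; rewrite mxE big_distrl /=.
  by apply: eq_bigr => a' _; rewrite mulrAC.
- rewrite [X in X + _ + _]big1 ?add0r => [|i _]; last by rewrite mul0r.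
  rewrite [X in _ + X]big1 ?addr0 => [|i _]; last by rewrite mul0r.
  rewrite -(pair_bigA _ (fun a' b' => g b a' * s b' c * psi a' b')) /= !mxE.
  rewrite exchange_big /=; apply: eq_bigr => b' _; rewrite mxE big_distrl /=.
  by apply: eq_bigr => a' _; rewrite mulrAC.
rewrite [X in X + _ + _]big1 ?add0r => [|i _]; last by rewrite mul0r.
rewrite [X in X + _]big1 ?add0r => [|i _]; last by rewrite mul0r.
rewrite (bigD1 j) //= eqxx mul1r big1 ?addr0 // => j' /negPf nj.
by rewrite eq_sym nj mul0r.
Qed.

Lemma lin_adj_pack p h g s :
  lin_adj (pack_lin p h g s) = pack_lin (adjmx p) (adjmx h) (adjmx g) (adjmx s).
Proof.
apply/funext => i; apply/funext => i'; rewrite /lin_adj.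
case: i => [[[a b]|[b c]]|j]; case: i' => [[[a' b']|[b' c']]|j'] //=;
  rewrite ?mxE ?rmorphM ?rmorph0 //.
by rewrite rmorph_nat eq_sym.
Qed.

Definition product_poly : ((fft_index -> C) -> C) -> Prop :=
  generated (fun h => (exists j, h = fun x => x (inr j)) \/
    exists a c, h = fun x => \sum_b x (inl (inl (a, b))) * x (inl (inr (b, c)))).

Definition GL_invariant (f : (fft_index -> C) -> C) : Prop :=
  forall g phi psi t, g \in unitmx ->
    f (pack (phi *m invmx g) (g *m psi) t) = f (pack phi psi t).

End FirstFundamentalTheorem.

Section Unipotent.
Variables (C : numClosedFieldType) (r m : nat) (J : finType).
Notation index := (fft_index (r + m) r J).
Notation pk := (@pack C (r + m) r J).

Lemma tensor_eval_line N (l : tensor C index N) (c : index -> C -> C) :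
  (forall i, polynomial_fun (c i)) -> polynomial_fun (fun x => tensor_eval l (c^~ x)).
Proof.
move=> Hc; rewrite /tensor_eval.
have poly_sum (Q : Type) (s : seq Q) (F : Q -> C -> C) :
    (forall i, polynomial_fun (F i)) -> polynomial_fun (fun x => \sum_(i <- s) F i x).
  move=> /(@choice _ _ _) [p Hp]; exists (\sum_(i <- s) p i) => t.
  by rewrite horner_sum; apply: eq_bigr.
have poly_prod (Q : Type) (s : seq Q) (F : Q -> C -> C) :
    (forall i, polynomial_fun (F i)) -> polynomial_fun (fun x => \prod_(i <- s) F i x).
  move=> /(@choice _ _ _) [p Hp]; exists (\prod_(i <- s) p i) => t.
  by rewrite horner_prod; apply: eq_bigr.
apply: poly_sum => w; have [p Hp] := poly_prod _ (index_enum 'I_N) _ (fun s => Hc (w s)).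
by exists ((l 0 (enum_rank w)) *: p) => t; rewrite hornerZ -Hp.
Qed.

(** Where the upper block of [phi] and the left block of [psi] are invertible, suitable [e] and [c]
    clear the other blocks, and GL_r turns what is left of [psi] into 1. What is left of [phi] is
    then the upper left block of the original [phi *m psi], an expression that makes sense
    everywhere. *)
Lemma product_poly_tensor N (l : tensor C index N) (f := tensor_eval l) :
  GL_invariant f ->
  (forall e c phi psi t, f (pk (block_mx 1%:M 0 e 1%:M *m phi)
     (psi *m block_mx 1%:M c 0 1%:M) t) = f (pk phi psi t)) ->
  product_poly f.
Proof.
move=> Ginv Uinv.
pose red (phi : 'M[C]_(r + m, r)) (psi : 'M[C]_(r, r + m)) t : index -> C :=
  pk (col_mx (usubmx phi *m lsubmx psi) 0) (row_mx 1%:M 0) t.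
have E1 phi psi t : usubmx phi \in unitmx -> lsubmx psi \in unitmx ->
    f (pk phi psi t) = f (red phi psi t).
  move=> u1 u2; rewrite -(Uinv (- (dsubmx phi *m invmx (usubmx phi)))
     (- (invmx (lsubmx psi) *m rsubmx psi))).
  set X := _ *m phi; set Y := psi *m _.
  have -> : X = col_mx (usubmx phi) 0.
    rewrite /X -{3}[phi]vsubmxK mul_block_col !mul1mx mul0mx addr0.
    by rewrite mulNmx mulmxKV // addNr.
  have -> : Y = row_mx (lsubmx psi) 0.
    rewrite /Y -{1}[psi]hsubmxK mul_row_block !mulmx1 mulmx0 addr0.
    by rewrite mulmxN mulKVmx // addNr.
  rewrite -(Ginv (invmx (lsubmx psi))) ?unitmx_inv // invmxK.
  by rewrite mul_col_mx mul_mx_row mul0mx mulmx0 mulVmx.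
have E2 phi psi t : f (pk phi psi t) = f (red phi psi t).
  (* Density on a line: adding [x] times the identity makes both blocks invertible for all but
     finitely many [x], and two polynomials in [x] that agree there agree at 0. *)
  pose ph x : 'M[C]_(r + m, r) := phi + x *: col_mx 1%:M 0.
  pose ps x : 'M[C]_(r, r + m) := psi + x *: row_mx 1%:M 0.
  have pid : polynomial_fun (@id C) by exists 'X => x; rewrite hornerX.
  have padd a b : polynomial_fun (fun x => a + x * b : C).
    by exists (a%:P + 'X * b%:P) => x; rewrite !hornerE.
  have [p1 H1] : polynomial_fun (fun x => f (pk (ph x) (ps x) t)).
    apply: (@tensor_eval_line _ _ (fun i x => pk (ph x) (ps x) t i)).
    case=> [[[a b]|[b c]]|j] /=.
    - have [p Hp] := padd (phi a b) ((col_mx 1%:M 0 : 'M_(r + m, r)) a b).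
      by exists p => x; rewrite -Hp !mxE.
    - have [p Hp] := padd (psi b c) ((row_mx 1%:M 0 : 'M_(r, r + m)) b c).
      by exists p => x; rewrite -Hp !mxE.
    - by exists (t j)%:P => x; rewrite hornerC.
  have [p2 H2] : polynomial_fun (fun x => f (red (ph x) (ps x) t)).
    apply: (@tensor_eval_line _ _ (fun i x => red (ph x) (ps x) t i)).
    case=> [[[a b]|[b c]]|j] /=.
    - case: (split_ordP a) => a' ->; last first.
        by exists 0 => x; rewrite col_mxEd mxE horner0.
      pose F k x : C := (usubmx phi a' k + x * (a' == k)%:R) *
         (lsubmx psi k b + x * (k == b)%:R).
      have /(@choice _ _ _) [p Hp] k : exists p : {poly C}, forall x, F k x = p.[x].
        have [q1 Hq1] := padd (usubmx phi a' k) (a' == k)%:R.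
        have [q2 Hq2] := padd (lsubmx psi k b) (k == b)%:R.
        by exists (q1 * q2) => x; rewrite hornerM -Hq1 -Hq2.
      exists (\sum_k p k) => x; rewrite horner_sum col_mxEu mxE.
      apply: eq_bigr => k _; rewrite -Hp /F /ph /ps.
      have -> : usubmx (ph x) a' k = usubmx phi a' k + x * (a' == k)%:R.
        by rewrite /ph linearD linearZ /= col_mxKu !mxE.
      suff -> : lsubmx (ps x) k b = lsubmx psi k b + x * (k == b)%:R by [].
      by rewrite /ps linearD linearZ /= row_mxKl !mxE.
    - by exists (((row_mx 1%:M 0 : 'M[C]_(r, r + m)) b c)%:P) => x; rewrite hornerC.
    - by exists (t j)%:P => x; rewrite hornerC.
  (* The exceptional [x] are the roots of these polynomials, which are monic and hence can be
     cancelled. *)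
  pose d1 := char_poly (- usubmx phi); pose d2 := char_poly (- lsubmx psi).
  have charE (A : 'M[C]_r) x : (char_poly (- A)).[x] = \det (A + x%:M).
    rewrite /char_poly -[LHS]/(horner_eval x _) -det_map_mx; congr (\det _).
    apply/matrixP => i j; rewrite !mxE -[LHS]/(_.[x]) !hornerE opprK addrC.
    by rewrite hornerMn hornerX.
  have : (p1 - p2) * (d1 * d2) = 0.
    apply: poly_fun0 => x; rewrite !hornerM !charE.
    have [/eqP ->|nz1] := boolP (\det (usubmx phi + x%:M) == 0); first by rewrite mul0r mulr0.
    have [/eqP ->|nz2] := boolP (\det (lsubmx psi + x%:M) == 0); first by rewrite !mulr0.
    rewrite hornerD hornerN -H1 -H2 E1 ?subrr ?mul0r // unitmxE unitfE.
      suff -> : usubmx (ph x) = usubmx phi + x%:M by [].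
      by rewrite /ph linearD linearZ /= col_mxKu scalemx1.
    suff -> : lsubmx (ps x) = lsubmx psi + x%:M by [].
    by rewrite /ps linearD linearZ /= row_mxKl scalemx1.
  move=> /eqP; rewrite mulf_eq0 mulf_eq0 !(negPf (monic_neq0 (char_poly_monic _))) !orbF.
  move=> /eqP /(congr1 (fun p => p.[0])); rewrite hornerD hornerN -H1 -H2 horner0.
  by move=> /eqP; rewrite subr_eq0 /ph /ps !scale0r !addr0 => /eqP.
have -> : f = fun x => tensor_eval l (fun i => red (\matrix_(a, b) x (inl (inl (a, b))))
   (\matrix_(b, c) x (inl (inr (b, c)))) (fun j => x (inr j)) i).
  by apply/funext => x; rewrite [x in LHS]packK E2.
apply: tensor_eval_gen => -[[[a b]|[b c]]|j] /=.
- case: (split_ordP a) => a' ->; last first.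
    have -> : (fun x : index -> C => (col_mx (usubmx (\matrix_(a, b) x (inl (inl (a, b)))) *m
      lsubmx (\matrix_(b, c) x (inl (inr (b, c))))) (0 : 'M_(m, r))) (rshift r a') b) = fun=> 0.
      by apply/funext => x; rewrite col_mxEd mxE.
    exact: gen_const.
  apply: gen_coord; right; exists (lshift m a'), (lshift m b); apply/funext => x.
  by rewrite col_mxEu mxE; apply: eq_bigr => k _; rewrite !mxE.
- exact: gen_const.
- by apply: gen_coord; left; exists j.
Qed.


Definition lower_block (i : index) : bool :=
  match i with
  | inl (inl ab) => (r <= ab.1)%N
  | inl (inr bc) => (r <= bc.2)%N
  | inr _ => false
  end.

Definition unipotent (e : 'M[C]_(m, r)) (c : 'M[C]_(r, m)) : index -> index -> C :=
  pack_lin (block_mx 1%:M 0 e 1%:M) 1%:M 1%:M (block_mx 1%:M c 0 1%:M).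

Lemma lower_unitri_entry (e : 'M[C]_(m, r)) a b :
  (block_mx 1%:M 0 e 1%:M : 'M_(r + m)) a b != 0 ->
  a = b \/ ((r <= a)%N /\ (b < r)%N).
Proof.
case: (split_ordP a) => a' ->; case: (split_ordP b) => b' ->.
- by rewrite block_mxEul mxE; case: (eqVneq a' b') => [->|_]; [left|rewrite eqxx].
- by rewrite block_mxEur mxE eqxx.
- by right; split=> //; exact: leq_addr.
- by rewrite block_mxEdr mxE; case: (eqVneq a' b') => [->|_]; [left|rewrite eqxx].
Qed.

Lemma upper_unitri_entry (c : 'M[C]_(r, m)) a b :
  (block_mx 1%:M c 0 1%:M : 'M_(r + m)) a b != 0 ->
  a = b \/ ((a < r)%N /\ (r <= b)%N).
Proof.
case: (split_ordP a) => a' ->; case: (split_ordP b) => b' ->.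
- by rewrite block_mxEul mxE; case: (eqVneq a' b') => [->|_]; [left|rewrite eqxx].
- by right; split=> //; exact: leq_addr.
- by rewrite block_mxEdl mxE eqxx.
- by rewrite block_mxEdr mxE; case: (eqVneq a' b') => [->|_]; [left|rewrite eqxx].
Qed.

Lemma lower_unitri_diag (e : 'M[C]_(m, r)) a :
  (block_mx 1%:M 0 e 1%:M : 'M_(r + m)) a a = 1.
Proof. by case: (split_ordP a) => a' ->; rewrite ?block_mxEul ?block_mxEdr mxE eqxx. Qed.

Lemma upper_unitri_diag (c : 'M[C]_(r, m)) a :
  (block_mx 1%:M c 0 1%:M : 'M_(r + m)) a a = 1.
Proof. by case: (split_ordP a) => a' ->; rewrite ?block_mxEul ?block_mxEdr mxE eqxx. Qed.

Lemma unipotent_diag e c i : unipotent e c i i = 1.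
Proof.
case: i => [[[a b]|[b d]]|j] /=; last by rewrite eqxx.
  by rewrite lower_unitri_diag mxE eqxx mulr1.
by rewrite upper_unitri_diag mxE eqxx mulr1.
Qed.

Lemma unipotent_entry e c i j : unipotent e c i j != 0 ->
  i = j \/ (lower_block i && ~~ lower_block j).
Proof.
case: i => [[[a b]|[b d]]|i]; case: j => [[[a' b']|[b' d']]|j] //=; rewrite ?eqxx //.
- rewrite mulf_eq0 negb_or => /andP[/lower_unitri_entry H].
  rewrite mxE; case: (eqVneq b' b) => [->|_]; rewrite ?eqxx // => _.
  by case: H => [->|[H1 H2]]; [left|right; rewrite H1 -ltnNge].
- rewrite mulf_eq0 negb_or => /andP[]; rewrite mxE.
  case: (eqVneq b b') => [->|_]; rewrite ?eqxx // => _ /upper_unitri_entry H.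
  by case: H => [->|[H1 H2]]; [left|right; rewrite H2 -ltnNge].
- by case: (eqVneq i j) => [->|_]; [left|rewrite eqxx].
Qed.

Definition lower_count N (w : word index N) : nat := \sum_s lower_block (w s).

(** Off the diagonal, a nonzero entry of the tensor power links a word to one where some lower
    letters have become non-lower. The coordinate at [w] thus receives contributions from [w], with
    coefficient 1, and from words with more lower letters, where [l] vanishes. *)
Lemma unipotent_sub_lower N (l : tensor C index N) e c D :
  (forall w, (D < lower_count w)%N -> l 0 (enum_rank w) = 0) ->
  forall w, (D <= lower_count w)%N ->
    (l *m tensor_power N (unipotent e c) - l) 0 (enum_rank w) = 0.
Proof.
move=> H w Dw; rewrite !mxE (bigD1 (enum_rank w)) //= !mxE !enum_rankK.
rewrite big1 => [|s _]; last by rewrite unipotent_diag.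
rewrite mulr1 addrAC subrr add0r; apply: big1 => a nwa.
rewrite !mxE enum_rankK; set v := enum_val a.
have [/existsP[s /eqP Hs]|] := boolP [exists s, unipotent e c (v s) (w s) == 0].
  by rewrite (bigD1 s) //= Hs mul0r mulr0.
rewrite negb_exists => /forallP nz.
have le s : (lower_block (w s) <= lower_block (v s))%N.
  by have /unipotent_entry [->|/andP[-> _]] := nz s => //; case: lower_block.
have [s ns] : exists s, v s <> w s.
  apply: contrapT => /forallNP E; move: nwa; rewrite -(enum_valK a) -/v => /eqP; apply.
  by congr enum_rank; apply/ffunP => s; apply: contrapT.
suff lt : (lower_count w < lower_count v)%N.
  by rewrite -(enum_valK a) H ?mul0r //; apply: leq_ltn_trans lt.
rewrite /lower_count (bigD1 s) //= [X in (_ < X)%N](bigD1 s) //=.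
have /unipotent_entry [//|/andP[-> /negPf ->]] := nz s.
by rewrite add0n add1n ltnS; apply: leq_sum.
Qed.

(* The orthogonal complement of the polynomials in [phi psi] among the
   invariants is stable under the unipotent group, so its elements of lowest
   degree in the lower block are fixed by that group; but then they are
   determined by their restriction to the upper block, where [psi] can be
   normalised to [1]. *)
Theorem first_fundamental_block N (l : tensor C index N) :
  GL_invariant (tensor_eval l) -> product_poly (tensor_eval l).
Proof.
pose V (l : tensor C index N) := GL_invariant (tensor_eval l).
pose S (l : tensor C index N) := V l /\ product_poly (tensor_eval l).
have V0 : V 0 by move=> g phi psi t _; rewrite !tensor_eval0.
have Vlin a u v : V u -> V v -> V (a *: u + v).
  by move=> Vu Vv g phi psi t ug; rewrite !tensor_evalD Vu // Vv.
have evE a (u v : tensor C index N) : tensor_eval (a *: u + v) = fun x => a * tensor_eval u x + tensor_eval v x.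
  by apply/funext => x; rewrite tensor_evalD.
have S0 : S 0.
  split=> //; have -> : tensor_eval (0 : tensor C index N) = fun=> 0.
    by apply/funext => x; rewrite tensor_eval0.
  exact: gen_const.
have Slin a u v : S u -> S v -> S (a *: u + v).
  move=> [Vu Pu] [Vv Pv]; split; first exact: Vlin.
  rewrite evE; apply: gen_add => //; apply: gen_mul => //; exact: gen_const.
(* [p] and [s] are arbitrary, because adjoints of [unipotent e c] occur below and these are
   triangular the other way round. *)
have Vstab (u : tensor C index N) p s : V u -> V (u *m tensor_power N (pack_lin p 1%:M 1%:M s)).
  move=> Vu g phi psi t ug; rewrite !tensor_eval_power !lin_act_pack !mulmx1 !mul1mx.
  by rewrite mulmxA -(mulmxA g) Vu.
have Pstab (u : tensor C index N) p s : product_poly (tensor_eval u) ->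
    product_poly (tensor_eval (u *m tensor_power N (pack_lin p 1%:M 1%:M s))).
  move=> Pu; have -> : tensor_eval (u *m tensor_power N (pack_lin p 1%:M 1%:M s)) =
     tensor_eval u \o lin_act (pack_lin p 1%:M 1%:M s).
    by apply/funext => x; rewrite tensor_eval_power.
  have actE (x : index -> C) := congr1 (lin_act (pack_lin p 1%:M 1%:M s)) (packK x).
  apply: generated_comp Pu => h [[j ->]|[a [c ->]]].
    apply: gen_coord; left; exists j; apply/funext => x /=.
    by rewrite actE lin_act_pack.
  have -> : ((fun x : index -> C => \sum_b x (inl (inl (a, b))) * x (inl (inr (b, c)))) \o
      lin_act (pack_lin p 1%:M 1%:M s)) = fun x => \sum_i \sum_j p a i * s j c *
      \sum_b x (inl (inl (i, b))) * x (inl (inr (b, j))).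
    apply/funext => x /=; rewrite actE lin_act_pack /= !mulmx1 !mul1mx.
    transitivity ((p *m ((\matrix_(a, b) x (inl (inl (a, b)))) *m
       (\matrix_(b, c) x (inl (inr (b, c))))) *m s) a c).
      by rewrite !mulmxA -(mulmxA _ _ s) mxE.
    rewrite mxE exchange_big /=; apply: eq_bigr => j _; rewrite mxE big_distrl /=.
    apply: eq_bigr => i _; rewrite mxE mulrAC; congr (_ * _).
    by apply: eq_bigr => b _; rewrite !mxE.
  apply: generated_sum => i _; apply: generated_sum => j _; apply: gen_mul.
    exact: gen_const.
  by apply: gen_coord; right; exists i, j.
pose M (u : tensor C index N) := V u /\ forall s, S s -> u *m adjmx s = 0.
have Mstab u e c : M u -> M (u *m tensor_power N (unipotent e c) - u).
  move=> [Vu Hu]; split.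
    by rewrite -scaleN1r addrC; apply: Vlin => //; apply: Vstab.
  move=> s Ss; rewrite mulmxBl Hu // subr0 -mulmxA.
  rewrite -[tensor_power _ _]adjmxK -adjmxM adjmx_tensor_power lin_adj_pack Hu //.
  have E1 : adjmx (1%:M : 'M[C]_r) = 1%:M by rewrite /adjmx trmx1 map_mx1.
  by rewrite !E1; split; [apply: Vstab; case: Ss|apply: Pstab; case: Ss].
have M0 D u : M u -> (forall w, (D <= lower_count w)%N -> u 0 (enum_rank w) = 0) -> u = 0.
  elim: D u => [|D IH] u Mu Hu.
    by apply/rowP => a; rewrite mxE -[a]enum_valK Hu.
  have fix_u e c : u *m tensor_power N (unipotent e c) = u.
    apply/eqP; rewrite -subr_eq0; apply/eqP; apply: IH; first exact: Mstab.
    exact: unipotent_sub_lower.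
  (* Being fixed by the unipotent group, [u] lies both in [S] and in its orthogonal complement. *)
  apply: adj_self0; case: Mu => Vu; apply; split=> //.
  apply: product_poly_tensor => // e c phi psi t.
  by rewrite -{2}(fix_u e c) tensor_eval_power lin_act_pack mulmx1 mul1mx.
move=> Vl; have [s [u [El [Vs Ps] Hu]]] := ortho_decomp S0 Slin l.
suff u0 : u = 0 by rewrite El u0 addr0.
(* No word of length [N] has [N.+1] lower letters, so the vanishing condition is void. *)
apply: (M0 N.+1).
  split=> //; have -> : u = (-1) *: s + l by rewrite El scaleN1r addrA addNr add0r.
  exact: Vlin.
move=> w; rewrite ltnNge => /negP[]; rewrite /lower_count.
have : (\sum_s lower_block (w s) <= \sum_(s < N) 1)%N.
  by apply: leq_sum => s' _; case: lower_block.
by rewrite sum1_card card_ord.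
Qed.

End Unipotent.

Theorem first_fundamental (C : numClosedFieldType) n r (J : finType) N
    (l : tensor C (fft_index n r J) N) : (r <= n)%N ->
  GL_invariant (tensor_eval l) -> product_poly (tensor_eval l).
Proof.
by move=> rn; move: l; rewrite -(subnKC rn); apply: first_fundamental_block.
Qed.

Section RelativeInvariants.
Variables (C : numClosedFieldType) (n r : nat) (T : Type) (S : (T -> C) -> Prop).
Variables (phi : T -> 'M[C]_(n, r)) (psi : T -> 'M[C]_(r, n)).

(** The functions in [S] do not change under the action, so they become the inert variables of
    [pack]. The tensor of [f] is invariant only at the points [pt y], which form a stable set; it is
    replaced by one that is invariant everywhere, to which the first fundamental theorem applies. *)
Lemma relative_invariants f : (r <= n)%N ->
  (forall y g, g \in unitmx -> exists y', [/\ phi y' = phi y *m invmx g,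
     psi y' = g *m psi y, forall t, S t -> t y' = t y & f y' = f y]) ->
  generated (fun h => [\/ S h, exists a b, h = fun y => phi y a b |
     exists a b, h = fun y => psi y a b]) f ->
  generated (fun h => S h \/ exists a b, h = fun y => (phi y *m psi y) a b) f.
Proof.
move=> rn act Hf.
pose c (i : pair_index n r) : T -> C := match i with
  | inl ab => fun y => phi y ab.1 ab.2
  | inr bc => fun y => psi y bc.1 bc.2 end.
have {}Hf : generated (fun h => S h \/ exists a, h = c a) f.
  apply: generated_sub Hf => h [Sh|[a [b ->]]|[a [b ->]]]; apply: gen_coord.
  - by left.
  - by right; exists (inl (a, b)).
  - by right; exists (inr (a, b)).
have [J [t [N [l [Gt El]]]]] := generated_tensor Hf.
pose pt y : fft_index n r J -> C := pack (phi y) (psi y) (t^~ y).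
have {}El y : f y = tensor_eval l (pt y).
  by rewrite El; congr tensor_eval; apply/funext => -[[[a b]|[b d]]|j].
have tinv y y' : (forall u, S u -> u y' = u y) -> t^~ y' = t^~ y.
  move=> H; apply/funext => j; elim: (Gt j) => //=.
  - by move=> h1 h2 _ -> _ ->.
  - by move=> h1 h2 _ -> _ ->.
(* Closed under adjoints, as the adjoint of [invmx g] is the inverse of the adjoint of [g]. *)
pose G k := exists2 g : 'M[C]_r, g \in unitmx & k = pack_lin 1%:M (invmx g) g 1%:M :> (fft_index n r J -> _).
have actE y g : g \in unitmx -> exists2 y', f y' = f y &
    lin_act (pack_lin 1%:M (invmx g) g 1%:M) (pt y) = pt y'.
  move=> ug; have [y' [E1 E2 E3 E4]] := act y g ug; exists y' => //.
  by rewrite lin_act_pack mul1mx mulmx1 /pt E1 E2 (tinv _ _ E3).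
have adj1 k : adjmx (1%:M : 'M[C]_k) = 1%:M by rewrite /adjmx trmx1 map_mx1.
have [||k y [g ug ->] [y0 ->]|u [uinv Eu]] :=
  @tensor_lift_invariant C _ N (fun x => exists y, x = pt y) G l.
- move=> _ [g ug ->]; exists (adjmx g).
    by rewrite /adjmx map_unitmx unitmx_tr.
  by rewrite lin_adj_pack !adj1 /adjmx trmx_inv map_invmx.
- by move=> k _ [g ug ->] [y ->]; have [y' _ ->] := actE y g ug; exists y'.
- by have [y' Ef ->] := actE y0 g ug; rewrite -!El.
have uinv' : GL_invariant (tensor_eval u).
  move=> g p s x ug; rewrite -(uinv _ (pack p s x) (ex_intro2 _ _ g ug erefl)).
  by rewrite lin_act_pack mul1mx mulmx1.
have -> : f = tensor_eval u \o pt.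
  by apply/funext => y /=; rewrite El Eu //; exists y.
apply: generated_comp (first_fundamental rn uinv') => h [[j ->]|[a [b ->]]].
  apply: generated_sub (Gt j) => h' Sh; apply: gen_coord; by left.
apply: gen_coord; right; exists a, b; apply/funext => y /=; by rewrite mxE.
Qed.

End RelativeInvariants.

(** * Surface words *)

Section SurfaceWords.
Variables (H : groupType) (g k : nat).
Local Open Scope group_scope.

Notation index := (surface_index g k).
Notation tup := (index -> H).

(** Words serve twice: they commute with simultaneous conjugation ([word_map_conj]), and for
    invertible matrices they are regular ([word_map_regular]). *)
Inductive word_map : (tup -> H) -> Prop :=
  | word_coord i : word_map (fun z => z i)
  | word_one : word_map (fun=> 1)
  | word_mul f h : word_map f -> word_map h -> word_map (fun z => f z * h z)
  | word_inv f : word_map f -> word_map (fun z => (f z)^-1).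

Lemma word_map_comp f (th : tup -> tup) :
  word_map f -> (forall i, word_map (fun z => th z i)) -> word_map (f \o th).
Proof.
move=> Hf Hth; elim: Hf => [i||f1 f2 _ H1 _ H2|f1 _ H1].
- exact: Hth.
- exact: word_one.
- exact: (word_mul H1 H2).
- exact: (word_inv H1).
Qed.

Lemma word_map_conj f p z : word_map f ->
  f (fun i => p * z i * p^-1) = p * f z * p^-1.
Proof.
elim=> [i||f1 f2 _ -> _ ->|f1 _ ->] //.
- by rewrite mulg1 mulgV.
- by rewrite !mulgA mulgVK.
- by rewrite !invgM invgK mulgA.
Qed.

Lemma word_map_prod (I : Type) (r : seq I) (F : I -> tup -> H) :
  (forall i, word_map (F i)) -> word_map (fun z => \prod_(i <- r) F i z).
Proof.
move=> HF; elim: r => [|i r IH].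
  have -> : (fun z : tup => \prod_(i <- [::]) F i z) = fun=> 1.
    by apply/funext => z; rewrite big_nil.
  exact: word_one.
have -> : (fun z : tup => \prod_(j <- i :: r) F j z) =
    fun z => F i z * \prod_(j <- r) F j z.
  by apply/funext => z; rewrite big_cons.
exact: word_mul.
Qed.

(* With [a = matA z i] and [b = matB z i], the letters of index [i] stand for
   [b] and [a^-1 b^-1 a], which are [1 + aa^*] and [(1 + a^*a)^-1]. *)
Definition letter (l : index) (z : tup) : H :=
  match l with
  | inl (inl i) => z (inl (inr i))
  | inl (inr i) => (z (inl (inl i)))^-1 * (z (inl (inr i)))^-1 * z (inl (inl i))
  | inr j => z (inr j)
  end.

Definition atom_type : finType := ('I_g + 'I_k)%type.

Definition atom (t : atom_type) (z : tup) : H :=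
  match t with
  | inl i => z (inl (inl i)) * z (inl (inr i)) * (z (inl (inl i)))^-1 *
      (z (inl (inr i)))^-1
  | inr j => z (inr j)
  end.

Definition atom_letters (t : atom_type) : seq index :=
  match t with
  | inl i => [:: inl (inl i); inl (inr i)]
  | inr j => [:: inr j]
  end.

Definition owner (l : index) : atom_type :=
  match l with
  | inl (inl i) | inl (inr i) => inl i
  | inr j => inr j
  end.

Definition eval_word (W : seq index) (z : tup) : H := \prod_(l <- W) letter l z.

Lemma word_map_letter l : word_map (letter l).
Proof.
case: l => [[i|i]|j] /=; do ?[exact: word_coord]; apply: word_mul; last exact: word_coord.
by apply: word_mul; apply: word_inv; apply: word_coord.
Qed.

Lemma word_map_eval W : word_map (eval_word W).
Proof. by apply: word_map_prod => l; apply: word_map_letter. Qed.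

Lemma mem_atom_letters l t : (l \in atom_letters t) = (owner l == t).
Proof. by case: l => [[i|i]|j]; case: t => [i'|j'] //=; rewrite ?inE ?orbF. Qed.

Lemma letter_local l (y z : tup) :
  (forall i, owner i = owner l -> y i = z i) -> letter l y = letter l z.
Proof. by case: l => [[i|i]|j] /= E; rewrite !E. Qed.

Lemma atom_local t (y z : tup) :
  (forall i, owner i = t -> y i = z i) -> atom t y = atom t z.
Proof. by case: t => [i|j] /= E; rewrite !E. Qed.

Lemma eval_word_local W (y z : tup) :
  (forall i, owner i \in map owner W -> y i = z i) -> eval_word W y = eval_word W z.
Proof.
move=> E; apply: eq_big_seq => l lW; apply: letter_local => i Ei.
by apply: E; rewrite Ei map_f.
Qed.

(** [auto_class] is what preserves the closure conditions at the punctures. *)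
Record tuple_auto (th th' : tup -> tup) : Prop := TupleAuto {
  auto_can : cancel th th';
  auto_can' : cancel th' th;
  auto_word : forall i, word_map (fun z => th z i);
  auto_word' : forall i, word_map (fun z => th' z i);
  auto_class : forall z j, exists p, th z (inr j) = p * z (inr j) * p^-1 }.

Lemma tuple_auto_comp th1 th1' th2 th2' :
  tuple_auto th1 th1' -> tuple_auto th2 th2' ->
  tuple_auto (th2 \o th1) (th1' \o th2').
Proof.
move=> [a1 b1 c1 d1 e1] [a2 b2 c2 d2 e2]; split.
- exact: can_comp.
- exact: can_comp.
- by move=> i; apply: (word_map_comp (c2 i)).
- by move=> i; apply: (word_map_comp (d1 i)).
move=> z j /=; have [p ->] := e2 (th1 z) j; have [q ->] := e1 z j.
by exists (p * q); rewrite invgM !mulgA.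
Qed.

Lemma tuple_auto_id : tuple_auto id id.
Proof.
split=> // [i|i|z j]; try exact: word_coord.
by exists 1; rewrite invg1 mulg1 mul1g.
Qed.

Definition update1 (j : 'I_k) (f : tup -> H) (z : tup) (l : index) : H :=
  if l == inr j then f z else z l.

Definition update2 (i : 'I_g) (f h : tup -> H) (z : tup) (l : index) : H :=
  if l == inl (inl i) then f z else if l == inl (inr i) then h z else z l.

Lemma word_map_update1 j f : word_map f -> forall l, word_map (fun z => update1 j f z l).
Proof. by move=> Hf l; rewrite /update1; case: (l == inr j) => //; apply: word_coord. Qed.

Lemma word_map_update2 i f h : word_map f -> word_map h ->
  forall l, word_map (fun z => update2 i f h z l).
Proof.
move=> Hf Hh l; rewrite /update2; case: (l == inl (inl i)) => //.
by case: (l == inl (inr i)) => //; apply: word_coord.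
Qed.

Lemma update1_auto j f f' : word_map f -> word_map f' ->
  (forall z, exists p, f z = p * z (inr j) * p^-1) ->
  (forall z, f' (update1 j f z) = z (inr j)) ->
  (forall z, f (update1 j f' z) = z (inr j)) ->
  tuple_auto (update1 j f) (update1 j f').
Proof.
move=> Hf Hf' cf E E'; split; try exact: word_map_update1.
- move=> z; apply/funext => l; have [->|/negPf n] := eqVneq l (inr j).
    by rewrite {1}/update1 eqxx.
  by rewrite /update1 n.
- move=> z; apply/funext => l; have [->|/negPf n] := eqVneq l (inr j).
    by rewrite {1}/update1 eqxx.
  by rewrite /update1 n.
move=> z j'; rewrite /update1; have [[->]|_] := eqVneq (inr j' : index) (inr j); first exact: cf.
by exists 1; rewrite invg1 mulg1 mul1g.
Qed.

Lemma update2_auto i f h f' h' :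
  word_map f -> word_map h -> word_map f' -> word_map h' ->
  (forall z, f' (update2 i f h z) = z (inl (inl i)) /\ h' (update2 i f h z) = z (inl (inr i))) ->
  (forall z, f (update2 i f' h' z) = z (inl (inl i)) /\ h (update2 i f' h' z) = z (inl (inr i))) ->
  tuple_auto (update2 i f h) (update2 i f' h').
Proof.
move=> Hf Hh Hf' Hh' E E'; split; try exact: word_map_update2.
- move=> z; apply/funext => l; have [E1 E2] := E z.
  have [->|/negPf n] := eqVneq l (inl (inl i)); first by rewrite {1}/update2 eqxx.
  have [->|/negPf n'] := eqVneq l (inl (inr i)); first by rewrite {1}/update2 eqxx.
  by rewrite /update2 n n'.
- move=> z; apply/funext => l; have [E1 E2] := E' z.
  have [->|/negPf n] := eqVneq l (inl (inl i)); first by rewrite {1}/update2 eqxx.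
  have [->|/negPf n'] := eqVneq l (inl (inr i)); first by rewrite {1}/update2 eqxx.
  by rewrite /update2 n n'.
by move=> z j'; exists 1; rewrite invg1 mulg1 mul1g.
Qed.

Lemma eval_word_cat W1 W2 z : eval_word (W1 ++ W2) z = eval_word W1 z * eval_word W2 z.
Proof. by rewrite /eval_word big_cat. Qed.

Lemma eval_word_cons l W z : eval_word (l :: W) z = letter l z * eval_word W z.
Proof. by rewrite /eval_word big_cons. Qed.

Local Ltac gsimpl := rewrite ?(invgM, invgK, mulgA, mulgK, mulgVK, mulVg, mulgV, mul1g, mulg1).

Local Ltac wm := repeat first [exact: word_coord | exact: word_map_eval | apply: word_mul | apply: word_inv].

(** [p c v = (p c p^-1) p v], and conjugation of the coordinate [c] by [p] is invertible by words
    because [p] does not involve [c]. *)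
Lemma extract_puncture j P V : inr j \notin P ++ V ->
  exists th th', [/\ tuple_auto th th',
    forall z, eval_word (P ++ inr j :: V) z = atom (inr j) (th z) * eval_word (P ++ V) z &
    forall z l, owner l != inr j -> th z l = z l].
Proof.
rewrite mem_cat negb_or => /andP[jP jV].
pose p := eval_word P.
pose f (z : tup) : H := p z * z (inr j) * (p z)^-1.
pose f' (z : tup) : H := (p z)^-1 * z (inr j) * p z.
have Ep h z : p (update1 j h z) = p z.
  apply: eval_word_local => l lP; rewrite /update1; case: eqVneq => // El.
  move: lP; rewrite El /= => /mapP[[[i|i]|j'] l'P] // [Ej].
  by rewrite Ej l'P in jP.
have Ej h z : update1 j h z (inr j) = h z by rewrite /update1 eqxx.
exists (update1 j f), (update1 j f'); split.
- apply: update1_auto; rewrite /f /f'; do ?by wm.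
  + by move=> z; exists (p z).
  + by move=> z; rewrite Ep Ej; gsimpl.
  + by move=> z; rewrite Ep Ej; gsimpl.
- move=> z; rewrite eval_word_cat eval_word_cons eval_word_cat /= Ej /f -/(p z).
  by gsimpl.
by move=> z l nl; rewrite /update1; case: eqVneq => // El; rewrite El eqxx in nl.
Qed.

(** [p] and [u] do not involve the two coordinates of the handle, so they behave as constants when
    these are replaced by the entries [f], [h] of the commutator; [f'], [h'] solve for the old
    coordinates. *)
Lemma extract_handle i P U V X Y :
  all (fun l => owner l != inl i) (P ++ U ++ V) ->
  perm_eq [:: X; Y] [:: inl (inl i); inl (inr i)] ->
  exists th th', [/\ tuple_auto th th',
    forall z, eval_word (P ++ X :: U ++ Y :: V) z =
       atom (inl i) (th z) * eval_word (P ++ U ++ V) z &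
    forall z l, owner l != inl i -> th z l = z l].
Proof.
rewrite !all_cat => /andP[iP /andP[iU iV]] perm.
pose p := eval_word P; pose u := eval_word U.
have loc W h h' z : all (fun l => owner l != inl i) W ->
    eval_word W (update2 i h h' z) = eval_word W z.
  move=> iW; apply: eval_word_local => l lW.
  have nl : owner l != inl i by move: lW => /mapP[l' /(allP iW) n ->].
  rewrite /update2; case: eqVneq => [El|_]; first by rewrite El eqxx in nl.
  by case: eqVneq => // El; rewrite El eqxx in nl.
have Ea h h' z : update2 i h h' z (inl (inl i)) = h z by rewrite /update2 eqxx.
have Eb h h' z : update2 i h h' z (inl (inr i)) = h' z by rewrite /update2 eqxx.
have out h h' z l : owner l != inl i -> update2 i h h' z l = z l.
  move=> nl; rewrite /update2; case: eqVneq => [El|_]; first by rewrite El eqxx in nl.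
  by case: eqVneq => // El; rewrite El eqxx in nl.
have : (X = inl (inl i) /\ Y = inl (inr i)) \/ (X = inl (inr i) /\ Y = inl (inl i)).
  have := perm_mem perm X; rewrite !inE eqxx /= => /esym /orP[]/eqP EX; [left|right].
    by move: perm; rewrite EX perm_cons => /perm_mem /(_ Y); rewrite !inE eqxx => /esym/eqP.
  move: perm; rewrite EX perm_sym (perm_catC [:: _] [:: _]) perm_cons.
  by move=> /perm_mem /(_ Y); rewrite !inE eqxx => /eqP.
move=> [[-> ->]|[-> ->]].
(* [p b u (a^-1 b^-1 a) v = [p b p^-1, p u a^-1 p^-1] p u v]. *)
- pose a (z : tup) : H := z (inl (inl i)); pose b (z : tup) : H := z (inl (inr i)).
  pose f (z : tup) : H := p z * b z * (p z)^-1.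
  pose h (z : tup) : H := p z * u z * (a z)^-1 * (p z)^-1.
  pose f' (z : tup) : H := (p z)^-1 * (b z)^-1 * p z * u z.
  pose h' (z : tup) : H := (p z)^-1 * a z * p z.
  exists (update2 i f h), (update2 i f' h'); split; last by move=> z l; apply: out.
  + apply: update2_auto; rewrite /f /h /f' /h' /a /b; do ?by wm.
    * by move=> z; rewrite /p /u !loc // Ea Eb; split; gsimpl.
    * by move=> z; rewrite /p /u !loc // Ea Eb; split; gsimpl.
  move=> z; rewrite !(eval_word_cat, eval_word_cons) /= Ea Eb /f /h /a /b /p /u.
  by gsimpl.
(* [p (a^-1 b^-1 a) u b v = [p a^-1 u^-1 p^-1, p u b^-1 u^-1 p^-1] p u v]. *)
pose a (z : tup) : H := z (inl (inl i)); pose b (z : tup) : H := z (inl (inr i)).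
pose f (z : tup) : H := p z * (a z)^-1 * (u z)^-1 * (p z)^-1.
pose h (z : tup) : H := p z * u z * (b z)^-1 * (u z)^-1 * (p z)^-1.
pose f' (z : tup) : H := (u z)^-1 * (p z)^-1 * (a z)^-1 * p z.
pose h' (z : tup) : H := (u z)^-1 * (p z)^-1 * (b z)^-1 * p z * u z.
exists (update2 i f h), (update2 i f' h'); split; last by move=> z l; apply: out.
- apply: update2_auto; rewrite /f /h /f' /h' /a /b; do ?by wm.
  + by move=> z; rewrite /p /u !loc // Ea Eb; split; gsimpl.
  + by move=> z; rewrite /p /u !loc // Ea Eb; split; gsimpl.
move=> z; rewrite !(eval_word_cat, eval_word_cons) /= Ea Eb /f /h /a /b /p /u.
by gsimpl.
Qed.

Lemma split_two (I : eqType) (x y : I) W : x \in W -> y \in W -> x != y ->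
  exists P U V, W = P ++ x :: U ++ y :: V \/ W = P ++ y :: U ++ x :: V.
Proof.
move=> /splitPr[P V]; rewrite mem_cat inE => /or3P[/splitPr[P1 P2]|/eqP ->|/splitPr[V1 V2]].
- by exists P1, P2, V; right; rewrite -catA.
- by rewrite eqxx.
- by exists P, V1, V2; left.
Qed.

(* The atoms are pulled out one at a time, each by an automorphism that only
   changes the coordinates of that atom. *)
Lemma normalize_word ts W : uniq ts ->
  perm_eq W (flatten (map atom_letters ts)) ->
  exists th th', [/\ tuple_auto th th',
    forall z, eval_word W z = \prod_(t <- ts) atom t (th z) &
    forall z l, owner l \notin ts -> th z l = z l].
Proof.
elim: ts W => [|t ts IH] W /=.
  move=> _ /perm_nilP ->; exists id, id; split=> //; first exact: tuple_auto_id.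
  by move=> z; rewrite /eval_word !big_nil.
move=> /andP[nt uts] perm.
have out l : l \in flatten (map atom_letters ts) -> owner l != t.
  move=> /flatten_mapP[t' t'ts]; rewrite mem_atom_letters => /eqP ->.
  by apply: contraNneq nt => <-.
suff [th1 [th1' [W' [au1 perm' E1 out1]]]] : exists th th' W',
    [/\ tuple_auto th th', perm_eq W' (flatten (map atom_letters ts)),
      forall z, eval_word W z = atom t (th z) * eval_word W' z &
      forall z l, owner l != t -> th z l = z l].
  have [th2 [th2' [au2 E2 out2]]] := IH W' uts perm'.
  exists (th2 \o th1), (th1' \o th2'); split; first exact: tuple_auto_comp.
    move=> z; rewrite E1 big_cons /= -E2; congr (_ * _).
      by apply: atom_local => i Ei; rewrite out2 // Ei.
    apply: eval_word_local => i /mapP[l lW Ei]; rewrite out1 // Ei.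
    by apply: out; rewrite -(perm_mem perm').
  move=> z l; rewrite inE negb_or => /andP[lt lts] /=.
  by rewrite out2 // out1.
case: t nt out perm => [i|j] nt out perm.
  have iW : inl (inl i) \in W by rewrite (perm_mem perm) inE eqxx.
  have iW' : inl (inr i) \in W by rewrite (perm_mem perm) !inE eqxx orbT.
  have [P [U [V [X [Y [EW pXY]]]]]] : exists P U V X Y, W = P ++ X :: U ++ Y :: V /\
      perm_eq [:: X; Y] [:: inl (inl i); inl (inr i)].
    have [//|P [U [V [EW|EW]]]] := split_two iW iW'.
      by exists P, U, V, (inl (inl i)), (inl (inr i)).
    exists P, U, V, (inl (inr i)), (inl (inl i)); split=> //.
    exact/permPl/(perm_catC [:: _] [:: _]).
  have perm' : perm_eq (P ++ U ++ V) (flatten (map atom_letters ts)).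
    apply/permP => a; move/permP/(_ a): perm; move/permP/(_ a): pXY.
    by rewrite EW /= !count_cat /= !count_cat /=; lia.
  have [|th [th' [au E o]]] := @extract_handle i P U V X Y _ pXY.
    by apply/allP => l; rewrite (perm_mem perm') => /out.
  by exists th, th', (P ++ U ++ V); split=> // z; rewrite EW.
have : inr j \in W by rewrite (perm_mem perm) inE eqxx.
move=> /splitPr S; case: S perm => P V perm.
have perm' : perm_eq (P ++ V) (flatten (map atom_letters ts)).
  apply/permP => a; move/permP/(_ a): perm.
  by rewrite /= !count_cat /= => /eqP; rewrite addnCA eqn_add2l => /eqP.
have [|th [th' [au E o]]] := @extract_puncture j P V.
  by rewrite (perm_mem perm'); apply/negP => /out; rewrite eqxx.
by exists th, th', (P ++ V); split.
Qed.

End SurfaceWords.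

(** * Regular functions on GL and closures of conjugacy classes *)

Section GeneralLinear.
Variables (K : fieldType) (n : nat).

(** The points of [GL K n] under a name that can carry a group structure; the two types are
    convertible. *)
Definition gl : Type := {A : 'M[K]_n | A \in unitmx}.
HB.instance Definition _ := Choice.on gl.

Definition to_gl (A : 'M[K]_n) (uA : A \in unitmx) : gl :=
  exist (fun A : 'M[K]_n => A \in unitmx) A uA.

Definition gl_one : gl := to_gl (unitmx1 K n).

Lemma gl_mul_subproof (A B : gl) : sval A *m sval B \in unitmx.
Proof. by rewrite unitmx_mul (svalP A) (svalP B). Qed.
Definition gl_mul (A B : gl) : gl := to_gl (gl_mul_subproof A B).

Lemma gl_inv_subproof (A : gl) : invmx (sval A) \in unitmx.
Proof. by rewrite unitmx_inv (svalP A). Qed.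
Definition gl_inv (A : gl) : gl := to_gl (gl_inv_subproof A).

Lemma gl_eq (A B : gl) : sval A = sval B -> A = B.
Proof. by move=> E; apply: val_inj. Qed.

Lemma gl_mulA : associative gl_mul.
Proof. by move=> A B D; apply: gl_eq; rewrite /= mulmxA. Qed.
Lemma gl_mul1 : left_id gl_one gl_mul.
Proof. by move=> A; apply: gl_eq; rewrite /= mul1mx. Qed.
Lemma gl_1mul : right_id gl_one gl_mul.
Proof. by move=> A; apply: gl_eq; rewrite /= mulmx1. Qed.
Lemma gl_mulV : left_inverse gl_one gl_inv gl_mul.
Proof. by move=> A; apply: gl_eq; rewrite /= mulVmx // (svalP A). Qed.
Lemma gl_Vmul : right_inverse gl_one gl_inv gl_mul.
Proof. by move=> A; apply: gl_eq; rewrite /= mulmxV // (svalP A). Qed.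

HB.instance Definition _ := isGroup.Build gl gl_mulA gl_mul1 gl_1mul gl_mulV gl_Vmul.

Lemma gl_coord_regular i j : regular (v := GL K n) (fun A => sval A i j).
Proof. by apply: gen_coord; left; exists i, j. Qed.

Lemma gl_detV_regular : regular (v := GL K n) (fun A => (\det (sval A))^-1).
Proof. by apply: gen_coord; right. Qed.

Lemma generated_invmx (T : Type) (S : (T -> K) -> Prop) (A : T -> 'M[K]_n) :
  (forall x, A x \in unitmx) ->
  (forall i j, generated S (fun x => A x i j)) ->
  generated S (fun x => (\det (A x))^-1) ->
  forall i j, generated S (fun x => invmx (A x) i j).
Proof.
move=> uA HA HD i j.
have -> : (fun x => invmx (A x) i j) = fun x => (\det (A x))^-1 *
    ((-1) ^+ (j + i) * \det (row' j (col' i (A x)))).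
  by apply/funext => x; rewrite /invmx uA !mxE.
apply: gen_mul => //; apply: gen_mul; first exact: gen_const.
apply: generated_det => i' j'.
have -> : (fun x => row' j (col' i (A x)) i' j') = fun x => A x (lift j i') (lift i j').
  by apply/funext => x; rewrite !mxE.
exact: HA.
Qed.

Lemma gl_regular_comp (T : Type) (S : (T -> K) -> Prop) (F : T -> GL K n) f :
  (forall i j, generated S (fun x => sval (F x) i j)) ->
  generated S (fun x => (\det (sval (F x)))^-1) ->
  regular (v := GL K n) f -> generated S (f \o F).
Proof.
move=> H1 H2; apply: generated_comp => h [[i [j E]]|E].
  have -> : h = fun A => sval A i j by apply/funext.
  exact: H1.
have -> : h = fun A => (\det (sval A))^-1 by apply/funext.
exact: H2.
Qed.

Lemma power_coord_regular (I : Type) (i : I) f :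
  regular (v := GL K n) f -> regular (v := power I (GL K n)) (fun x => f (x i)).
Proof. by move=> Hf; apply: gen_coord; exists i, f. Qed.

Lemma word_map_regular g k (F : (surface_index g k -> gl) -> gl) f :
  word_map F -> regular (v := GL K n) f ->
  regular (v := power (surface_index g k) (GL K n)) (f \o F).
Proof.
move=> HF; elim: HF f => [i||F1 F2 _ H1 _ H2|F1 _ H1] f Hf.
- exact: power_coord_regular.
- exact: gen_const.
- apply: gl_regular_comp Hf.
    apply: (generated_mulmx (A := fun x => sval (F1 x)) (B := fun x => sval (F2 x))) => i j.
      by apply: (H1 (fun A => sval A i j)); apply: gl_coord_regular.
    by apply: (H2 (fun A => sval A i j)); apply: gl_coord_regular.
  have -> : (fun x : surface_index g k -> gl => (\det (sval (F1 x * F2 x)%g))^-1) =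
      fun x => (\det (sval (F1 x)))^-1 * (\det (sval (F2 x)))^-1.
    by apply/funext => x; rewrite /= det_mulmx invfM.
  apply: gen_mul.
    exact: (H1 (fun A => (\det (sval A))^-1) gl_detV_regular).
  exact: (H2 (fun A => (\det (sval A))^-1) gl_detV_regular).
apply: gl_regular_comp Hf.
  apply: generated_invmx => [x|i j|]; first exact: (svalP (F1 x)).
    by apply: (H1 (fun A => sval A i j)); apply: gl_coord_regular.
  exact: (H1 (fun A => (\det (sval A))^-1) gl_detV_regular).
have -> : (fun x : surface_index g k -> gl => (\det (sval (F1 x)^-1%g))^-1) =
    fun x => \det (sval (F1 x)).
  by apply/funext => x; rewrite /= det_inv invrK.
apply: generated_det => i j.
by apply: (H1 (fun A => sval A i j)); apply: gl_coord_regular.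
Qed.

End GeneralLinear.

Section Closure.
Variables (K : numFieldType) (n : nat) (Cl : GL K n -> Prop) (A : GL K n).
Hypotheses (ClP : conjugacy_class Cl) (ClA : Cl A).

Lemma class_similar B : Cl B <-> similarmx (sval A) (sval B).
Proof.
have [A0 HA0] := ClP; have [P EP] := (HA0 A).1 ClA.
have sA : similarmx (sval A0) (sval A) by exists (sval P); first exact: (svalP P).
split=> [/HA0[Q EQ]|/(similarmx_trans sA) [Q uQ EQ]].
  apply: similarmx_trans (similarmx_sym sA) _.
  by exists (sval Q); first exact: (svalP Q).
by apply/HA0; exists (to_gl uQ).
Qed.

Lemma root_prod_generated (T : Type) (S : (T -> K) -> Prop) (M : T -> 'M[K]_n) cs :
  (forall i j, generated S (fun x => M x i j)) ->
  forall i j, generated S (fun x => root_prod (M x) cs i j).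
Proof.
move=> HM; elim: cs => [|c cs IH] i j /=; first exact: gen_const.
apply: generated_mulmx => // a b.
have -> : (fun x => (M x - c%:M) a b) = fun x => M x a b + - (c *+ (a == b)).
  by apply/funext => x; rewrite !mxE.
by apply: gen_add => //; apply: gen_const.
Qed.

(** If the rank of p(B) exceeded that of p(A), a minor of p in bases adapted to p(B) would be a
    regular function that vanishes on the class and equals 1 at [B]. *)
Lemma closure_rank_le B : zariski_closure Cl B -> rank_le (sval B) (sval A).
Proof.
move=> HB cs; rewrite leqNgt; apply/negP => lt.
set M := root_prod (sval B) cs in lt.
have [L HL] := row_fullP (col_base_full M).
have [R HR] := row_freeP (row_base_free M).
have E : L *m M *m R = 1%:M.
  have -> : L *m M = row_base M by rewrite -[X in L *m X]mulmx_base mulmxA HL mul1mx.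
  exact: HR.
pose f (X : GL K n) := \det (L *m root_prod (sval X) cs *m R).
have f0 : f B = 0.
  apply: HB => [|X ClX].
    apply: generated_det; apply: generated_mulmx => [|i j]; last exact: gen_const.
    apply: generated_mulmx => [i j|]; first exact: gen_const.
    by apply: root_prod_generated => i j; apply: gl_coord_regular.
  apply/eqP; apply: contraTT lt; rewrite /f -unitfE -unitmxE -row_free_unit.
  rewrite /row_free -leqNgt => /eqP <-.
  apply: leq_trans (mxrankM_maxl _ _) _; apply: leq_trans (mxrankM_maxr _ _) _.
  have /class_similar sX := ClX.
  exact: (rank_le_similar sX (@rank_le_refl _ _ _)).
by move: f0; rewrite /f -/M E det1 => /eqP; rewrite oner_eq0.
Qed.

(** The determinant agrees with that of [A] off the roots of [e], hence is constant on the line. The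
    whole line therefore lies in GL_n, and regular functions restrict to polynomials on it; one that
    vanishes on the class vanishes off the roots of [e], hence at [t = 0]. *)
Lemma pencil_closure (B : GL K n) (A' : 'M[K]_n) (e : {poly K}) : e != 0 ->
  (forall t, e.[t] != 0 -> similarmx (sval A) ((1 - t) *: sval B + t *: A')) ->
  zariski_closure Cl B.
Proof.
move=> enz He f Hf f0.
pose m t := (1 - t) *: sval B + t *: A'.
have detm t : \det (m t) = \det (sval A).
  have [p Hp] := det_pencil (sval B) A'.
  suff /eqP : (p - (\det (sval A))%:P) * e = 0.
    rewrite mulf_eq0 (negPf enz) orbF subr_eq0 => /eqP Ep.
    by rewrite -Hp Ep hornerC.
  apply: poly_fun0 => x; rewrite hornerM.
  have [->|/He [P uP EP]] := eqVneq e.[x] 0; first by rewrite mulr0.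
  rewrite hornerD hornerN hornerC Hp EP !det_mulmx det_inv mulrAC mulfV ?mul1r ?subrr ?mul0r //.
  by rewrite -unitfE -unitmxE.
have um t : m t \in unitmx by rewrite unitmxE detm -unitmxE; exact: (svalP A).
pose c t : GL K n := to_gl (um t).
have [p Hp] : polynomial_fun (f \o c).
  apply: polynomial_fun_gen; apply: gl_regular_comp Hf.
    move=> i j; have -> : (fun x => sval (c x) i j) =
        fun t => (1 + (-1) * t) * sval B i j + t * A' i j.
      by apply/funext => t; rewrite /= !mxE mulN1r.
    apply: gen_add; apply: gen_mul; do ?exact: gen_const; last exact: gen_coord.
    by apply: gen_add; [exact: gen_const|apply: gen_mul; [exact: gen_const|exact: gen_coord]].
  have -> : (fun x => (\det (sval (c x)))^-1) = fun=> (\det (sval A))^-1.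
    by apply/funext => t /=; rewrite detm.
  exact: gen_const.
have p0 : p = 0.
  suff /eqP : p * e = 0 by rewrite mulf_eq0 (negPf enz) orbF => /eqP.
  apply: poly_fun0 => x; rewrite hornerM -Hp.
  have [->|/He s] := eqVneq e.[x] 0; first by rewrite mulr0.
  by rewrite /= f0 ?mul0r //; apply/class_similar.
have -> : B = c 0 by apply: gl_eq; rewrite /= /m subr0 scale1r scale0r addr0.
by rewrite -[LHS]/((f \o c) 0) Hp p0 horner0.
Qed.

End Closure.

Lemma leg_closure (K : numFieldType) m (d : nat -> nat) (xi : nat -> K)
    (Cl : GL K (d 0) -> Prop) (A B : GL K (d 0)) :
  conjugacy_class Cl -> Cl A -> leg_type m xi (sval A) ->
  zariski_closure Cl B <-> rank_le (sval B) (sval A).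
Proof.
move=> HCl ClA tA; split; first exact: closure_rank_le.
by move=> /(leg_pencil tA) [A' [e [_ enz He]]]; apply: pencil_closure He.
Qed.

(** * Representations of the multiplicative preprojective algebra *)

Section FreeAlgebra.
Variables (K : fieldType) (I : choiceType).

Lemma free_alg_ind (P : free_alg K I -> Prop) :
  P 1 -> (forall f h, P f -> P h -> P (f + h)) -> (forall c f, P f -> P (c *: f)) ->
  (forall f h, P f -> P h -> P (f * h)) -> (forall i, P (gen K i)) -> forall f, P f.
Proof.
move=> P1 PD PZ PM Pg f.
have Pw (m : fmonom I) : P (mkmalgU m 1).
  case: m => w; elim: w => [|i w IH].
    have -> : FMonom [::] = fmone I by rewrite -fmoneE.
    exact: P1.
  have -> : mkmalgU (FMonom (i :: w)) 1 = gen K i * (mkmalgU (FMonom w) 1 : free_alg K I).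
    rewrite /gen [RHS]fgmulUU mulr1; congr mkmalgU.
    by apply/eqP; rewrite fmP fmM fmU.
  exact: PM.
have P0 : P 0 by rewrite -(scale0r (1 : free_alg K I)); apply: PZ.
rewrite (monalgE f); elim: (X in \sum_(k <- X) _) => [|k r IH]; first by rewrite big_nil.
rewrite big_cons; apply: PD => //.
have -> : mkmalgU k f@_k = f@_k *: (mkmalgU k 1 : free_alg K I).
  by apply/malgP => k'; rewrite mcoeffZ !mcoeffU mulr_natr.
exact: PZ.
Qed.

Lemma free_alg_lift (S : algType K) (h : I -> S) : exists ev : free_alg K I -> S,
  [/\ ev 1 = 1, {morph ev : f f' / f + f'}, {morph ev : f f' / f * f'},
      forall c f, ev (c *: f) = c *: ev f & forall i, ev (gen K i) = h i].
Proof.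
pose hw (m : fmonom I) : S := \prod_(i <- m) h i.
have hwP : mmorphism hw.
  by split=> [x y|]; rewrite /hw ?fmM ?big_cat // fm1 big_nil.
pose hwM : {mmorphism fmonom I -> S} :=
  HB.pack hw (isMultiplicative.Build (fmonom I) S hw hwP).
pose ev := mmap (in_alg S) hwM.
have comm (g : {malg K[fmonom I]}) m m' : GRing.comm (in_alg S g@_m) (hwM m').
  by rewrite /GRing.comm /= mulr_algl mulr_algr.
have [evM ev1] := commr_mmap_is_multiplicative comm.
exists ev; split=> //.
- exact: mmapD.
- by move=> c f; rewrite /ev mmapZ /= mulr_algl.
- by move=> i; rewrite /ev mmapU /= scale1r mul1r /hw fmU big_seq1.
Qed.

End FreeAlgebra.

Section MatrixData.
Variables (K : fieldType) (Q : quiver) (alpha : vertex Q -> nat).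

Definition matrix_data : Type :=
  forall a : darrow Q, 'M[K]_(alpha (dhead a), alpha (dtail a)).

(* The identity when [i = j], in a form that needs no transport. *)
Definition vertex_delta (i j : vertex Q) : 'M[K]_(alpha i, alpha j) :=
  \matrix_(u, v) ((i == j) && (u == v :> nat))%:R.

Lemma vertex_delta_id i : vertex_delta i i = 1%:M.
Proof. by apply/matrixP => u v; rewrite !mxE eqxx. Qed.

Lemma vertex_delta_neq i j : i != j -> vertex_delta i j = 0.
Proof. by move=> /negPf n; apply/matrixP => u v; rewrite !mxE n. Qed.

(** The match is there for the types: [dtail (star a)] reduces to [dhead a] only when [a] is a
    constructor. *)
Definition loc_block (x : matrix_data) (a : darrow Q) : 'M[K]_(alpha (dhead a)) :=
  match a return 'M[K]_(alpha (dhead a)) with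
  | inl b => 1%:M + x (inl b) *m x (inr b)
  | inr b => 1%:M + x (inr b) *m x (inl b)
  end.

Definition factor_block (x : matrix_data) (a : darrow Q) : 'M[K]_(alpha (dhead a)) :=
  match a with inl _ => loc_block x a | inr _ => invmx (loc_block x a) end.

(** The blocks of the endomorphism of the total space that is [m] at the head of [a] and the
    identity at all other vertices; this is how [1 + a a^*] acts. *)
Definition extend_block (a : darrow Q) (m : 'M[K]_(alpha (dhead a))) i j :
    'M[K]_(alpha i, alpha j) :=
  vertex_delta i j + vertex_delta i (dhead a) *m (m - 1%:M) *m vertex_delta (dhead a) j.

Lemma extend_block_head a m : extend_block m (dhead a) (dhead a) = m.
Proof. by rewrite /extend_block !vertex_delta_id mul1mx mulmx1 addrC subrK. Qed.

Lemma extend_block_out a (m : 'M[K]_(alpha (dhead a))) i : i != dhead a ->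
  extend_block m i i = 1%:M.
Proof.
by move=> n; rewrite /extend_block vertex_delta_id (vertex_delta_neq n) !mul0mx addr0.
Qed.

Lemma extend_block_offdiag a (m : 'M[K]_(alpha (dhead a))) i j : i != j ->
  extend_block m i j = 0.
Proof.
move=> n; rewrite /extend_block (vertex_delta_neq n) add0r.
have [E|n'] := eqVneq i (dhead a).
  have n' : dhead a != j by rewrite -E.
  by rewrite (vertex_delta_neq n') mulmx0.
by rewrite (vertex_delta_neq n') !mul0mx.
Qed.

Lemma extend_blockM a (m m' : 'M[K]_(alpha (dhead a))) i j :
  \sum_l extend_block m i l *m extend_block m' l j = extend_block (m *m m') i j.
Proof.
have [<-{j}|n] := eqVneq i j; last first.
  rewrite extend_block_offdiag // big1 // => l _.
  have [->|nl] := eqVneq l i; first by rewrite (extend_block_offdiag _ n) mulmx0.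
  by rewrite extend_block_offdiag ?mul0mx // eq_sym.
rewrite (bigD1 i) //= big1 ?addr0 => [|l nl]; last first.
  by rewrite extend_block_offdiag ?mul0mx // eq_sym.
have [->|n] := eqVneq i (dhead a); first by rewrite !extend_block_head.
by rewrite !extend_block_out // mulmx1.
Qed.

Lemma extend_block1 a i j : @extend_block a 1%:M i j = vertex_delta i j.
Proof. by rewrite /extend_block subrr mulmx0 mul0mx addr0. Qed.

End MatrixData.

Section RepToData.
Variables (K : fieldType) (Q : quiver) (q : vertex Q -> K) (s : seq (darrow Q)).
Variable (alpha : vertex Q -> nat).
Notation rep := (mpa_rep q s alpha).
Notation data := (@matrix_data K Q alpha).

Definition rep_data (r : rep) : data := fun a => sval r (mpa_arr q s a) (dhead a) (dtail a).

Definition rep_val (r : rep) (f : free_alg K (mpa_gen Q)) i j : 'M[K]_(alpha i, alpha j) :=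
  sval r (proj (mpa_rel q s) f) i j.

Lemma rep_valD r f h i j : rep_val r (f + h) i j = rep_val r f i j + rep_val r h i j.
Proof. by rewrite /rep_val projD; case: (svalP r) => H _ _ _ _; apply: H. Qed.

Lemma rep_valZ r c f i j : rep_val r (c *: f) i j = c *: rep_val r f i j.
Proof. by rewrite /rep_val projZ; case: (svalP r) => _ H _ _ _; apply: H. Qed.

Lemma rep_valM r f h i j :
  rep_val r (f * h) i j = \sum_l rep_val r f i l *m rep_val r h l j.
Proof. by rewrite /rep_val projM; case: (svalP r) => _ _ H _ _; apply: H. Qed.

Lemma rep_valN r f i j : rep_val r (- f) i j = - rep_val r f i j.
Proof. by rewrite -scaleN1r rep_valZ scaleN1r. Qed.

Lemma rep_val_rel r f i j : mpa_rel q s f -> rep_val r f i j = 0.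
Proof.
move=> Hf; have -> : rep_val r f = rep_val r 0.
  rewrite /rep_val; congr (sval r _); apply/projP; rewrite subr0.
  by rewrite -[f]mul1r -[1 * f]mulr1; apply: ideal_genM.
by rewrite -(scale0r 1) rep_valZ scale0r.
Qed.

Lemma rep_val_eq r f h i j : mpa_rel q s (f - h) -> rep_val r f i j = rep_val r h i j.
Proof.
by move=> /(rep_val_rel r i j); rewrite rep_valD rep_valN => /eqP; rewrite subr_eq0 => /eqP.
Qed.

Lemma rep_val_e r l i j : rep_val r (free_e K l) i j =
  vertex_delta K alpha i l *m vertex_delta K alpha l j.
Proof.
have [_ _ _ H1 H0] := svalP r.
have [->|n] := eqVneq i l; last first.
  by rewrite (vertex_delta_neq K alpha n) mul0mx; apply: H0; rewrite n.
have [->|n] := eqVneq j l; first by rewrite vertex_delta_id mulmx1; apply: H1.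
by rewrite (vertex_delta_neq K alpha (_ : l != j)) 1?eq_sym // mulmx0; apply: H0; rewrite n orbT.
Qed.

Lemma rep_val_sum r (I : Type) (t : seq I) F i j :
  rep_val r (\sum_(k <- t) F k) i j = \sum_(k <- t) rep_val r (F k) i j.
Proof.
elim: t => [|k t IH]; last by rewrite !big_cons rep_valD IH.
by rewrite !big_nil -(scale0r 1) rep_valZ scale0r.
Qed.

Lemma sum_delta i j : \sum_l (vertex_delta K alpha i l *m vertex_delta K alpha l j) = vertex_delta K alpha i j.
Proof.
rewrite (bigD1 i) //= big1 ?addr0 ?vertex_delta_id ?mul1mx // => l n.
by rewrite vertex_delta_neq ?mul0mx // eq_sym.
Qed.

Lemma rep_val1 r i j : rep_val r 1 i j = vertex_delta K alpha i j.
Proof.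
rewrite -(rep_val_eq r i j (rel_one q s)) rep_val_sum -sum_delta.
by apply: eq_bigr => l _; rewrite rep_val_e.
Qed.

Lemma rep_val_arr r a i j : rep_val r (free_arr K a) i j =
  vertex_delta K alpha i (dhead a) *m rep_data r a *m vertex_delta K alpha (dtail a) j.
Proof.
have -> : rep_data r a = rep_val r (free_arr K a) (dhead a) (dtail a) by [].
have [->|n] := eqVneq i (dhead a); last first.
  rewrite -(rep_val_eq r i j (rel_head q s a)) rep_valM.
  rewrite (vertex_delta_neq K alpha n) !mul0mx big1 // => l _.
  by rewrite rep_val_e (vertex_delta_neq K alpha n) !mul0mx.
have [->|n] := eqVneq j (dtail a); first by rewrite !vertex_delta_id mul1mx mulmx1.
rewrite -(rep_val_eq r _ j (rel_tail q s a)) rep_valM.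
rewrite (vertex_delta_neq K alpha (_ : dtail a != j)) 1?eq_sym // mulmx0 big1 // => l _.
by rewrite rep_val_e (vertex_delta_neq K alpha (_ : dtail a != j)) 1?eq_sym // !mulmx0.
Qed.

Lemma rep_val_loc r a i j :
  rep_val r (free_loc K a) i j = extend_block (loc_block (rep_data r) a) i j.
Proof.
rewrite /free_loc rep_valD rep_val1 rep_valM /extend_block; congr (_ + _).
rewrite (bigD1 (dtail a)) //= big1 ?addr0 => [|l n]; last first.
  rewrite rep_val_arr (vertex_delta_neq K alpha (_ : dtail a != l)) 1?eq_sym //.
  by rewrite mulmx0 mul0mx.
rewrite !rep_val_arr.
by case: a => b /=; rewrite !vertex_delta_id mulmx1 mul1mx addrAC subrr add0r !mulmxA.
Qed.

Lemma rep_loc_unit r a : loc_block (rep_data r) a \in unitmx /\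
  forall i j, rep_val r (free_inv K a) i j = extend_block (invmx (loc_block (rep_data r) a)) i j.
Proof.
set D := loc_block _ a; pose Y i j := rep_val r (free_inv K a) i j.
have DY i j : extend_block D i i *m Y i j = vertex_delta K alpha i j.
  have := rep_val_eq r i j (rel_inv_r q s a); rewrite rep_val1 rep_valM => <-.
  rewrite (bigD1 i) //= big1 ?addr0 => [|l n]; first by rewrite rep_val_loc.
  by rewrite rep_val_loc extend_block_offdiag ?mul0mx // eq_sym.
have uD : D \in unitmx.
  have := DY (dhead a) (dhead a); rewrite extend_block_head vertex_delta_id.
  by move=> /mulmx1_unit [].
split=> // i j; rewrite -/(Y i j).
have -> : Y i j = extend_block (invmx D) i i *m (extend_block D i i *m Y i j).
  rewrite mulmxA; have [->|n] := eqVneq i (dhead a).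
    by rewrite !extend_block_head mulVmx // mul1mx.
  by rewrite !extend_block_out // !mul1mx.
rewrite DY; have [<-|n] := eqVneq i j; first by rewrite vertex_delta_id mulmx1.
by rewrite vertex_delta_neq // mulmx0 extend_block_offdiag.
Qed.

Lemma rep_val_factor r a i j :
  rep_val r (free_factor K a) i j = extend_block (factor_block (rep_data r) a) i j.
Proof.
by case: a => b; [exact: rep_val_loc|case: (rep_loc_unit r (inr b)) => _ ->].
Qed.

(** The equations of representations in terms of arrows alone. All factors are block diagonal, so
    the relation splits into one equation per vertex; [data_valid_rep] gives the converse of
    [rep_data_valid]. *)
Definition data_valid (x : data) : Prop :=
  (forall a, loc_block x a \in unitmx) /\
  forall i, \prod_(a <- s) extend_block (factor_block x a) i i = (q i)%:M.

Lemma rep_data_valid r : data_valid (rep_data r).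
Proof.
split=> [a|i]; first by case: (rep_loc_unit r a).
have -> : (q i)%:M = rep_val r (\sum_l q l *: free_e K l) i i.
  rewrite rep_val_sum (bigD1 i) // [X in _ = _ + X]big1.
    by rewrite addr0 rep_valZ rep_val_e vertex_delta_id mulmx1 scalemx1.
  by move=> l n; rewrite rep_valZ rep_val_e vertex_delta_neq ?mul0mx ?scaler0 // eq_sym.
rewrite -(rep_val_eq r i i (rel_mpa q s)).
suff [H _] : (forall i, \prod_(a <- s) extend_block (factor_block (rep_data r) a) i i =
      rep_val r (\prod_(a <- s) free_factor K a) i i) /\
   forall i j, i != j -> rep_val r (\prod_(a <- s) free_factor K a) i j = 0 by [].
elim: s => [|a t [IH1 IH2]].
  split=> [k|k j n]; rewrite big_nil ?big_nil rep_val1; last exact: vertex_delta_neq.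
  by rewrite vertex_delta_id.
split=> [k|k j n]; rewrite !big_cons rep_valM.
  rewrite [RHS](bigD1 k) //= [X in _ = _ + X]big1 ?addr0 => [|l n]; last by rewrite IH2 ?mulmx0.
  by rewrite rep_val_factor -IH1.
apply: big1 => l _; have [->|nl] := eqVneq l k; first by rewrite IH2 ?mulmx0.
by rewrite rep_val_factor extend_block_offdiag ?mul0mx // eq_sym.
Qed.

End RepToData.

Section RegularFunctions.
Variables (K : fieldType) (Q : quiver) (q : vertex Q -> K) (s : seq (darrow Q)).
Variable (alpha : vertex Q -> nat).
Variables (T : Type) (S : (T -> K) -> Prop) (p : T -> mpa_rep q s alpha).
Hypothesis Harr : forall a u v, generated S (fun t => rep_data (p t) a u v).
Hypothesis Hinv : forall a u v,
  generated S (fun t => invmx (loc_block (rep_data (p t)) a) u v).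

(** Induction on an element of the free algebra reduces every entry to those of the arrows and of
    the adjoined inverses. *)
Lemma rep_val_generated f i j u v : generated S (fun t => rep_val (p t) f i j u v).
Proof.
have const_mul m1 m2 m3 m4 (A : 'M[K]_(m1, m2)) (B : 'M_(m3, m4)) (M : T -> 'M_(m2, m3)) :
    (forall u v, generated S (fun t => M t u v)) ->
    forall u v, generated S (fun t => (A *m M t *m B) u v).
  move=> HM; apply: generated_mulmx => [|u' v']; last exact: gen_const.
  by apply: generated_mulmx => // u' v'; apply: gen_const.
elim/free_alg_ind: f i j u v => [|f h IHf IHh|c f IHf|f h IHf IHh|[[l|a]|a]] i j u v.
- have -> : (fun t => rep_val (p t) 1 i j u v) = fun=> vertex_delta K alpha i j u v.
    by apply/funext => t; rewrite rep_val1.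
  exact: gen_const.
- have -> : (fun t => rep_val (p t) (f + h) i j u v) =
      fun t => rep_val (p t) f i j u v + rep_val (p t) h i j u v.
    by apply/funext => t; rewrite rep_valD mxE.
  exact: gen_add.
- have -> : (fun t => rep_val (p t) (c *: f) i j u v) = fun t => c * rep_val (p t) f i j u v.
    by apply/funext => t; rewrite rep_valZ mxE.
  by apply: gen_mul => //; apply: gen_const.
- have -> : (fun t => rep_val (p t) (f * h) i j u v) =
      fun t => \sum_l (rep_val (p t) f i l *m rep_val (p t) h l j) u v.
    by apply/funext => t; rewrite rep_valM summxE.
  by apply: generated_sum => l _; apply: generated_mulmx.
- have -> : (fun t => rep_val (p t) (gen K (inl (inl l) : mpa_gen Q)) i j u v) =
      fun=> (vertex_delta K alpha i l *m vertex_delta K alpha l j) u v.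
    by apply/funext => t; rewrite -(rep_val_e (p t)).
  exact: gen_const.
- have -> : (fun t => rep_val (p t) (gen K (inl (inr a) : mpa_gen Q)) i j u v) =
      fun t => (vertex_delta K alpha i (dhead a) *m rep_data (p t) a *m
         vertex_delta K alpha (dtail a) j) u v.
    by apply/funext => t; rewrite -(rep_val_arr (p t)).
  exact: const_mul.
have -> : (fun t => rep_val (p t) (gen K (inr a : mpa_gen Q)) i j u v) =
    fun t => extend_block (invmx (loc_block (rep_data (p t)) a)) i j u v.
  by apply/funext => t; case: (rep_loc_unit (p t) a) => _ <-.
have -> : (fun t => extend_block (invmx (loc_block (rep_data (p t)) a)) i j u v) =
   fun t => vertex_delta K alpha i j u v + (vertex_delta K alpha i (dhead a) *m
     (invmx (loc_block (rep_data (p t)) a) - 1%:M) *m vertex_delta K alpha (dhead a) j) u v.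
  by apply/funext => t; rewrite /extend_block mxE.
apply: gen_add; first exact: gen_const.
apply: const_mul => u' v'.
have -> : (fun t => (invmx (loc_block (rep_data (p t)) a) - 1%:M) u' v') =
   fun t => invmx (loc_block (rep_data (p t)) a) u' v' + - (1%:M : 'M[K]__) u' v'.
  by apply/funext => t; rewrite !mxE.
by apply: gen_add => //; apply: gen_const.
Qed.

Lemma mpa_rep_generated f : regular (v := mpa_rep q s alpha) f -> generated S (f \o p).
Proof.
apply: generated_comp => h [x [i [j [u [v /funext ->]]]]].
by have := rep_val_generated (repr x) u v; rewrite /rep_val proj_repr.
Qed.

End RegularFunctions.

Section DataToRep.
Variables (K : fieldType) (Q : quiver) (q : vertex Q -> K) (s : seq (darrow Q)).
Variable (alpha : vertex Q -> nat) (v0 : vertex Q).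
Hypothesis alpha0 : (0 < alpha v0)%N.
Notation data := (@matrix_data K Q alpha).

Definition total_index : finType := {i : vertex Q & 'I_(alpha i)}.

(** The algebra structure on square matrices asks for a size in successor form; the vertex [v0]
    makes the total space nonzero. *)
Lemma total_card : #|total_index| = #|total_index|.-1.+1.
Proof.
rewrite prednK //; apply/card_gt0P.
by exists (existT (fun i => 'I_(alpha i)) v0 (Ordinal alpha0)).
Qed.

Definition total_rank (x : total_index) : 'I_(#|total_index|.-1.+1) :=
  cast_ord total_card (enum_rank x).

Lemma total_rank_bij : bijective total_rank.
Proof.
exists (fun c => enum_val (cast_ord (esym total_card) c)).
  by move=> x; rewrite /total_rank cast_ordK enum_rankK.
by move=> c; rewrite /total_rank enum_valK cast_ordKV.
Qed.

Definition block_row (i : vertex Q) : 'M[K]_(alpha i, #|total_index|.-1.+1) :=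
  \matrix_(u, c) (c == total_rank (existT (fun i => 'I_(alpha i)) i u))%:R.
Definition block_col (i : vertex Q) : 'M[K]_(#|total_index|.-1.+1, alpha i) :=
  (block_row i)^T.

Lemma block_row_col i j : block_row i *m block_col j = vertex_delta K alpha i j.
Proof.
apply/matrixP => u v; rewrite !mxE.
rewrite (bigD1 (total_rank (existT _ i u))) //= !mxE eqxx mul1r.
rewrite big1 ?addr0 => [|c /negPf n]; last by rewrite !mxE n mul0r.
rewrite (bij_eq total_rank_bij); congr (_%:R).
have [ij|n] := eqVneq i j; last first.
  have /negPf -> // : existT (fun i => 'I_(alpha i)) i u != existT _ j v.
  by apply/eqP => /(congr1 tag) /= E; rewrite E eqxx in n.
by subst j; rewrite eq_Tagged.
Qed.

Lemma block_sum : \sum_i block_col i *m block_row i = 1%:M :> 'M_(#|total_index|.-1.+1).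
Proof.
apply/matrixP => c d; rewrite summxE !mxE.
have [g gK Kg] := total_rank_bij; rewrite -[c]Kg -[d]Kg.
case: (g c) => i u; case: (g d) => j v.
rewrite (bigD1 i) //= big1 ?addr0 => [|l n]; last first.
  rewrite mxE big1 // => w _; rewrite !mxE (bij_eq total_rank_bij).
  have /negPf -> : existT (fun i => 'I_(alpha i)) i u != existT _ l w.
    by apply/eqP => /(congr1 tag) /= E; rewrite E eqxx in n.
  by rewrite mul0r.
rewrite mxE (bigD1 u) //= !mxE eqxx mul1r big1 ?addr0 => [|w n]; last first.
  by rewrite !mxE (bij_eq total_rank_bij) eq_Tagged /= eq_sym (negPf n) mul0r.
by rewrite !(bij_eq total_rank_bij) eq_sym.
Qed.

Notation total := 'M[K]_(#|total_index|.-1.+1).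

Lemma block_row_ext (X Y : total) :
  (forall i, block_row i *m X = block_row i *m Y) -> X = Y.
Proof.
move=> H; rewrite -[X]mul1mx -[Y]mul1mx -block_sum !mulmx_suml.
by apply: eq_bigr => i _; rewrite -!mulmxA H.
Qed.

Definition total_block a (m : 'M[K]_(alpha (dhead a))) : total :=
  1%:M + block_col (dhead a) *m (m - 1%:M) *m block_row (dhead a).

Lemma block_rowK i : block_row i *m block_col i = 1%:M.
Proof. by rewrite block_row_col vertex_delta_id. Qed.

Lemma total_block1 a : @total_block a 1%:M = 1%:M.
Proof. by rewrite /total_block subrr mulmx0 mul0mx addr0. Qed.

Lemma total_blockM a (m m' : 'M[K]_(alpha (dhead a))) :
  total_block m *m total_block m' = total_block (m *m m').
Proof.
rewrite /total_block mulmxDl mul1mx mulmxDr mulmx1 -addrA; congr (_ + _).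
set C := block_col _; set R := block_row _.
have -> : C *m (m - 1%:M) *m R *m (C *m (m' - 1%:M) *m R) =
    C *m ((m - 1%:M) *m (m' - 1%:M)) *m R.
  by rewrite !mulmxA -(mulmxA _ R C) block_rowK mulmx1.
rewrite -!mulmxDl -!mulmxDr; congr (_ *m _ *m _).
rewrite [X in _ + (_ + X)]mulmxBl mul1mx addrCA (addrC (m' - 1%:M)) subrK.
by rewrite mulmxBr mulmx1 addrC addrA subrK.
Qed.

Lemma block_row_total a (m : 'M[K]_(alpha (dhead a))) i :
  block_row i *m total_block m = extend_block m i i *m block_row i.
Proof.
rewrite /total_block mulmxDr mulmx1 !mulmxA block_row_col.
have [->|n] := eqVneq i (dhead a).
  rewrite extend_block_head vertex_delta_id mul1mx mulmxBl mul1mx.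
  by rewrite addrC subrK.
by rewrite (vertex_delta_neq _ _ n) !mul0mx addr0 extend_block_out // mul1mx.
Qed.

(** The free algebra is mapped to the endomorphisms of the total space. The relators go to 0, hence
    so does the ideal, and the blocks of the images do not depend on the representative chosen by
    [repr]. *)
Lemma data_valid_rep (x : data) : data_valid q s x ->
  exists r : mpa_rep q s alpha, rep_data r = x.
Proof.
move=> [ux Hx].
pose E l : total := block_col l *m block_row l.
pose X a : total := block_col (dhead a) *m x a *m block_row (dtail a).
pose Y a : total := total_block (invmx (loc_block x a)).
have [ev [ev1 evD evM evZ evg]] := @free_alg_lift K (mpa_gen Q) total
  (fun g => match g with inl (inl l) => E l | inl (inr a) => X a | inr a => Y a end).
have evE l : ev (free_e K l) = E l by rewrite evg.
have evX a : ev (free_arr K a) = X a by rewrite evg.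
have evY a : ev (free_inv K a) = Y a by rewrite evg.
have ev0 : ev 0 = 0 by rewrite -(scale0r 1) evZ scale0r.
have evN f : ev (- f) = - ev f by rewrite -scaleN1r evZ scaleN1r.
have evB f h : ev f = ev h -> ev (f - h) = 0 by move=> Efh; rewrite evD evN Efh subrr.
have evsum (I : Type) (t : seq I) F : ev (\sum_(k <- t) F k) = \sum_(k <- t) ev (F k).
  by elim: t => [|k t IH]; rewrite ?big_nil // !big_cons evD IH.
have evL a : ev (free_loc K a) = total_block (loc_block x a).
  rewrite /free_loc evD ev1 evM !evX /X /total_block; congr (_ + _).
  rewrite -[LHS]/(_ *m _); case: a => b /=; rewrite addrAC subrr add0r.
    by rewrite !mulmxA -(mulmxA _ (block_row _) (block_col _)) block_rowK mulmx1.
  by rewrite !mulmxA -(mulmxA _ (block_row _) (block_col _)) block_rowK mulmx1.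
have evF a : ev (free_factor K a) = total_block (factor_block x a).
  by case: a => b; rewrite /= ?evL ?evY.
have ev_rel f : mpa_rel q s f -> ev f = 0.
  case=> [i|i j n||a|a|a|a|].
  - apply: evB; rewrite evM evE -[LHS]/(_ *m _) /E mulmxA -(mulmxA _ (block_row i)).
    by rewrite block_rowK mulmx1.
  - rewrite evM !evE -[LHS]/(_ *m _) /E mulmxA -(mulmxA _ (block_row i)).
    by rewrite block_row_col vertex_delta_neq // mulmx0 mul0mx.
  - apply: evB; rewrite ev1 evsum; transitivity (1%:M : total) => //.
    by rewrite -block_sum; apply: eq_bigr => l _; rewrite evE.
  - apply: evB; rewrite evM evE evX -[LHS]/(_ *m _) /E /X !mulmxA.
    by rewrite -(mulmxA _ (block_row _) (block_col _)) block_rowK mulmx1.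
  - apply: evB; rewrite evM evE evX -[LHS]/(_ *m _) /E /X !mulmxA.
    by rewrite -(mulmxA _ (block_row _) (block_col _)) block_rowK mulmx1.
  - by apply: evB; rewrite evM evL evY -[LHS]/(_ *m _) total_blockM mulmxV // total_block1 ev1.
  - by apply: evB; rewrite evM evL evY -[LHS]/(_ *m _) total_blockM mulVmx // total_block1 ev1.
  apply: evB; apply: block_row_ext => i.
  have -> : block_row i *m ev (\prod_(a <- s) free_factor K a) =
      (\prod_(a <- s) extend_block (factor_block x a) i i) *m block_row i.
    elim: (s) => [|a t IH]; first by rewrite !big_nil ev1 mulmx1 mul1mx.
    rewrite !big_cons evM evF -[X in _ *m X]/(_ *m _) mulmxA block_row_total.
    by rewrite -mulmxA IH mulmxA.
  rewrite Hx evsum mulmx_sumr (bigD1 i) //= big1 ?addr0 => [|l n]; last first.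
    by rewrite evZ evE -scalemxAr mulmxA block_row_col vertex_delta_neq ?mul0mx ?scaler0 // eq_sym.
  by rewrite evZ evE -scalemxAr mulmxA block_rowK mul1mx mul_scalar_mx.
have ev_ideal f : ideal_gen (mpa_rel q s) f -> ev f = 0.
  elim=> [//|f1 f2 _ E1 _ E2|u h v Hf]; first by rewrite evD E1 E2 addr0.
  by rewrite !evM (ev_rel _ Hf) mulr0 mul0r.
pose rho (y : mpa q s) i j := block_row i *m ev (repr y) *m block_col j.
have rho_proj f i j : rho (proj (mpa_rel q s) f) i j = block_row i *m ev f *m block_col j.
  congr (_ *m _ *m _); apply/eqP; rewrite -subr_eq0 -evN -evD; apply/eqP.
  exact/ev_ideal/repr_proj.
have rhoP : is_rep rho.
  split=> [y z i j|c y i j|y z i j|l|l i j n].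
  - rewrite -[y]proj_repr -[z]proj_repr -projD !rho_proj.
    by rewrite evD mulmxDr mulmxDl.
  - rewrite -[y]proj_repr -[c *: _]projZ !rho_proj.
    by rewrite evZ -scalemxAr -scalemxAl.
  - rewrite -[y]proj_repr -[z]proj_repr -[_ * _]projM !rho_proj evM -[ev _ * _]/(_ *m _).
    rewrite -[X in X *m ev (repr z)]mulmx1 -block_sum mulmx_sumr mulmx_suml mulmx_sumr mulmx_suml.
    by apply: eq_bigr => l _; rewrite !rho_proj !mulmxA.
  - by rewrite rho_proj evE /E mulmxA -mulmxA !block_rowK mulmx1.
  rewrite rho_proj evE /E mulmxA -mulmxA !block_row_col.
  case/orP: n => n; first by rewrite vertex_delta_neq ?mul0mx.
  by rewrite (vertex_delta_neq _ _ (_ : l != j)) ?mulmx0 // eq_sym.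
exists (exist _ rho rhoP); apply: functional_extensionality_dep => a.
rewrite /rep_data /= rho_proj evX /X !mulmxA block_rowK mul1mx.
by rewrite -mulmxA block_rowK mulmx1.
Qed.

End DataToRep.

(** * Isomorphisms of affine quotients *)

Section QuotientIsomorphism.
Variables (K : fieldType) (X Y : variety K).
Variables (orbX : X -> X -> Prop) (orbY : Y -> Y -> Prop) (p : Y -> X).
Hypothesis p_regular : forall f, regular (v := X) f -> regular (v := Y) (f \o p).
Hypothesis p_orbit : forall y y', orbY y y' -> orbX (p y) (p y').
Hypothesis p_surj : forall x, exists y, p y = x.
Hypothesis p_lift : forall y x', orbX (p y) x' -> exists2 y', orbY y y' & p y' = x'.
Hypothesis p_invariant : forall h, regular (v := Y) h ->
  (forall y y', orbY y y' -> h y = h y') -> exists2 f, regular (v := X) f & h =1 f \o p.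

Lemma sig_eq (T : Type) (P : T -> Prop) (u v : {x | P x}) : sval u = sval v -> u = v.
Proof.
case: u v => [x Px] [y Py] /= E; subst y; congr exist; exact: Prop_irrelevance.
Qed.

Lemma pullback_subproof (f : invariant_fun orbX) : regular (v := Y) (sval f \o p) /\
  forall y y', orbY y y' -> (sval f \o p) y = (sval f \o p) y'.
Proof.
case: f => f [Rf If] /=; split; first exact: p_regular.
by move=> y y' /p_orbit /If.
Qed.

Definition pullback (f : invariant_fun orbX) : invariant_fun orbY := exist _ _ (pullback_subproof f).

Lemma descent_subproof (h : invariant_fun orbY) : exists f : invariant_fun orbX, pullback f = h.
Proof.
case: h => h [Rh Ih]; have [f Rf Ef] := p_invariant Rh Ih.
have If x x' : orbX x x' -> f x = f x'.
  have [y <-] := p_surj x => /p_lift [y' yy' <-].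
  by rewrite -[LHS]/((f \o p) y) -Ef (Ih _ _ yy') Ef.
exists (exist _ f (conj Rf If)); apply: sig_eq; apply/funext => y /=.
by rewrite Ef.
Qed.

Definition descent (h : invariant_fun orbY) : invariant_fun orbX :=
  sval (cid (descent_subproof h)).

Lemma descentK : cancel descent pullback.
Proof. by move=> h; rewrite /descent; case: cid. Qed.

Lemma pullback_inj : injective pullback.
Proof.
move=> f f' E; apply: sig_eq; apply/funext => x; have [y <-] := p_surj x.
by have := congr1 (fun h => sval h y) E.
Qed.

Lemma pullbackK : cancel pullback descent.
Proof. by move=> f; apply: pullback_inj; rewrite descentK. Qed.

Lemma descentE h y : sval (descent h) (p y) = sval h y.
Proof. by rewrite -[in RHS](descentK h). Qed.

Lemma character_descent chi : is_character chi -> is_character (chi \o descent).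
Proof.
case=> Hc Hd Hm; split=> [c f Ef|f h t E|f h t E] /=.
- by apply: Hc => x; have [y <-] := p_surj x; rewrite descentE Ef.
- by apply: Hd => x; have [y <-] := p_surj x; rewrite !descentE E.
- by apply: Hm => x; have [y <-] := p_surj x; rewrite !descentE E.
Qed.

Lemma character_pullback chi : is_character chi -> is_character (chi \o pullback).
Proof.
case=> Hc Hd Hm; split=> [c f Ef|f h t E|f h t E] /=.
- by apply: Hc => y /=; rewrite Ef.
- by apply: Hd => y /=; rewrite E.
- by apply: Hm => y /=; rewrite E.
Qed.

(** Pullback along [p] is a bijection between the invariant functions: surjectivity of [p] makes it
    injective, [p_invariant] makes it surjective, and [p_lift] ensures that a descended function is
    constant on orbits. Characters are then transported by composition. *)
Lemma git_quotient_isomorphic : isomorphic (git_quotient orbX) (git_quotient orbY).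
Proof.
exists (fun chi => exist _ _ (character_descent (svalP chi))).
exists (fun chi => exist _ _ (character_pullback (svalP chi))); split.
- by move=> chi; apply: sig_eq; apply/funext => f /=; rewrite pullbackK.
- by move=> chi; apply: sig_eq; apply/funext => f /=; rewrite descentK.
- by move=> u [f Ef]; exists (descent f) => chi; rewrite /= Ef.
- by move=> u [f Ef]; exists (pullback f) => chi; rewrite /= Ef.
Qed.

End QuotientIsomorphism.

(** * Crab-shaped quivers *)

Section ExtendBlockMore.
Variables (K : fieldType) (Q : quiver) (alpha : vertex Q -> nat).

Lemma extend_blockMd a (m m' : 'M[K]_(alpha (dhead a))) i :
  extend_block m i i *m extend_block m' i i = extend_block (m *m m') i i.
Proof.
rewrite -extend_blockM (bigD1 i) //= big1 ?addr0 // => l n.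
by rewrite extend_block_offdiag ?mul0mx // eq_sym.
Qed.

Lemma extend_block_unit a (m : 'M[K]_(alpha (dhead a))) i : m \in unitmx ->
  extend_block m i i \in unitmx /\ extend_block (invmx m) i i = invmx (extend_block m i i).
Proof.
move=> um; have E : extend_block m i i *m extend_block (invmx m) i i = 1%:M.
  by rewrite extend_blockMd mulmxV // extend_block1 vertex_delta_id.
have [u _] := mulmx1_unit E; split=> //.
by rewrite -[LHS]mul1mx -(mulVmx u) -mulmxA E mulmx1.
Qed.

Lemma vertex_deltaK i j : i = j ->
  vertex_delta K alpha i j *m vertex_delta K alpha j i = 1%:M.
Proof. by move=> ->; rewrite vertex_delta_id mulmx1. Qed.

Lemma extend_block_eq a (m : 'M[K]_(alpha (dhead a))) i : i = dhead a ->
  extend_block m i i = vertex_delta K alpha i (dhead a) *m m *m vertex_delta K alpha (dhead a) i.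
Proof.
move=> E; rewrite /extend_block mulmxBr mulmxBl mulmx1 vertex_deltaK //.
by rewrite vertex_delta_id addrC subrK.
Qed.

End ExtendBlockMore.

Lemma prod_single (R : pzRingType) (I : eqType) (s : seq I) (F : I -> R) a :
  uniq s -> a \in s -> (forall b, b != a -> F b = 1) -> \prod_(b <- s) F b = F a.
Proof.
move=> us /splitPr E; case: E us => s1 s2.
rewrite (perm_uniq (_ : perm_eq _ (a :: s1 ++ s2))); last first.
  by apply/permP => x; rewrite /= !count_cat /=; lia.
rewrite /= mem_cat negb_or => /andP[/andP[n1 n2] _] F1.
rewrite big_cat big_cons /= !big1_seq ?mul1r ?mulr1 // => b /andP[_ bs]; apply: F1.
  by apply: contraNneq n2 => <-.
by apply: contraNneq n1 => <-.
Qed.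

Lemma prod_pair (R : pzRingType) (I : eqType) (s : seq I) (F : I -> R) a a' :
  uniq s -> a \in s -> a' \in s -> a != a' -> (forall b, b != a -> b != a' -> F b = 1) ->
  \prod_(b <- s) F b = F a * F a' \/ \prod_(b <- s) F b = F a' * F a.
Proof.
move=> us as_ as' n F1.
have one t : a \notin t -> a' \notin t -> \prod_(b <- t) F b = 1.
  move=> n1 n2; rewrite big1_seq // => b /andP[_ bt]; apply: F1.
    by apply: contraNneq n1 => <-.
  by apply: contraNneq n2 => <-.
have [P [U [V [E|E]]]] := split_two as_ as' n; [left|right]; move: us; rewrite E.
  rewrite (perm_uniq (_ : perm_eq _ (a :: a' :: P ++ U ++ V))); last first.
    by apply/permP => x; rewrite !count_cat /= !count_cat /=; lia.
  rewrite /= inE !mem_cat !negb_or => /and3P[/and4P[_ p1 p2 p3] /and3P[q1 q2 q3] _].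
  by rewrite big_cat big_cons big_cat big_cons /= !one // !mul1r mulr1.
rewrite (perm_uniq (_ : perm_eq _ (a :: a' :: P ++ U ++ V))); last first.
  by apply/permP => x; rewrite !count_cat /= !count_cat /=; lia.
rewrite /= inE !mem_cat !negb_or => /and3P[/and4P[_ p1 p2 p3] /and3P[q1 q2 q3] _].
by rewrite big_cat big_cons big_cat big_cons /= !one // !mul1r mulr1.
Qed.

Section CrabLegs.
Variables (K : fieldType) (g k n : nat) (A : 'I_k -> GL K n.+1) (xi : 'I_k -> nat -> K).
Notation w := (minpoly_degree A).
Notation Q := (crab g w).
Notation alpha := (crab_dim g A xi).
Notation delta := (vertex_delta K alpha).
Notation legv i j := (existT (fun i => 'I_(w i).-1) i j : leg_vertex w).

(* The [j]-th vertex of the [i]-th leg counted from the centre [j = 0], which is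
   also the junk value out of range. *)
Definition leg_vtx (i : 'I_k) (j : nat) : vertex Q :=
  if j is j'.+1 then omap (existT (fun i => 'I_(w i).-1) i) (insub j') else None.

Lemma leg_vtxS i (j : 'I_(w i).-1) : leg_vtx i j.+1 = Some (legv i j).
Proof. by rewrite /= valK. Qed.

Lemma leg_vtx_eq i i' (j : 'I_(w i).-1) (j' : 'I_(w i').-1) :
  Some (legv i j) = leg_vtx i' j' ->
  exists2 l : 'I_(w i).-1, legv i' j' = legv i l & val l = j.+1.
Proof.
case Ej: (val j') => [|l] //.
have ll : (l < (w i').-1)%N by have := ltn_ord j'; rewrite -[nat_of_ord j']/(val j') Ej => /ltnW.
rewrite -[l]/(val (Ordinal ll)) leg_vtxS => -[Ei]; move: j' Ej ll.
case: _ / Ei => j' Ej ll E.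
have El := congr1 (fun p : leg_vertex w => nat_of_ord (tagged p)) E.
by exists j' => //; rewrite Ej; move: El => /= ->.
Qed.

(** The arrow that starts at [p] and points towards the centre; [leg_out p] is its reverse. *)
Definition leg_in (p : leg_vertex w) : darrow Q := inl (inr p).
Definition leg_out (p : leg_vertex w) : darrow Q := inr (inr p).

Variable x : @matrix_data K Q alpha.

(** Indexed by natural numbers to match [leg_rep]; the [delta] factors are transports. The value 0
    beyond the leg gives the relation at the last vertex the same shape as the others. *)
Definition leg_phi i j : 'M[K]_(alpha (leg_vtx i j), alpha (leg_vtx i j.+1)) :=
  match insub j : option 'I_(w i).-1 with
  | Some jo => delta (leg_vtx i j) (leg_vtx i jo) *m x (leg_in (legv i jo)) *m
      delta (Some (legv i jo)) (leg_vtx i j.+1)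
  | None => 0
  end.

Definition leg_psi i j : 'M[K]_(alpha (leg_vtx i j.+1), alpha (leg_vtx i j)) :=
  match insub j : option 'I_(w i).-1 with
  | Some jo => delta (leg_vtx i j.+1) (Some (legv i jo)) *m x (leg_out (legv i jo)) *m
      delta (leg_vtx i jo) (leg_vtx i j)
  | None => 0
  end.

Lemma leg_phiE i (j : 'I_(w i).-1) : leg_phi i j =
  x (leg_in (legv i j)) *m delta (Some (legv i j)) (leg_vtx i j.+1).
Proof. by rewrite /leg_phi valK vertex_delta_id mul1mx. Qed.

Lemma leg_psiE i (j : 'I_(w i).-1) : leg_psi i j =
  delta (leg_vtx i j.+1) (Some (legv i j)) *m x (leg_out (legv i j)).
Proof. by rewrite /leg_psi valK vertex_delta_id mulmx1. Qed.

Lemma leg_phi_out i j : ((w i).-1 <= j)%N -> leg_phi i j = 0.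
Proof. by move=> H; rewrite /leg_phi insubN // -leqNgt. Qed.

Lemma leg_phi_psi i (j : 'I_(w i).-1) :
  loc_block x (leg_in (legv i j)) = 1%:M + leg_phi i j *m leg_psi i j.
Proof.
rewrite leg_phiE leg_psiE; set X := x _; set D := delta _ _; set D' := delta _ _; set Y := x _.
have -> : X *m D *m (D' *m Y) = X *m (D *m D') *m Y by rewrite !mulmxA.
by rewrite vertex_deltaK ?leg_vtxS // mulmx1.
Qed.

Lemma leg_psi_phi i (j : 'I_(w i).-1) :
  extend_block (loc_block x (leg_out (legv i j))) (leg_vtx i j.+1) (leg_vtx i j.+1) =
  1%:M + leg_psi i j *m leg_phi i j.
Proof.
have E := leg_vtxS j.
rewrite (@extend_block_eq _ _ _ (leg_out (legv i j)) _ (leg_vtx i j.+1) E).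
rewrite -[loc_block _ _]/(1%:M + x (leg_out (legv i j)) *m x (leg_in (legv i j))).
rewrite mulmxDr mulmx1 mulmxDl (vertex_deltaK _ _ E).
by rewrite leg_phiE leg_psiE !mulmxA.
Qed.

Variable s : seq (darrow Q).
Hypothesis ps : perm_eq s (enum (darrow Q)).
Hypothesis ux : forall a, loc_block x a \in unitmx.

(** Only two factors act nontrivially at this vertex: the inverse of [1 + psi_j phi_j] and, unless
    the leg ends here, [1 + phi_(j+1) psi_(j+1)]. Their order in [s] is immaterial because the
    product is a scalar. *)
Lemma leg_vertex_relation i (j : 'I_(w i).-1) (c : K) : c != 0 ->
  \prod_(a <- s) extend_block (factor_block x a) (leg_vtx i j.+1) (leg_vtx i j.+1) = c%:M
  <-> 1%:M + leg_phi i j.+1 *m leg_psi i j.+1 = c *: (1%:M + leg_psi i j *m leg_phi i j).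
Proof.
move=> c0; set v := leg_vtx i j.+1.
have us : uniq s by rewrite (perm_uniq ps) enum_uniq.
have mems a : a \in s by rewrite (perm_mem ps) mem_enum.
have Ev : v = Some (legv i j) by exact: leg_vtxS.
pose F a := extend_block (factor_block x a) v v.
set M := 1%:M + leg_psi i j *m leg_phi i j.
have [uM EM] : M \in unitmx /\ F (leg_out (legv i j)) = invmx M.
  by rewrite /M -leg_psi_phi /F; apply: extend_block_unit; apply: ux.
have Fout a : v != dhead a -> F a = 1 by move=> na; apply: extend_block_out.
have out_out p : leg_out p != leg_out (legv i j) -> F (leg_out p) = 1.
  by move=> np; apply: Fout; rewrite Ev eq_sym; apply: contraNneq np => -[->].
have Floop l : F (inl (inl l)) = 1 /\ F (inr (inl l)) = 1.
  by split; apply: Fout; rewrite Ev.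
have cV m : invmx m = c%:M :> 'M_(alpha v) -> m \in unitmx -> 1%:M = c *: m.
  by move=> E um; rewrite -mul_scalar_mx -E mulVmx.
have Fin p : F (leg_in p) <> 1 -> exists2 j' : 'I_(w i).-1, p = legv i j' & val j' = j.+1.
  case: p => i' j' NF; apply: leg_vtx_eq; rewrite -leg_vtxS.
  by apply: contrapT => /eqP nv; apply: NF; apply: Fout.
case: (ltnP j.+1 (w i).-1) => lt; last first.
  rewrite leg_phi_out // mul0mx addr0.
  have -> : \prod_(a <- s) F a = invmx M.
    rewrite -EM; apply: prod_single => // -[[l|p]|[l|p]] np.
    - by case: (Floop l).
    - apply: contrapT => /Fin [j' _ Ej].
      by have := ltn_ord j'; rewrite -[nat_of_ord j']/(val j') Ej ltnNge lt.
    - by case: (Floop l).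
    - exact: out_out.
  split=> [E|E]; first exact: cV.
  by rewrite -[LHS]mulmx1 E -scalemxAr mulVmx // scalemx1.
pose jo := Ordinal lt; pose p' := legv i jo.
have F' : F (leg_in p') = 1%:M + leg_phi i j.+1 *m leg_psi i j.+1.
  by rewrite -[j.+1]/(nat_of_ord jo) -leg_phi_psi; exact: (@extend_block_head K Q alpha (leg_in p') _).
set U := 1%:M + _ in F' *.
have : \prod_(a <- s) F a = invmx M *m U \/ \prod_(a <- s) F a = U *m invmx M.
  rewrite -EM -F'; apply: prod_pair => // -[[l|p]|[l|p]] np np'.
  - by case: (Floop l).
  - apply: contrapT => /Fin [j' Ep Ej]; case/eqP: np'; rewrite Ep /p'.
    by congr (inl (inr (existT _ _ _))); apply: val_inj.
  - by case: (Floop l).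
  - exact: out_out.
case=> ->; split=> [E|->].
- by rewrite -mul_mx_scalar -E mulKVmx.
- by rewrite -scalemxAr mulVmx // scalemx1.
- by rewrite -mul_scalar_mx -E mulmxKV.
- by rewrite -scalemxAl mulmxV // scalemx1.
Qed.

End CrabLegs.

Section GLMore.
Variables (K : fieldType) (n : nat).

Lemma gl_mulE (a b : gl K n) : sval (a * b)%g = sval a *m sval b.
Proof. by []. Qed.

Lemma gl_invE (a : gl K n) : sval (a^-1)%g = invmx (sval a).
Proof. by []. Qed.

(* The identity when [M] is not invertible. *)
Definition gl_of (M : 'M[K]_n) : gl K n := insubd (gl_one K n) M.

Lemma gl_ofE M : M \in unitmx -> sval (gl_of M) = M.
Proof. by move=> uM; rewrite -[sval _]/(val _) val_insubd uM. Qed.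

Lemma unit_swap m (X : 'M[K]_(n, m)) (Y : 'M[K]_(m, n)) : 1%:M + X *m Y \in unitmx ->
  1%:M + Y *m X \in unitmx /\
  invmx (1%:M + Y *m X) = 1%:M - Y *m invmx (1%:M + X *m Y) *m X.
Proof.
set U := 1%:M + X *m Y => uU.
have E : (1%:M + Y *m X) *m (1%:M - Y *m invmx U *m X) = 1%:M.
  have E1 : (1%:M + Y *m X) *m Y = Y *m U by rewrite mulmxDl mulmxDr mul1mx mulmx1 mulmxA.
  rewrite mulmxBr mulmx1 !mulmxA E1 mulmxK // addrK //.
have [u _] := mulmx1_unit E; split=> //.
by apply: (can_inj (mulKmx u)); rewrite mulmxV // E.
Qed.

End GLMore.

Lemma root_prod_big (K : fieldType) n (B : 'M[K]_n) (cs : seq K) :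
  root_prod B cs = \prod_(c <- cs) (B - c%:M).
Proof. by elim: cs => [|c cs IH]; rewrite ?big_nil // big_cons -IH. Qed.

Lemma leg_rep_ext (K : fieldType) m (d : nat -> nat) (xi : nat -> K)
    (phi phi' : forall j, 'M[K]_(d j, d j.+1)) (psi psi' : forall j, 'M[K]_(d j.+1, d j)) C :
  (forall j, (j < m)%N -> phi j = phi' j /\ psi j = psi' j) ->
  leg_rep m xi phi psi C -> leg_rep m xi phi' psi' C.
Proof.
move=> E [H1 H2].
have EL j : (j <= m)%N -> leg_map xi phi psi C j = leg_map xi phi' psi' C j.
  by case: j => [|j] //= jm; have [-> ->] := E j jm.
split=> [j jm|]; last by rewrite -EL.
by rewrite -EL ?H1 ?(ltnW jm) //; have [-> ->] := E j jm.
Qed.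

(** Invertibility travels down the leg: [1 + phi psi] and [1 + psi phi] are invertible together, and
    the latter is a nonzero multiple of the next [1 + phi psi]. Thus legs built from ranks alone
    satisfy the conditions of the localisation. *)
Lemma leg_rep_unit (K : fieldType) m (d : nat -> nat) (xi : nat -> K)
    (phi : forall j, 'M[K]_(d j, d j.+1)) (psi : forall j, 'M[K]_(d j.+1, d j)) C :
  (forall j, (j <= m)%N -> xi j != 0) ->
  leg_rep m xi phi psi C -> C \in unitmx ->
  forall j, (j < m)%N -> 1%:M + phi j *m psi j \in unitmx /\ 1%:M + psi j *m phi j \in unitmx.
Proof.
move=> xi0 [H _] uC.
have uZ k (M : 'M[K]_k) c : c != 0 -> (c *: M \in unitmx) = (M \in unitmx).
  by move=> c0; rewrite -mul_scalar_mx unitmx_mul unitmxE det_scalar unitrX ?unitfE.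
elim=> [|j IH] jm.
  have := H 0%N jm => /= E; move: uC; rewrite E uZ ?xi0 // => u.
  by split=> //; case: (unit_swap u).
have [_ u] := IH (ltnW jm); have E := H j.+1 jm; rewrite /= in E.
have {}u : 1%:M + phi j.+1 *m psi j.+1 \in unitmx.
  by rewrite -(uZ _ _ (xi j.+1)) ?xi0 // -?E ?uZ ?xi0 // ltnW // ltnW.
by split=> //; case: (unit_swap u).
Qed.

(** * The central tuple and the relation at the central vertex *)

Section CrabTuple.
Variables (K : fieldType) (g k n : nat) (A : 'I_k -> GL K n.+1) (xi : 'I_k -> nat -> K).
Notation w := (minpoly_degree A).
Notation Q := (crab g w).
Notation alpha := (crab_dim g A xi).
Notation q := (crab_param g A xi).
Notation delta := (vertex_delta K alpha).
Notation legv i j := (existT (fun i => 'I_(w i).-1) i j : leg_vertex w).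
Notation index := (surface_index g k).
Notation data := (@matrix_data K Q alpha).
Notation legd i := (fun j => alpha (leg_vtx g A i j)).

Hypothesis xi_neq0 : forall i j, (j < w i)%N -> xi i j != 0.
Hypothesis xi_root : forall i, partial_product A xi i (w i) = 0.

Lemma w_gt0 i : (0 < w i)%N.
Proof. exact: mxminpoly_nonconstant. Qed.

Lemma wS i : (w i).-1.+1 = w i.
Proof. by rewrite prednK // w_gt0. Qed.

Lemma xi0 i j : (j <= (w i).-1)%N -> xi i j != 0.
Proof. by move=> jw; apply: xi_neq0; rewrite -wS ltnS. Qed.

Lemma partial_product_root i m : partial_product A xi i m = root_prod (sval (A i)) (mkseq (xi i) m).
Proof.
by rewrite root_prod_big big_map -[in RHS](subn0 m) -/(index_iota 0 m) big_mkord.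
Qed.

Lemma crab_leg_type i : @leg_type K (w i).-1 (legd i) (xi i) (sval (A i)).
Proof.
split=> [[|j] jm|]; first by rewrite /mkseq /= mxrank1.
  rewrite -partial_product_root -[j]/(nat_of_ord (Ordinal jm)).
  by rewrite (leg_vtxS g (Ordinal jm)).
by rewrite wS -partial_product_root.
Qed.

Lemma crab_dim_decr i (j : 'I_(w i).-1) :
  (alpha (Some (legv i j)) <= alpha (leg_vtx g A i j))%N.
Proof.
have [H _] := crab_leg_type i.
rewrite -(leg_vtxS g j) -(H j (ltnW (ltn_ord j))) -(H j.+1 (ltn_ord j)).
rewrite /mkseq -(addn1 (nat_of_ord j)) iotaD map_cat root_prod_cat; exact: mxrankM_maxl.
Qed.

Definition crab_tuple (x : data) (l : index) : gl K n.+1 :=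
  match l with
  | inl (inl i) => gl_of (x (inl (inl i)))
  | inl (inr i) => gl_of (1%:M + x (inl (inl i)) *m x (inr (inl i)))
  | inr j => gl_of (xi j 0 *: (1%:M + leg_phi x j 0 *m leg_psi x j 0))
  end.

Definition central_letter (a : darrow Q) : option index :=
  match a with
  | inl (inl i) => Some (inl (inl i))
  | inr (inl i) => Some (inl (inr i))
  | inl (inr (existT j jo)) => if val jo == 0%N then Some (inr j) else None
  | inr (inr _) => None
  end.

(* A leg without vertices carries no arrow, hence does not occur in the relation
   at the centre; its matrix [C_j] is the scalar [xi_j1]. *)
Definition central_word (s : seq (darrow Q)) : seq index :=
  pmap central_letter s ++ [seq inr j | j <- enum 'I_k & (w j).-1 == 0%N].

(** The scalar by which a coordinate of the tuple differs from the factor in the relation; the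
    product of the weights is the inverse of the parameter at the centre. *)
Definition letter_weight (l : index) : K := if l is inr j then xi j 0 else 1.

Definition surface_atoms : seq (atom_type g k) :=
  map inl (enum 'I_g) ++ map inr (enum 'I_k).

Lemma surface_atoms_uniq : uniq surface_atoms.
Proof.
rewrite cat_uniq; apply/and3P; split.
- by rewrite map_inj_uniq ?enum_uniq // => ? ? [].
- by apply/hasPn => _ /mapP[j _ ->]; apply/negP => /mapP[].
- by rewrite map_inj_uniq ?enum_uniq // => ? ? [].
Qed.

Lemma surface_atoms_letters :
  perm_eq (enum {: index}) (flatten (map (@atom_letters g k) surface_atoms)).
Proof.
have sub : {subset enum {: index} <= flatten (map (@atom_letters g k) surface_atoms)}.
  move=> l _; apply/flatten_mapP; exists (owner l); last by rewrite mem_atom_letters.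
  by rewrite mem_cat; case: l => [[i|i]|j] /=; rewrite map_f ?mem_enum ?orbT.
have szg (t : seq 'I_g) : size (flatten (map (@atom_letters g k) (map inl t))) = (size t).*2.
  by elim: t => //= i t ->.
have szk (t : seq 'I_k) : size (flatten (map (@atom_letters g k) (map inr t))) = size t.
  by elim: t => //= i t ->.
have sz : (size (flatten (map (@atom_letters g k) surface_atoms)) <= size (enum {: index}))%N.
  rewrite -cardT !card_sum !card_ord /surface_atoms map_cat flatten_cat size_cat.
  by rewrite szg szk !size_enum_ord addnn.
have [_ E] := uniq_min_size (enum_uniq _) sub sz.
by apply: uniq_perm => //; [exact: enum_uniq|exact: leq_size_uniq (enum_uniq _) sub sz].
Qed.

Lemma central_letterP a l : central_letter a = Some l ->
  match l with
  | inl (inl i) => a = inl (inl i)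
  | inl (inr i) => a = inr (inl i)
  | inr j => exists2 jo : 'I_(w j).-1, val jo = 0%N & a = inl (inr (legv j jo))
  end.
Proof.
case: a => [[i|[j jo]]|[i|p]] //=; try by case=> <-.
by case: (eqVneq (nat_of_ord jo) 0%N) => // jo0 [<-]; exists jo.
Qed.

Lemma central_letter_inj a b l :
  central_letter a = Some l -> central_letter b = Some l -> a = b.
Proof.
move=> /central_letterP + /central_letterP; case: l => [[i|i] -> ->|j] //.
move=> [jo E ->] [jo' E' ->]; congr (inl (inr (existT _ _ _))).
by apply: val_inj; rewrite E E'.
Qed.

Lemma central_word_perm s : perm_eq s (enum (darrow Q)) ->
  perm_eq (central_word s) (flatten (map (@atom_letters g k) surface_atoms)).
Proof.
move=> ps; apply: perm_trans surface_atoms_letters.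
have us : uniq s by rewrite (perm_uniq ps) enum_uniq.
have mems a : a \in s by rewrite (perm_mem ps) mem_enum.
have memp l : reflect (exists a, central_letter a = Some l) (l \in pmap central_letter s).
  rewrite mem_pmap; apply: (iffP mapP) => [[a _ ->]|[a Ea]]; first by exists a.
  by exists a.
apply: uniq_perm; rewrite ?enum_uniq //.
  rewrite cat_uniq; apply/and3P; split.
  - rewrite -(map_inj_uniq (@Some_inj _)) pmapS_filter map_inj_in_uniq ?filter_uniq //.
    move=> a b; rewrite !mem_filter /=; case Ea: (central_letter a) => [l|] //= _ _ Eb.
    exact: central_letter_inj Ea (esym Eb).
  - apply/hasPn => l /mapP[j]; rewrite mem_filter => /andP[w0 _] ->.
    by apply/negP => /memp[a /central_letterP [jo _ _]]; have := leq_ltn_trans (leq0n _) (ltn_ord jo); rewrite (eqP w0).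
  - by rewrite map_inj_uniq; [apply/filter_uniq/enum_uniq|move=> ? ? []].
move=> l; rewrite mem_enum mem_cat; case: l => [[i|i]|j].
- by apply/orP; left; apply/memp; exists (inl (inl i)).
- by apply/orP; left; apply/memp; exists (inr (inl i)).
case: (posnP (w j).-1) => [w0|wp]; apply/orP; [right|left].
  by rewrite map_f // mem_filter w0 eqxx mem_enum.
by apply/memp; exists (inl (inr (legv j (Ordinal wp)))).
Qed.

Section Data.
Variable x : data.
Hypothesis ux : forall a, loc_block x a \in unitmx.
Hypothesis ul : forall i, x (inl (inl i)) \in unitmx.

Lemma leg_phi_psi_unit j : 1%:M + leg_phi x j 0 *m leg_psi x j 0 \in unitmx.
Proof.
case: (posnP (w j).-1) => [w0|wp].
  by rewrite leg_phi_out ?w0 // mul0mx addr0 unitmx1.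
by have := ux (leg_in g (legv j (Ordinal wp))); rewrite (leg_phi_psi x (Ordinal wp)).
Qed.

Lemma crab_tupleA i : sval (crab_tuple x (inl (inl i))) = x (inl (inl i)).
Proof. exact: (gl_ofE (ul i)). Qed.

Lemma crab_tupleB i : sval (crab_tuple x (inl (inr i))) =
  1%:M + x (inl (inl i)) *m x (inr (inl i)).
Proof. exact: (gl_ofE (ux (inl (inl i)))). Qed.

Lemma crab_tupleC j : sval (crab_tuple x (inr j)) =
  xi j 0 *: (1%:M + leg_phi x j 0 *m leg_psi x j 0).
Proof.
apply: gl_ofE; rewrite -mul_scalar_mx unitmx_mul (leg_phi_psi_unit j) andbT.
by rewrite unitmxE det_scalar unitrX // unitfE xi0.
Qed.

Lemma sval_prod (I : Type) (r : seq I) (F : I -> gl K n.+1) :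
  sval (\prod_(i <- r) F i)%g = \prod_(i <- r) sval (F i).
Proof. by elim: r => [|i r IH]; rewrite ?big_nil // !big_cons -IH. Qed.

Lemma central_letter_block a : extend_block (factor_block x a) None None =
  if central_letter a is Some l
  then (letter_weight l)^-1 *: sval (letter l (crab_tuple x)) else 1%:M :> 'M_n.+1.
Proof.
case: a => [[i|p]|[i|p]].
- by rewrite /= invr1 scale1r crab_tupleB; exact: (@extend_block_head K Q alpha (inl (inl i)) _).
- case: p => j [[|jo] ljo].
    rewrite /letter /central_letter /= crab_tupleC scalerA mulVf ?xi0 // scale1r.
    by rewrite -(leg_phi_psi x (Ordinal ljo)); exact: (@extend_block_head K Q alpha (leg_in g (legv j (Ordinal ljo))) _).
  apply: extend_block_out; rewrite /=.
  by case: insubP => [u _ _ //|]; rewrite (ltnW ljo).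
- rewrite /= invr1 scale1r crab_tupleA crab_tupleB.
  rewrite -[RHS]/(invmx (x (inl (inl i))) *m invmx _ *m x (inl (inl i))).
  transitivity (factor_block x (inr (inl i))).
    exact: (@extend_block_head K Q alpha (inr (inl i)) _).
  rewrite /=; set a := x (inl (inl i)); set b := x (inr (inl i)).
  have ua : a \in unitmx := ul i.
  have uX : 1%:M + a *m b \in unitmx := ux (inl (inl i)).
  have -> : 1%:M + b *m a = invmx a *m (1%:M + a *m b) *m a.
    by rewrite mulmxDr mulmx1 mulmxDl mulVmx // mulmxA mulVmx // mul1mx.
  rewrite invmx_mulmx ?unitmx_mul ?unitmx_inv ?ua // invmx_mulmx ?unitmx_inv // invmxK.
  by rewrite mulmxA.
exact: extend_block_out.
Qed.

Lemma central_word_eval s : perm_eq s (enum (darrow Q)) ->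
  sval (eval_word (central_word s) (crab_tuple x)) =
  (\prod_j xi j 0) *: \prod_(a <- s) extend_block (factor_block x a) None None.
Proof.
move=> ps.
have E1 (t : seq (darrow Q)) : sval (eval_word (pmap central_letter t) (crab_tuple x)) =
   (\prod_(l <- pmap central_letter t) letter_weight l) *:
     \prod_(a <- t) extend_block (factor_block x a) None None.
  elim: t => [|a t IH]; first by rewrite /eval_word !big_nil scale1r.
  rewrite big_cons central_letter_block [pmap _ _]/=.
  case E: (central_letter a) => [l|] /=; last by rewrite mul1r.
  rewrite eval_word_cons big_cons -scalerAl scalerA.
  rewrite gl_mulE IH -[LHS]/(sval (letter l (crab_tuple x)) * _).
  rewrite -scalerAr mulrAC mulfV ?mul1r //.
  by case: (l) => [[?|?]|j] /=; rewrite ?oner_neq0 ?xi0.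
have E2 (t : seq 'I_k) : all (fun j => (w j).-1 == 0%N) t ->
    sval (eval_word (map inr t) (crab_tuple x)) = (\prod_(l <- map inr t) letter_weight l)%:M.
  elim: t => [|j t IH]; first by rewrite /eval_word !big_nil.
  move=> /= /andP[/eqP w0 /IH {}IH]; rewrite eval_word_cons big_cons.
  rewrite gl_mulE IH.
  by rewrite crab_tupleC leg_phi_out ?w0 // mul0mx addr0 scalemx1 -scalar_mxM.
rewrite /central_word eval_word_cat.
rewrite gl_mulE E1 E2; last first.
  by apply/allP => j; rewrite mem_filter => /andP[].
rewrite mul_mx_scalar scalerA mulrC -big_cat /=.
rewrite -/(central_word s) (perm_big _ (central_word_perm ps)) /=; congr (_ *: _).
rewrite big_flatten big_map big_cat !big_map big1; last first.
  by move=> i _; rewrite /atom_letters !big_cons big_nil /= !mul1r.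
by rewrite /= mul1r [index_enum _]unlock; apply: eq_bigr => j _; rewrite /atom_letters big_seq1.
Qed.

Lemma central_relation s : perm_eq s (enum (darrow Q)) ->
  eval_word (central_word s) (crab_tuple x) = 1%g <->
  \prod_(a <- s) extend_block (factor_block x a) None None = (q None)%:M :> 'M_n.+1.
Proof.
move=> ps; have E := central_word_eval ps.
have nz : \prod_j xi j 0 != 0 by apply/prodf_neq0 => j _; apply: xi0.
have Eq : q None = (\prod_j xi j 0)^-1 by rewrite /= prodfV.
split=> [E1|E1].
  rewrite E1 in E; rewrite Eq -scalemx1 [X in _ = _ *: X]E scalerA mulVf //.
  by rewrite scale1r.
by apply: gl_eq; rewrite E E1 Eq -scalemx1 scalerA mulfV // scale1r.
Qed.

End Data.

End CrabTuple.

(** * Representations with a prescribed central tuple *)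

Section CrabData.
Variables (K : fieldType) (g k n : nat) (A : 'I_k -> GL K n.+1) (xi : 'I_k -> nat -> K).
Notation w := (minpoly_degree A).
Notation Q := (crab g w).
Notation alpha := (crab_dim g A xi).
Notation q := (crab_param g A xi).
Notation delta := (vertex_delta K alpha).
Notation legv i j := (existT (fun i => 'I_(w i).-1) i j : leg_vertex w).
Notation index := (surface_index g k).
Notation data := (@matrix_data K Q alpha).
Notation legd i := (fun j => alpha (leg_vtx g A i j)).

Hypothesis xi_neq0 : forall i j, (j < w i)%N -> xi i j != 0.
Hypothesis xi_root : forall i, partial_product A xi i (w i) = 0.
Variable s : seq (darrow Q).
Hypothesis ps : perm_eq s (enum (darrow Q)).

Lemma leg_param_neq0 i (j : 'I_(w i).-1) : xi i j / xi i j.+1 != 0.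
Proof.
by rewrite mulf_neq0 ?invr_eq0 // (xi0 xi_neq0) ?ltn_ord // ltnW.
Qed.

Lemma leg_param i (j : 'I_(w i).-1) : q (leg_vtx g A i j.+1) = xi i j / xi i j.+1.
Proof. by rewrite leg_vtxS. Qed.

Lemma leg_relation (x : data) i (j : 'I_(w i).-1) : data_valid q s x ->
  1%:M + leg_phi x i j.+1 *m leg_psi x i j.+1 =
    (xi i j / xi i j.+1) *: (1%:M + leg_psi x i j *m leg_phi x i j).
Proof.
move=> [ux Hx]; apply/(leg_vertex_relation ps ux j (leg_param_neq0 j)).
by rewrite Hx leg_param.
Qed.

Lemma crab_leg_rep (x : data) i : data_valid q s x ->
  @leg_rep K (w i).-1 (legd i) (xi i) (leg_phi x i) (leg_psi x i)
    (sval (crab_tuple x (inr i))).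
Proof.
move=> vx; have [ux _] := vx.
have E j (jm : (j < (w i).-1)%N) : xi i j.+1 *: (1%:M + leg_phi x i j.+1 *m leg_psi x i j.+1) =
    xi i j *: (1%:M + leg_psi x i j *m leg_phi x i j).
  rewrite -[j]/(nat_of_ord (Ordinal jm)) leg_relation // scalerA mulrCA mulfV ?mulr1 //.
  exact: (xi0 xi_neq0).
have EC : sval (crab_tuple x (inr i)) = xi i 0 *: (1%:M + leg_phi x i 0 *m leg_psi x i 0).
  exact: crab_tupleC.
split=> [[|j] jm|]; [exact: EC|by rewrite /= E // ltnW|].
case Em: (w i).-1 => [|m] /=.
  by rewrite EC leg_phi_out ?Em // mul0mx addr0 scalemx1.
by rewrite -E ?Em // leg_phi_out ?Em // mul0mx addr0 scalemx1.
Qed.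

(** The reverse of a loop [a] is solved from [1 + a b = B], which is possible because [a] is
    invertible. *)
Definition data_of_legs (z : index -> gl K n.+1)
    (phi : forall i j, 'M[K]_(legd i j, legd i j.+1))
    (psi : forall i j, 'M[K]_(legd i j.+1, legd i j)) : data :=
  fun a => match a return 'M[K]_(alpha (dhead a), alpha (dtail a)) with
  | inl (inl i) => sval (z (inl (inl i)))
  | inr (inl i) => invmx (sval (z (inl (inl i)))) *m (sval (z (inl (inr i))) - 1%:M)
  | inl (inr (existT i j)) => phi i j *m delta (leg_vtx g A i j.+1) (Some (legv i j))
  | inr (inr (existT i j)) => delta (Some (legv i j)) (leg_vtx g A i j.+1) *m psi i j
  end.

Lemma crab_data_exists (z : index -> gl K n.+1) :
  (forall i, rank_le (sval (z (inr i))) (sval (A i))) ->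
  eval_word (central_word s) z = 1%g ->
  exists x : data, [/\ data_valid q s x, forall i, x (inl (inl i)) \in unitmx &
    crab_tuple x = z].
Proof.
move=> zA zW.
have leg i : exists pp : (forall j, 'M[K]_(legd i j, legd i j.+1)) *
    (forall j, 'M[K]_(legd i j.+1, legd i j)),
    @leg_rep K (w i).-1 (legd i) (xi i) pp.1 pp.2 (sval (z (inr i))).
  have [|phi [psi H]] := @leg_rep_exists K (w i).-1 (legd i) (xi i) (sval (A i)) (sval (z (inr i))) _
    (crab_leg_type g xi_root i) (zA i).
    by move=> j; apply: (xi0 xi_neq0).
  by exists (phi, psi).
pose phi i := (sval (cid (leg i))).1; pose psi i := (sval (cid (leg i))).2.
have Hleg i : @leg_rep K (w i).-1 (legd i) (xi i) (phi i) (psi i) (sval (z (inr i))).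
  by rewrite /phi /psi; case: cid.
pose x := data_of_legs z phi psi; exists x.
have phiE i (j : 'I_(w i).-1) : leg_phi x i j = phi i j.
  rewrite leg_phiE -[x _]/(phi i j *m delta (leg_vtx g A i j.+1) (Some (legv i j))).
  by rewrite -mulmxA vertex_deltaK ?mulmx1 // leg_vtxS.
have psiE i (j : 'I_(w i).-1) : leg_psi x i j = psi i j.
  rewrite leg_psiE -[x _]/(delta (Some (legv i j)) (leg_vtx g A i j.+1) *m psi i j).
  by rewrite mulmxA vertex_deltaK ?mul1mx // leg_vtxS.
have {}Hleg i : @leg_rep K (w i).-1 (legd i) (xi i) (leg_phi x i) (leg_psi x i) (sval (z (inr i))).
  apply: leg_rep_ext (Hleg i) => j jm.
  by rewrite -[j]/(nat_of_ord (Ordinal jm)) phiE psiE.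
have ul i : x (inl (inl i)) \in unitmx by apply: (svalP (z (inl (inl i)))).
have EX i : 1%:M + x (inl (inl i)) *m x (inr (inl i)) = sval (z (inl (inr i))).
  by rewrite /= mulmxA mulmxV ?ul // mul1mx addrC subrK.
have ux a : loc_block x a \in unitmx.
  have uin i : loc_block x (inl (inl i)) \in unitmx.
    rewrite -[loc_block _ _]/(1%:M + x (inl (inl i)) *m x (inr (inl i))) EX.
    exact: (svalP (z (inl (inr i)))).
  have uleg i (j : 'I_(w i).-1) : loc_block x (leg_in g (legv i j)) \in unitmx.
    rewrite leg_phi_psi.
    have [] // := leg_rep_unit _ (Hleg i) (svalP (z (inr i))) (ltn_ord j).
    by move=> l; apply: (xi0 xi_neq0).
  case: a => [[i|[i j]]|[i|[i j]]].
  - exact: uin.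
  - exact: uleg.
  - exact: (unit_swap (uin i)).1.
  - exact: (unit_swap (uleg i j)).1.
have EC i : xi i 0 *: (1%:M + leg_phi x i 0 *m leg_psi x i 0) = sval (z (inr i)).
  have [H1 H2] := Hleg i; case: (posnP (w i).-1) => [w0|wp].
    rewrite w0 /= in H2; rewrite H2 leg_phi_out ?w0 // mul0mx addr0 scalemx1 //.
  by have := H1 0%N wp.
have Ez : crab_tuple x = z.
  apply/funext => -[[i|i]|i]; apply: gl_eq.
  - exact: crab_tupleA.
  - by rewrite crab_tupleB // EX.
  - by rewrite crab_tupleC // EC.
split=> //; split=> // -[[i j]|].
  rewrite -(leg_vtxS g j) leg_param.
  apply/(leg_vertex_relation ps ux j (leg_param_neq0 j)).
  have [H1 H2] := Hleg i; have x0 := xi0 xi_neq0 (ltn_ord j).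
  apply: (can_inj (scalerK x0)); rewrite scalerA mulrCA mulfV // mulr1.
  case: (ltnP j.+1 (w i).-1) => jm; first by have := H1 j.+1 jm; rewrite /= => <-.
  have Em : (w i).-1 = j.+1 by apply/eqP; rewrite eqn_leq jm ltn_ord.
  rewrite leg_phi_out // mul0mx addr0 scalemx1.
  (* The types depend on the position, so the end [(w i).-1] of the leg is generalised before it is
     identified with [j.+1]. *)
  have key m : m = j.+1 ->
      @leg_map K (legd i) (xi i) (leg_phi x i) (leg_psi x i) (sval (z (inr i))) m = (xi i m)%:M ->
      (xi i j.+1)%:M = xi i j *: (1%:M + leg_psi x i j *m leg_phi x i j).
    by move=> -> /= <-.
  exact: key Em H2.
by apply/(central_relation xi_neq0 ux ul ps); rewrite Ez.
Qed.

End CrabData.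

Section CrabRep.
Variables (K : fieldType) (g k n : nat) (A : 'I_k -> GL K n.+1) (xi : 'I_k -> nat -> K).
Notation w := (minpoly_degree A).
Notation Q := (crab g w).
Notation alpha := (crab_dim g A xi).
Notation q := (crab_param g A xi).
Notation delta := (vertex_delta K alpha).
Notation legv i j := (existT (fun i => 'I_(w i).-1) i j : leg_vertex w).
Notation index := (surface_index g k).
Notation data := (@matrix_data K Q alpha).

Hypothesis xi_neq0 : forall i j, (j < w i)%N -> xi i j != 0.
Variable s : seq (darrow Q).
Hypothesis ps : perm_eq s (enum (darrow Q)).
Notation Y := (mpa_rep' q s alpha None).

Definition rep'_data (y : Y) : data := rep_data (sval y).
Definition rep'_tuple (y : Y) : index -> gl K n.+1 := crab_tuple (rep'_data y).

Lemma rep'_valid y : data_valid q s (rep'_data y).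
Proof. exact: rep_data_valid. Qed.

Lemma rep'_loop y i : rep'_data y (inl (inl i)) \in unitmx.
Proof. exact: (svalP y (inl i) isT). Qed.

Lemma rep'_exists (x : data) : data_valid q s x ->
  (forall i, x (inl (inl i)) \in unitmx) -> exists y : Y, rep'_data y = x.
Proof.
move=> vx ul; have [r Er] := @data_valid_rep K Q q s alpha None isT x vx.
have Hr a : is_loop (None : vertex Q) a -> loop_mx (None : vertex Q) r a \in unitmx.
  case: a => [i _|p] //; have := ul i; rewrite -Er; apply.
by exists (exist _ r Hr).
Qed.

Lemma rep'_conj (y : Y) (P : forall v, GL K (alpha v)) : exists2 y' : Y,
  gl_equivalent y y' &
  forall a, rep'_data y' a = sval (P (dhead a)) *m rep'_data y a *m invmx (sval (P (dtail a))).
Proof.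
pose rho (x : mpa q s) i j := sval (P i) *m sval (sval y) x i j *m invmx (sval (P j)).
have [HD HZ HM H1 H0] := svalP (sval y).
have uP i : sval (P i) \in unitmx by exact: (svalP (P i)).
have rhoP : is_rep rho.
  split=> [x x' i j|c x i j|x x' i j|l|l i j nl]; rewrite /rho.
  - by rewrite HD mulmxDr mulmxDl.
  - by rewrite HZ -scalemxAr -scalemxAl.
  - rewrite HM mulmx_sumr mulmx_suml; apply: eq_bigr => l _.
    by rewrite !mulmxA mulmxKV.
  - by rewrite H1 mulmx1 mulmxV.
  - by rewrite H0 // mulmx0 mul0mx.
pose r : mpa_rep q s alpha := exist _ rho rhoP.
have Hr a : is_loop (None : vertex Q) a -> loop_mx (None : vertex Q) r a \in unitmx.
  move=> la; have := svalP y a la; rewrite /loop_mx /= /rho => u.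
  rewrite unitmx_mul unitmx_inv (uP None) andbT unitmx_mul (uP None).
  exact: u.
by exists (exist _ r Hr); first by exists P.
Qed.

Lemma gl_equivalent_data (y y' : Y) : gl_equivalent y y' ->
  exists P : forall v, GL K (alpha v), forall a,
    rep'_data y' a = sval (P (dhead a)) *m rep'_data y a *m invmx (sval (P (dtail a))).
Proof. by move=> [P HP]; exists P => a; apply: HP. Qed.

Lemma rep'_tuple_conj (y y' : Y) (P : forall v, GL K (alpha v)) :
  (forall a, rep'_data y' a =
     sval (P (dhead a)) *m rep'_data y a *m invmx (sval (P (dtail a)))) ->
  forall l, rep'_tuple y' l = ((P None : gl K n.+1) * rep'_tuple y l * (P None : gl K n.+1)^-1)%g.
Proof.
move=> HP l; have [uy _] := rep'_valid y; have [uy' _] := rep'_valid y'.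
have uP v : sval (P v) \in unitmx by exact: (svalP (P v)).
have key m (X : 'M[K]_(n.+1, m)) (Y : 'M_(m, n.+1)) (R : 'M_m) : R \in unitmx ->
    1%:M + (sval (P None) *m X *m invmx R) *m (R *m Y *m invmx (sval (P None)) ) =
    sval (P None) *m (1%:M + X *m Y) *m invmx (sval (P None)).
  move=> uR; rewrite mulmxDr mulmx1 mulmxDl mulmxV ?(uP None) //.
  by rewrite !mulmxA mulmxKV.
case: l => [[i|i]|j]; apply: gl_eq; rewrite !gl_mulE gl_invE.
- by rewrite !crab_tupleA ?HP //; apply: rep'_loop.
- by rewrite !crab_tupleB // !HP; apply: key (uP None).
rewrite !crab_tupleC // -scalemxAr -scalemxAl; congr (_ *: _).
case: (posnP (w j).-1) => [w0|wp].
  by rewrite !leg_phi_out ?w0 // !mul0mx !addr0 mulmx1 mulmxV ?(uP None).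
have := leg_phi_psi (rep'_data y') (Ordinal wp); have := leg_phi_psi (rep'_data y) (Ordinal wp).
rewrite [nat_of_ord (Ordinal wp)]/= => <- <-.
rewrite -[loc_block (rep'_data y') _]/(1%:M + _ *m _) -[loc_block (rep'_data y) _]/(1%:M + _ *m _).
rewrite !HP; exact: (key _ _ _ _ (uP (Some (legv j (Ordinal wp))))).
Qed.

Lemma rep'_arr_regular a u v : regular (v := Y) (fun y => rep'_data y a u v).
Proof.
apply: gen_coord; left; exists (fun r => rep_data r a u v); split=> //.
by apply: gen_coord; exists (mpa_arr q s a), (dhead a), (dtail a), u, v.
Qed.

Lemma rep'_inv_regular a u v :
  regular (v := Y) (fun y => invmx (loc_block (rep'_data y) a) u v).
Proof.
apply: gen_coord; left.
exists (fun r => rep_val r (free_inv K a) (dhead a) (dhead a) u v); split.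
  by apply: gen_coord; exists (proj (mpa_rel q s) (free_inv K a)), (dhead a), (dhead a), u, v.
by move=> y; case: (rep_loc_unit (sval y) a) => _ ->; rewrite extend_block_head.
Qed.

Lemma rep'_tuple_regular f : regular (v := power index (GL K n.+1)) f ->
  regular (v := Y) (f \o rep'_tuple).
Proof.
apply: generated_comp => h [l [h' [Rh' /funext ->]]].
have uy y : forall a, loc_block (rep'_data y) a \in unitmx by case: (rep'_valid y).
case: l => [[i|i]|j].
- apply: (@gl_regular_comp K n.+1 Y _ (fun y => rep'_tuple y (inl (inl i)))) Rh'.
    move=> u v; have -> : (fun y => sval (rep'_tuple y (inl (inl i))) u v) =
        fun y => rep'_data y (inl (inl i)) u v.
      by apply/funext => y; rewrite crab_tupleA //; apply: rep'_loop.
    exact: rep'_arr_regular.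
  apply: gen_coord; right; exists (inl i); split=> // y.
  by rewrite crab_tupleA //; apply: rep'_loop.
- apply: (@gl_regular_comp K n.+1 Y _ (fun y => rep'_tuple y (inl (inr i)))) Rh'.
    move=> u v; have -> : (fun y => sval (rep'_tuple y (inl (inr i))) u v) =
        fun y => (1%:M : 'M_n.+1) u v +
          (rep'_data y (inl (inl i)) *m rep'_data y (inr (inl i)) : 'M_n.+1) u v.
      by apply/funext => y; rewrite crab_tupleB // mxE.
    apply: gen_add; first exact: gen_const.
    by apply: generated_mulmx => a b; apply: rep'_arr_regular.
  (* The inverse determinant is regular as the determinant of the inverse adjoined by the
     localisation. *)
  have -> : (fun y => (\det (sval (rep'_tuple y (inl (inr i)))))^-1) =
      fun y => \det (invmx (loc_block (rep'_data y) (inl (inl i)))).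
    by apply/funext => y; rewrite crab_tupleB // det_inv.
  by apply: generated_det => a b; apply: rep'_inv_regular.
apply: (@gl_regular_comp K n.+1 Y _ (fun y => rep'_tuple y (inr j))) Rh'.
  move=> u v; have -> : (fun y => sval (rep'_tuple y (inr j)) u v) =
      fun y => xi j 0 * ((1%:M : 'M_n.+1) u v +
        (leg_phi (rep'_data y) j 0 *m leg_psi (rep'_data y) j 0 : 'M_n.+1) u v).
    by apply/funext => y; rewrite crab_tupleC // !mxE.
  apply: gen_mul; first exact: gen_const.
  apply: gen_add; first exact: gen_const.
  case: (posnP (w j).-1) => [w0|wp].
    have -> : (fun y => (leg_phi (rep'_data y) j 0 *m leg_psi (rep'_data y) j 0 : 'M_n.+1) u v) = fun=> 0.
      by apply/funext => y; rewrite leg_phi_out ?w0 // mul0mx mxE.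
    exact: gen_const.
  apply: (@generated_mulmx K Y) => a b.
    have -> : (fun y => leg_phi (rep'_data y) j 0 a b) =
       fun y => (rep'_data y (leg_in g (legv j (Ordinal wp))) *m
         delta (Some (legv j (Ordinal wp))) (leg_vtx g A j 1)) a b.
      by apply/funext => y; rewrite -(leg_phiE _ (Ordinal wp)).
    by apply: generated_mulmx => *; [exact: rep'_arr_regular|exact: gen_const].
  have -> : (fun y => leg_psi (rep'_data y) j 0 a b) =
     fun y => (delta (leg_vtx g A j 1) (Some (legv j (Ordinal wp))) *m
       rep'_data y (leg_out g (legv j (Ordinal wp)))) a b.
    by apply/funext => y; rewrite -(leg_psiE _ (Ordinal wp)).
  by apply: generated_mulmx => *; [exact: gen_const|exact: rep'_arr_regular].
have -> : (fun y => (\det (sval (rep'_tuple y (inr j))))^-1) =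
    fun y => (xi j 0 ^+ n.+1)^-1 *
      (\det (1%:M + leg_phi (rep'_data y) j 0 *m leg_psi (rep'_data y) j 0 : 'M_n.+1))^-1.
  by apply/funext => y; rewrite crab_tupleC // detZ invfM.
apply: gen_mul; first exact: gen_const.
case: (posnP (w j).-1) => [w0|wp].
  have -> : (fun y => (\det (1%:M + leg_phi (rep'_data y) j 0 *m leg_psi (rep'_data y) j 0 : 'M_n.+1))^-1) = fun=> 1.
    by apply/funext => y; rewrite leg_phi_out ?w0 // mul0mx addr0 det1 invr1.
  exact: gen_const.
have -> : (fun y => (\det (1%:M + leg_phi (rep'_data y) j 0 *m leg_psi (rep'_data y) j 0 : 'M_n.+1))^-1) =
    fun y => \det (invmx (loc_block (rep'_data y) (leg_in g (legv j (Ordinal wp))))).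
  by apply/funext => y; rewrite det_inv (leg_phi_psi _ (Ordinal wp)).
by apply: generated_det => a b; apply: rep'_inv_regular.
Qed.

End CrabRep.

(** * Invariants of the base changes along the legs *)

Section CrabInvariants.
Variables (K : numClosedFieldType) (g k n : nat) (A : 'I_k -> GL K n.+1).
Variable xi : 'I_k -> nat -> K.
Notation w := (minpoly_degree A).
Notation Q := (crab g w).
Notation alpha := (crab_dim g A xi).
Notation q := (crab_param g A xi).
Notation delta := (vertex_delta K alpha).
Notation legv i j := (existT (fun i => 'I_(w i).-1) i j : leg_vertex w).
Notation index := (surface_index g k).
Notation data := (@matrix_data K Q alpha).

Hypothesis xi_neq0 : forall i j, (j < w i)%N -> xi i j != 0.
Hypothesis xi_root : forall i, partial_product A xi i (w i) = 0.
Variable s : seq (darrow Q).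
Hypothesis ps : perm_eq s (enum (darrow Q)).
Notation Y := (mpa_rep' q s alpha None).
Notation dat := (@rep'_data K g k n A xi s).
Notation tup := (@rep'_tuple K g k n A xi s).

Definition from_tuple (h : Y -> K) : Prop :=
  exists2 F, regular (v := power index (GL K n.+1)) F & h = F \o tup.

Lemma from_tuple_gen h : generated from_tuple h -> from_tuple h.
Proof.
elim=> [//|c|h1 h2 _ [F1 R1 ->] _ [F2 R2 ->]|h1 h2 _ [F1 R1 ->] _ [F2 R2 ->]].
- by exists (fun=> c) => //; apply: gen_const.
- by exists (fun z => F1 z + F2 z) => //; apply: gen_add.
- by exists (fun z => F1 z * F2 z) => //; apply: gen_mul.
Qed.

Lemma word_entry_from_tuple (F : (index -> gl K n.+1) -> gl K n.+1) u v :
  word_map F -> from_tuple (fun y => sval (F (tup y)) u v).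
Proof.
move=> HF; exists (fun z => sval (F z) u v) => //.
exact: (word_map_regular HF (gl_coord_regular K u v)).
Qed.

(** [L] is the set of leg vertices still to be eliminated. *)
Definition leg_gens (L : {set leg_vertex w}) (h : Y -> K) : Prop :=
  from_tuple h \/ exists2 p, p \in L &
    (exists u v, h = fun y => dat y (leg_in g p) u v) \/
    (exists u v, h = fun y => dat y (leg_out g p) u v).

Lemma leg_gens_tuple L h : from_tuple h -> generated (leg_gens L) h.
Proof. by move=> Hh; apply: gen_coord; left. Qed.

Lemma leg_gens_in (L : {set leg_vertex w}) p u v : p \in L ->
  generated (leg_gens L) (fun y => dat y (leg_in g p) u v).
Proof. by move=> pL; apply: gen_coord; right; exists p => //; left; exists u, v. Qed.

Lemma leg_gens_out (L : {set leg_vertex w}) p u v : p \in L ->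
  generated (leg_gens L) (fun y => dat y (leg_out g p) u v).
Proof. by move=> pL; apply: gen_coord; right; exists p => //; right; exists u, v. Qed.

Lemma leg_gens_phi (L : {set leg_vertex w}) i (j : 'I_(w i).-1) u v : legv i j \in L ->
  generated (leg_gens L) (fun y => leg_phi (dat y) i j u v).
Proof.
move=> pL; have -> : (fun y => leg_phi (dat y) i j u v) = fun y =>
    (dat y (leg_in g (legv i j)) *m delta (Some (legv i j)) (leg_vtx g A i j.+1)) u v.
  by apply/funext => y; rewrite leg_phiE.
by apply: generated_mulmx => *; [exact: leg_gens_in|exact: gen_const].
Qed.

Lemma leg_gens_psi (L : {set leg_vertex w}) i (j : 'I_(w i).-1) u v : legv i j \in L ->
  generated (leg_gens L) (fun y => leg_psi (dat y) i j u v).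
Proof.
move=> pL; have -> : (fun y => leg_psi (dat y) i j u v) = fun y =>
    (delta (leg_vtx g A i j.+1) (Some (legv i j)) *m dat y (leg_out g (legv i j))) u v.
  by apply/funext => y; rewrite leg_psiE.
by apply: generated_mulmx => *; [exact: gen_const|exact: leg_gens_out].
Qed.

Lemma data_units y a : loc_block (dat y) a \in unitmx.
Proof. by case: (rep'_valid y). Qed.

Lemma generated_ext (T : Type) (S : (T -> K) -> Prop) f h :
  f =1 h -> generated S h -> generated S f.
Proof. by move=> /funext ->. Qed.

Lemma leg_inv_generated i j u v : generated (leg_gens setT)
  (fun y => invmx (1%:M + leg_phi (dat y) i j *m leg_psi (dat y) i j) u v).
Proof.
have [m Em] : exists m, ((w i).-1 - j <= m)%N by exists ((w i).-1 - j)%N.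
elim: m j Em u v => [|m IH] j jm u v.
  apply: (@generated_ext _ _ _ (fun=> (1%:M : 'M_(alpha (leg_vtx g A i j))) u v)).
    by move=> y; rewrite leg_phi_out -?subn_eq0 -?leqn0 // mul0mx addr0 invmx1.
  exact: gen_const.
case: (ltnP j (w i).-1) => [lt|ge]; last by apply: IH; lia.
pose jo := Ordinal lt; pose c := xi i j / xi i j.+1.
have IH' u' v' := IH j.+1 (_ : ((w i).-1 - j.+1 <= m)%N) u' v'.
have uy y : 1%:M + leg_phi (dat y) i j *m leg_psi (dat y) i j \in unitmx.
  by have := data_units y (leg_in g (legv i jo)); rewrite leg_phi_psi.
apply: (@generated_ext _ _ _ (fun y => (1%:M : 'M_(alpha (leg_vtx g A i j))) u v +
   - ((leg_phi (dat y) i j *m (c%:M *m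
       invmx (1%:M + leg_phi (dat y) i j.+1 *m leg_psi (dat y) i j.+1))) *m
      leg_psi (dat y) i j) u v)).
  move=> y; have [u1 _] := unit_swap (uy y); have [_ ->] := unit_swap u1.
  have c0 : c != 0 := leg_param_neq0 xi_neq0 jo.
  have := leg_relation xi_neq0 ps jo (rep'_valid y); rewrite [nat_of_ord jo]/= -/c => ->.
  rewrite invmxZ; last by rewrite -mul_scalar_mx unitmx_mul u1 andbT unitmxE det_scalar unitrX ?unitfE.
  by rewrite -mul_scalar_mx (mulmxA c%:M) -scalar_mxM mulfV // mul1mx !mxE.
apply: gen_add; first exact: gen_const.
apply: generated_opp; apply: generated_mulmx => u' v'; last exact: (@leg_gens_psi _ i jo).
apply: generated_mulmx => a b; first exact: (@leg_gens_phi _ i jo).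
apply: generated_mulmx => a' b'; first exact: gen_const.
by apply: IH'; lia.
Qed.

Lemma rep'_generated f : regular (v := Y) f -> generated (leg_gens setT) f.
Proof.
have unit_entry i u v : generated (leg_gens setT) (fun y => invmx (dat y (inl (inl i)) : 'M_n.+1) u v).
  apply: (@generated_ext _ _ _ (fun y => sval ((tup y (inl (inl i)))^-1)%g u v)).
    by move=> y; rewrite gl_invE crab_tupleA //; apply: rep'_loop.
  apply: leg_gens_tuple; apply: (@word_entry_from_tuple (fun z => (z (inl (inl i)))^-1)%g).
  exact/word_inv/word_coord.
have Harr a u v : generated (leg_gens setT) (fun y => dat y a u v).
  case: a u v => [[i|p]|[i|p]] u v.
  - apply: (@generated_ext _ _ _ (fun y => sval (tup y (inl (inl i))) u v)).
      by move=> y; rewrite crab_tupleA //; apply: rep'_loop.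
    apply: leg_gens_tuple; apply: (@word_entry_from_tuple (fun z => z (inl (inl i)))).
    exact: word_coord.
  - exact: leg_gens_in.
  - apply: (@generated_ext _ _ _ (fun y => (invmx (dat y (inl (inl i)) : 'M_n.+1) *m
        (sval (tup y (inl (inr i))) - 1%:M)) u v)).
      move=> y; rewrite crab_tupleB; last exact: data_units.
      by rewrite addrAC subrr add0r mulKmx //; apply: rep'_loop.
    apply: generated_mulmx => a b; first exact: unit_entry.
    apply: (@generated_ext _ _ _ (fun y => sval (tup y (inl (inr i))) a b + - (1%:M : 'M_n.+1) a b)).
      by move=> y; rewrite !mxE.
    apply: gen_add; last exact: gen_const.
    apply: leg_gens_tuple; apply: (@word_entry_from_tuple (fun z => z (inl (inr i)))).
    exact: word_coord.
  - exact: leg_gens_out.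
have Hin i (j : 'I_(w i).-1) u v : generated (leg_gens setT)
    (fun y => invmx (loc_block (dat y) (leg_in g (legv i j))) u v).
  apply: (@generated_ext _ _ _ (fun y => invmx (1%:M + leg_phi (dat y) i j *m leg_psi (dat y) i j) u v)).
    by move=> y; rewrite leg_phi_psi.
  exact: leg_inv_generated.
have Hinv a u v : generated (leg_gens setT) (fun y => invmx (loc_block (dat y) a) u v).
  case: a u v => [[i|[i j]]|[i|[i j]]] u v.
  - apply: (@generated_ext _ _ _ (fun y => sval ((tup y (inl (inr i)))^-1)%g u v)).
      by move=> y; rewrite gl_invE crab_tupleB //; apply: data_units.
    apply: leg_gens_tuple; apply: (@word_entry_from_tuple (fun z => (z (inl (inr i)))^-1)%g).
    exact/word_inv/word_coord.
  - exact: Hin.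
  - apply: (@generated_ext _ _ _ (fun y => sval (letter (inl (inr i)) (tup y)) u v)).
      move=> y; have uy := data_units y; have ul := rep'_loop y.
      have := central_letter_block xi_neq0 uy ul (inr (inl i)).
      rewrite [X in X = _](@extend_block_head K Q alpha (inr (inl i)) _) => E.
      by rewrite -[invmx _]/(factor_block (dat y) (inr (inl i))) E /= invr1 scale1r.
    by apply: leg_gens_tuple; apply/word_entry_from_tuple/word_map_letter.
  apply: (@generated_ext _ _ _ (fun y => (1%:M : 'M_(alpha (Some (legv i j)))) u v +
     - ((dat y (leg_out g (legv i j)) *m
         invmx (loc_block (dat y) (leg_in g (legv i j)))) *m dat y (leg_in g (legv i j))) u v)).
    move=> y; have u1 := data_units y (leg_in g (legv i j)).
    have [_ E] := unit_swap u1; rewrite -[loc_block _ (inr _)]/(1%:M + _ *m _) E.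
    by rewrite [LHS]mxE [X in _ + X = _]mxE.
  apply: gen_add; first exact: gen_const.
  apply: generated_opp; apply: generated_mulmx => a b; last exact: leg_gens_in.
  by apply: generated_mulmx => a' b'; [exact: leg_gens_out|exact: Hin].
apply: generated_sub => h [[h' [Rh' /funext ->]]|[[i|p] [la /funext ->]]] //.
  exact: (mpa_rep_generated Harr Hinv Rh').
apply: leg_gens_tuple; exists (fun z => (\det (sval (z (inl (inl i)))))^-1).
  exact: (power_coord_regular (inl (inl i)) (gl_detV_regular K n.+1)).
by apply/funext => y; rewrite /= crab_tupleA //; apply: rep'_loop.
Qed.

Definition down_closed (L : {set leg_vertex w}) : Prop :=
  forall i (j j' : 'I_(w i).-1), legv i j \in L -> (j' < j)%N -> legv i j' \in L.

(** The products left by the first fundamental theorem are not new generators: the relation at the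
    preceding vertex expresses them through its own arrows, and at the first vertex they come from
    the matrix C_i of the tuple. *)
Lemma leg_product_generated (L : {set leg_vertex w}) i (j : 'I_(w i).-1) u v :
  (forall j' : 'I_(w i).-1, val j = (val j').+1 -> legv i j' \in L) ->
  generated (leg_gens L) (fun y =>
    (dat y (leg_in g (legv i j)) *m dat y (leg_out g (legv i j))) u v).
Proof.
have phi_psi y (l : 'I_(w i).-1) : dat y (leg_in g (legv i l)) *m dat y (leg_out g (legv i l)) =
    leg_phi (dat y) i l *m leg_psi (dat y) i l.
  have := leg_phi_psi (dat y) l; rewrite -[loc_block _ _]/(1%:M + _ *m _).
  exact: addrI.
case: j u v => [[|j] lj] u v Hj.
  apply: (@generated_ext _ _ _ (fun y => (xi i 0)^-1 * sval (tup y (inr i)) u v + - (1%:M : 'M_n.+1) u v)).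
    move=> y; rewrite phi_psi crab_tupleC //; last exact: data_units.
    rewrite [in RHS]mxE mulrA mulVf ?(xi0 xi_neq0) // mul1r [in RHS]mxE addrAC subrr add0r //.
  apply: gen_add; last exact: gen_const.
  apply: gen_mul; first exact: gen_const.
  apply: leg_gens_tuple; apply: (@word_entry_from_tuple (fun z => z (inr i))).
  exact: word_coord.
pose j' := Ordinal (ltnW lj); have pL : legv i j' \in L by apply: Hj.
apply: (@generated_ext _ _ _ (fun y => (xi i j / xi i j.+1) * ((1%:M : 'M_(alpha (leg_vtx g A i j.+1))) u v +
    (leg_psi (dat y) i j' *m leg_phi (dat y) i j') u v) + - (1%:M : 'M_(alpha (leg_vtx g A i j.+1))) u v)).
  move=> y; rewrite phi_psi.
  have := leg_relation xi_neq0 ps j' (rep'_valid y).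
  rewrite [nat_of_ord j']/= => /(congr1 (fun M : 'M_(alpha (leg_vtx g A i j.+1)) => M u v)).
  rewrite !mxE => <-; rewrite addrAC subrr add0r //.
apply: gen_add; last exact: gen_const.
apply: gen_mul; first exact: gen_const.
apply: gen_add; first exact: gen_const.
by apply: generated_mulmx => a b; [exact: (@leg_gens_psi L i j')|exact: (@leg_gens_phi L i j')].
Qed.

(* By maximality of [p], a base change at [p] affects no other generator. *)
Lemma eliminate_leg_vertex (L : {set leg_vertex w}) p f :
  down_closed L -> p \in L -> (forall p', p' \in L -> (tagged p' <= tagged p)%N) ->
  (forall y y', gl_equivalent y y' -> f y = f y') ->
  generated (leg_gens L) f -> generated (leg_gens (L :\ p)) f.
Proof.
case: p => i j Ldown pL pmax finv Hf; set p := existT _ i j in pL pmax *.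
have r_le : (alpha (Some p) <= alpha (leg_vtx g A i j))%N by apply: crab_dim_decr.
pose phi (y : Y) : 'M[K]_(alpha (leg_vtx g A i j), alpha (Some p)) := dat y (leg_in g p).
pose psi (y : Y) : 'M[K]_(alpha (Some p), alpha (leg_vtx g A i j)) := dat y (leg_out g p).
have act y (h : 'M_(alpha (Some p))) : h \in unitmx -> exists y', [/\ phi y' = phi y *m invmx h,
    psi y' = h *m psi y, forall t, leg_gens (L :\ p) t -> t y' = t y & f y' = f y].
  move=> uh; pose P v : GL K (alpha v) := gl_of (@extend_block K Q alpha (leg_out g p) h v v).
  have EP v : sval (P v) = @extend_block K Q alpha (leg_out g p) h v v.
    by apply: gl_ofE; case: (@extend_block_unit K Q alpha (leg_out g p) h v uh).
  have Pp : sval (P (Some p)) = h.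
    by rewrite EP; apply: (@extend_block_head K Q alpha (leg_out g p) h).
  have Pout v : v != Some p -> sval (P v) = 1%:M by move=> nv; rewrite EP extend_block_out.
  (* An arrow ending at [p] starts one vertex further out, against the maximality of [p]. *)
  have nhead p' : p' \in L -> crab_head (inr p' : crab_arrow g w) != Some p.
    case: p' => i' j' p'L; apply/eqP => E.
    have [l El Ej] := @leg_vtx_eq K g k n A i i' j j' (esym E).
    have := pmax _ p'L; rewrite El /= -[nat_of_ord l]/(val l) Ej ltnn //.
  have [y' yy' Ey'] := rep'_conj y P; exists y'; split.
  - rewrite /phi Ey' /= -/p Pp (Pout _ (nhead p pL)) mul1mx //.
  - by rewrite /psi Ey' /= -/p Pp (Pout _ (nhead p pL)) invmx1 mulmx1.
  - have out p' : p' \in L :\ p -> dat y' (leg_in g p') = dat y (leg_in g p') /\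
        dat y' (leg_out g p') = dat y (leg_out g p').
      rewrite in_setD1 => /andP[np' p'L].
      have n' : Some p' != Some p :> vertex Q by apply: contraNneq np' => -[->].
      by rewrite !Ey' /= (Pout _ n') (Pout _ (nhead p' p'L)) !invmx1 !mul1mx !mulmx1.
    move=> t [[F _ ->]|[p' /out [E1 E2] [[u [v ->]]|[u [v ->]]]]]; [|by rewrite E1|by rewrite E2].
    rewrite /=; congr F; apply/funext => l; rewrite (rep'_tuple_conj xi_neq0 Ey').
    have -> : (P None : gl K n.+1) = 1%g by apply: gl_eq; exact: (Pout None isT).
    by rewrite mul1g invg1 mulg1.
  - by rewrite (finv _ _ yy').
have Hf' : generated (fun h => [\/ leg_gens (L :\ p) h, exists a b, h = fun y => phi y a b |
     exists a b, h = fun y => psi y a b]) f.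
  apply: generated_sub Hf => h [Th|[p' p'L Hh]]; first by apply: gen_coord; apply: Or31; left.
  apply: gen_coord; have [Ep|np] := eqVneq p' p.
    by move: Hh; rewrite Ep => -[[u [v ->]]|[u [v ->]]]; [apply: Or32; exists u, v|apply: Or33; exists u, v].
  apply: Or31; right; exists p' => //; rewrite in_setD1 np p'L //.
apply: generated_sub (relative_invariants r_le act Hf') => h [Hh|[a [b ->]]]; first exact: gen_coord.
apply: leg_product_generated => j' Ej; rewrite in_setD1; apply/andP; split.
  apply/eqP => /(congr1 (fun p : leg_vertex w => nat_of_ord (tagged p))) /= E.
  by move: Ej; rewrite /= -E => /n_Sn.
by apply: (Ldown _ j) => //; rewrite -[nat_of_ord j]/(val j) Ej.
Qed.

Lemma invariant_from_tuple f : regular (v := Y) f ->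
  (forall y y', gl_equivalent y y' -> f y = f y') -> from_tuple f.
Proof.
move=> Rf finv; apply: from_tuple_gen.
suff H m (L : {set leg_vertex w}) : (#|L| <= m)%N -> down_closed L ->
    generated (leg_gens L) f -> generated from_tuple f.
  apply: (H _ setT (leqnn _)); last exact: rep'_generated.
  by move=> *; rewrite in_setT.
elim: m L => [|m IH] L.
  rewrite leqn0 cards_eq0 => /eqP -> _; apply: generated_sub => h [Th|[p]].
    exact: gen_coord.
  by rewrite in_set0.
move=> Lm Ldown Gf; have [L0|/set0Pn[p0 p0L]] := eqVneq L set0.
  by apply: (IH L) => //; rewrite L0 cards0.
(* A vertex at maximal distance from the centre can be removed without destroying down-closure. *)
case: (arg_maxnP (fun p : leg_vertex w => nat_of_ord (tagged p)) p0L) => p pL pmax.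
have {}pL : p \in L by exact: pL.
apply: (IH (L :\ p)).
- by move: Lm; rewrite (cardsD1 p L) pL.
- move=> i j j'; rewrite !in_setD1 => /andP[np jL] lt; rewrite (Ldown _ _ _ jL lt) andbT.
  apply/eqP => Ep; have := pmax _ jL; rewrite -Ep /= leqNgt lt //.
exact: eliminate_leg_vertex.
Qed.

End CrabInvariants.

Lemma surface_relation (K : fieldType) g k n (x : surface_index g k -> GL K n.+1) :
  (\prod_(i < g) (matA x i * matB x i * (matA x i)^-1 * (matB x i)^-1)) *
    (\prod_(j < k) matC x j) = 1 <->
  (\prod_(t <- surface_atoms g k) atom t (x : surface_index g k -> gl K n.+1))%g = 1%g.
Proof.
have E : sval (\prod_(t <- surface_atoms g k) atom t (x : surface_index g k -> gl K n.+1))%g =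
    (\prod_(i < g) (matA x i * matB x i * (matA x i)^-1 * (matB x i)^-1)) *
    (\prod_(j < k) matC x j).
  rewrite /surface_atoms big_cat !big_map gl_mulE !sval_prod.
  by rewrite ![index_enum _]unlock.
by split=> [E1|E1]; [apply: gl_eq; rewrite E|rewrite -E E1].
Qed.

(** * The isomorphism of the quotients *)

Section Assembly.
Variables (K : numClosedFieldType) (g k n : nat).
Variables (Cl : 'I_k -> GL K n.+1 -> Prop) (A : 'I_k -> GL K n.+1) (xi : 'I_k -> nat -> K).
Variable s : seq (darrow (crab g (minpoly_degree A))).
Hypothesis Cl_class : forall i, conjugacy_class (Cl i).
Hypothesis Cl_A : forall i, Cl i (A i).
Hypothesis xi_neq0 : forall i j, (j < minpoly_degree A i)%N -> xi i j != 0.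
Hypothesis xi_root : forall i, partial_product A xi i (minpoly_degree A i) = 0.
Hypothesis ps : perm_eq s (enum (darrow (crab g (minpoly_degree A)))).
Notation index := (surface_index g k).
Notation X := (surface_rep g Cl).
Notation Y := (mpa_rep' (crab_param g A xi) s (crab_dim g A xi) None).
Notation tup := (@rep'_tuple K g k n A xi s).

Lemma class_closure i B : zariski_closure (Cl i) B <-> rank_le (sval B) (sval (A i)).
Proof.
exact: (@leg_closure K _ (fun j => crab_dim g A xi (leg_vtx g A i j)) (xi i) (Cl i) (A i) B
  (Cl_class i) (Cl_A i) (crab_leg_type g xi_root i)).
Qed.

Lemma tuple_rank_le (y : Y) i : rank_le (sval (tup y (inr i))) (sval (A i)).
Proof.
apply: (@leg_rep_rank_le K _ (fun j => crab_dim g A xi (leg_vtx g A i j)) (xi i) _ _ _ _ _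
  (crab_leg_type g xi_root i) (crab_leg_rep xi_neq0 ps i (rep'_valid y))).
by move=> j; apply: (xi0 xi_neq0).
Qed.

Lemma gl_similar (B P : gl K n.+1) : similarmx (sval B) (sval (P * B * P^-1)%g).
Proof. by exists (sval P); first exact: (svalP P). Qed.

(** The map is [tup] followed by [th], which trades the word relation imposed by the ordering [s]
    for the surface relation. As [th] and its inverse are given by words, they are regular and
    equivariant, so the conditions on the map can be checked on [tup]. *)
Lemma quotient_isomorphic :
  isomorphic (character_variety g Cl)
    (mpa_quotient (crab g (minpoly_degree A)) (crab_param g A xi) s (crab_dim g A xi) None).
Proof.
have [th [th' [au E _]]] := @normalize_word (gl K n.+1) g k (surface_atoms g k) (central_word s)
  (surface_atoms_uniq g k) (central_word_perm ps).
have [can can' wth wth' cl] := au.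
have th_conj z (P : gl K n.+1) l : th (fun i => (P * z i * P^-1)%g) l = (P * th z l * P^-1)%g.
  exact: (word_map_conj P z (wth l)).
have pull (t : (index -> gl K n.+1) -> index -> gl K n.+1) f :
    (forall l, word_map (fun z => t z l)) ->
    regular (v := power index (GL K n.+1)) f -> regular (v := power index (GL K n.+1)) (f \o t).
  move=> wt; apply: generated_comp => h [l [h' [Rh' /funext ->]]].
  exact: (word_map_regular (wt l) Rh').
have pP (y : Y) : (forall j, zariski_closure (Cl j) (th (tup y) (inr j))) /\
    (\prod_(i < g) (matA (th (tup y)) i * matB (th (tup y)) i *
        (matA (th (tup y)) i)^-1 * (matB (th (tup y)) i)^-1)) *
      (\prod_(j < k) matC (th (tup y)) j) = 1.
  split=> [j|].
    apply/class_closure; have [P ->] := cl (tup y) j.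
    exact: (rank_le_similar (gl_similar _ P) (tuple_rank_le y j)).
  apply/surface_relation; rewrite -E.
  have [uy Hy] := rep'_valid y.
  apply/(central_relation xi_neq0 uy (rep'_loop y) ps).
  exact: (Hy None).
pose p (y : Y) : X := exist _ (th (tup y)) (pP y).
apply: (@git_quotient_isomorphic K X Y _ _ p).
- move=> f [h [Rh /funext ->]].
  exact: (@rep'_tuple_regular K g k n A xi xi_neq0 s _ (pull _ _ wth Rh)).
- move=> y y' /gl_equivalent_data [P HP]; exists (P None) => l.
  have Et : tup y' = fun i => ((P None : gl K n.+1) * tup y i * (P None : gl K n.+1)^-1)%g.
    by apply/funext => i; apply: rep'_tuple_conj.
  by rewrite /= Et th_conj.
(* Surjectivity: [th'] changes the puncture matrices only within their classes, so the rank
   conditions hold for [th' x] and legs exist. *)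
- case=> x [cx Px].
  have [||z [vz uz Ez]] := @crab_data_exists K g k n A xi xi_neq0 xi_root s ps (th' x).
  + move=> i; have := cl (th' x) i; rewrite can' => -[P EP].
    have /class_closure := cx i; rewrite EP; apply: rank_le_similar.
    exact/similarmx_sym/gl_similar.
  + by rewrite E can'; apply/surface_relation.
  have [y Ey] := rep'_exists vz uz; exists y; apply: sig_eq => /=.
  by rewrite /rep'_tuple Ey Ez can'.
- move=> y x' [P HP].
  (* An orbit is lifted by conjugating at the centre and leaving the leg spaces alone. *)
  pose P' v : GL K (crab_dim g A xi v) :=
    match v return GL K (crab_dim g A xi v) with None => P | Some _ => gl_one K _ end.
  have [y' yy' Ey'] := rep'_conj y P'; exists y' => //.
  apply: sig_eq => /=; apply/funext => l; apply: gl_eq; rewrite HP.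
  have -> : tup y' = fun i => ((P : gl K n.+1) * tup y i * (P : gl K n.+1)^-1)%g.
    by apply/funext => i; apply: (rep'_tuple_conj xi_neq0 Ey').
  by rewrite th_conj.
move=> h Rh hinv.
have [F RF ->] := invariant_from_tuple xi_neq0 xi_root ps Rh hinv.
exists (fun x : X => (F \o th') (sval x)).
  by exists (F \o th'); split=> //; apply: pull.
by move=> y /=; rewrite can.
Qed.

End Assembly.

(* The complex numbers are [R[i]] for [R] a model of the reals. *)
Theorem theorem3p6 (R : realType) (g k n : nat)
    (Cl : 'I_k -> GL R[i] n.+1 -> Prop)
    (A : 'I_k -> GL R[i] n.+1)
    (xi : 'I_k -> nat -> R[i])
    (s : seq (darrow (crab g (minpoly_degree A)))) :
  (forall i, conjugacy_class (Cl i)) ->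
  (forall i, Cl i (A i)) ->
  (forall i j, (j < minpoly_degree A i)%N -> xi i j != 0) ->
  (forall i, partial_product A xi i (minpoly_degree A i) = 0) ->
  perm_eq s (enum (darrow (crab g (minpoly_degree A)))) ->
  isomorphic (character_variety g Cl)
    (mpa_quotient (crab g (minpoly_degree A))
       (crab_param g A xi) s (crab_dim g A xi) None).
Proof. exact: quotient_isomorphic. Qed.
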